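(* The problem \[ M\Big(\iint_{\mathbb{R}^6}\frac{|u(x)-u(y)|^2}{|x-y|^{3+2s}}dxdy+\int_{\mathbb{R}^3}V_0u^2dx\Big)\big[(-\Delta)^su+V_0u\big]=f(u)\quad\text{in }\mathbb{R}^3 \] admits a positive solution.
   Context: $s\in(\frac34,1)$, $(-\Delta)^s$ is the fractional Laplacian on $\mathbb{R}^3$, $V_0>0$ is a constant; solutions are weak solutions in $H^s(\mathbb{R}^3)$. $M:[0,\infty)\to[0,\infty)$ continuous with $(M_1)$ $M(t)\ge m_0>0$ for $t\ge0$; $(M_2)$ $M$ increasing; $(M_3)$ $\frac{M(t_1)}{t_1}-\frac{M(t_2)}{t_2}\le m_0(\frac1{t_1}-\frac1{t_2})$ for $t_1\ge t_2>0$. $f:\mathbb{R}\to\mathbb{R}$ continuous, $f=0$ on $(-\infty,0)$, $F(t)=\int_0^tf$, with $(f_1)$ $f(t)/t^3\to0$ as $t\to0^+$; $(f_2)$ $f(t)/t^{q-1}\to0$ as $t\to\infty$ for some $q\in(4,\frac6{3-2s})$; $(f_3)$ $0<\vartheta F(t)\le f(t)t$ for $t>0$, some $\vartheta\in(4,\frac6{3-2s})$; $(f_4)$ $f(t)/t^3$ nondecreasing on $(0,\infty)$. *)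

(* Defs.v *)
From HB Require Import structures.
From mathcomp Require Import all_boot all_order all_algebra.
From mathcomp Require Import all_classical all_reals all_analysis.
Set Implicit Arguments. Unset Strict Implicit. Unset Printing Implicit Defensive.
Import Order.TTheory GRing.Theory Num.Theory.
Import numFieldNormedType.Exports.
Local Open Scope classical_set_scope.
Local Open Scope ring_scope.

Notation R3 R := ((R * R) * R)%type.

Section ProdSigmaFinite.
Local Open Scope ereal_scope.
Context d1 d2 (T1 : measurableType d1) (T2 : measurableType d2) (R : realType).
Variable m1 : sigma_finite_measure T1 R.
Variable m2 : sigma_finite_measure T2 R.
Lemma prod_sigma_finite : sigma_finite setT (m1 \x m2).
Proof.
have /sigma_finiteP[F [TF ndF Foo]] := sigma_finiteT m1.
have /sigma_finiteP[G [TG ndG Goo]] := sigma_finiteT m2.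
exists (fun n => F n `*` G n).
 rewrite -setXTT TF TG predeqE => -[x y]; split.
    move=> [/= [n _ Fnx] [k _ Gky]]; exists (maxn n k) => //; split.
    - by move: x Fnx; exact/subsetPset/ndF/leq_maxl.
    - by move: y Gky; exact/subsetPset/ndG/leq_maxr.
  by move=> [n _ []/= ? ?]; split; exists n.
move=> k; have [? ?] := Foo k; have [? ?] := Goo k.
split; first exact: measurableX.
by rewrite product_measure1E// lte_mul_pinfty// ge0_fin_numE.
Qed.
End ProdSigmaFinite.

Definition leb2 (R : realType) :=
  product_measure1 (@lebesgue_measure R) (@lebesgue_measure R).
HB.instance Definition _ (R : realType) := Measure.on (@leb2 R).
HB.instance Definition _ (R : realType) :=
  Measure_isSigmaFinite.Build _ _ _ (@leb2 R)
    (@prod_sigma_finite _ _ _ _ _ (@lebesgue_measure R) (@lebesgue_measure R)).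

Definition leb3 (R : realType) :=
  product_measure1 (@leb2 R) (@lebesgue_measure R).
HB.instance Definition _ (R : realType) := Measure.on (@leb3 R).
HB.instance Definition _ (R : realType) :=
  Measure_isSigmaFinite.Build _ _ _ (@leb3 R)
    (@prod_sigma_finite _ _ _ _ _ (@leb2 R) (@lebesgue_measure R)).

Definition leb6 (R : realType) := product_measure1 (@leb3 R) (@leb3 R).
HB.instance Definition _ (R : realType) := Measure.on (@leb6 R).
HB.instance Definition _ (R : realType) :=
  Measure_isSigmaFinite.Build _ _ _ (@leb6 R)
    (@prod_sigma_finite _ _ _ _ _ (@leb3 R) (@leb3 R)).

Definition dist3 (R : realType) (x y : R3 R) : R :=
  Num.sqrt ((x.1.1 - y.1.1) ^+ 2 + (x.1.2 - y.1.2) ^+ 2 + (x.2 - y.2) ^+ 2).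

Definition gag_integrand (R : realType) (s : R) (u v : R3 R -> R)
  (z : R3 R * R3 R) : R :=
  (u z.1 - u z.2) * (v z.1 - v z.2) / (dist3 z.1 z.2 `^ (3 + 2 * s)).

Definition gagliardo2 (R : realType) (s : R) (u : R3 R -> R) : \bar R :=
  (\int[@leb6 R]_z (gag_integrand s u u z)%:E)%E.

Definition Hs (R : realType) (s : R) (u : R3 R -> R) : Prop :=
  measurable_fun setT u /\
  (\int[@leb3 R]_x ((u x) ^+ 2)%:E < +oo)%E /\
  (gagliardo2 s u < +oo)%E.

Definition normV (R : realType) (s V0 : R) (u : R3 R -> R) : R :=
  Rintegral (@leb6 R) setT (gag_integrand s u u)
  + Rintegral (@leb3 R) setT (fun x => V0 * (u x) ^+ 2).

(* Weak solution in H^s(R^3) of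
   M(||u||^2) [(-Delta)^s u + V0 u] = f(u) in R^3:
   for every test function phi in H^s(R^3),
   M(||u||^2) ( \iint (u(x)-u(y))(phi(x)-phi(y))/|x-y|^(3+2s)
                + \int V0 u phi ) = \int f(u) phi. *)
Definition weak_solution (R : realType) (s V0 : R) (M f : R -> R)
  (u : R3 R -> R) : Prop :=
  Hs s u /\
  forall phi : R3 R -> R, Hs s phi ->
    M (normV s V0 u) *
      (Rintegral (@leb6 R) setT (gag_integrand s u phi)
       + Rintegral (@leb3 R) setT (fun x => V0 * u x * phi x))
    = Rintegral (@leb3 R) setT (fun x => f (u x) * phi x).

Definition positive_ae (R : realType) (u : R3 R -> R) : Prop :=
  {ae @leb3 R, forall x, 0 < u x}.

Definition primF (R : realType) (f : R -> R) (t : R) : R :=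
  Rintegral (@lebesgue_measure R) `[0, t] f.

(* Main.v *)
(* The energy [I u = (1/2) \int_0^(N u) M - \int F(u)] is minimized over the Nehari set
   [g u := M (N u) N u - \int f(u) u = 0], [u <> 0], without using any differentiability of [g].

   By (M3) and (f4), [I (t u) + (1 - t^4)/4 g u + (m0/4) (1 - t^2)^2 N u <= I u] for [t >= 0]. Hence
   if [u] is an almost minimizer, the ray through [u + e phi] crosses the Nehari set at some [t]
   close to 1, and [I (t (u + e phi)) >= inf I] combined with the convexity of the primitives of
   [M] and [f] bounds the directional derivative of [I] at [t u] from below by [-e].

   Minimizing sequences are bounded, since [I - g/4 >= (m0/4) N], and do not vanish in the sense of
   Lions; after translation they converge almost everywhere, along a subsequence, to some [u <> 0].
   The limit satisfies the equation with [M (N u)] replaced by [M A], [A = lim N (u_ n) >= N u].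
   Then [g u <= 0], so [t u] is on the Nehari set for some [t] in (0,1], and
   [inf I <= I (t u) <= I u - g u / 4 <= inf I - c (A - N u)], the last step by Fatou's lemma;
   therefore [A = N u].

   The embedding into [L^q] and the local compactness are obtained from averages over dyadic cubes.
   Positivity: testing with the negative part gives [u >= 0]; testing with [(e eta - u)^+] and
   letting [e] tend to 0 shows that [u x * eta y] vanishes for almost all [(x, y)] with [u y = 0]. *)

Require Import Defs.
From HB Require Import structures.
From mathcomp Require Import all_boot all_order all_algebra.
From mathcomp Require Import all_classical all_reals all_analysis.
From mathcomp Require Import measurable_realfun zify ring lra.
Import Order.TTheory GRing.Theory Num.Theory.
Import numFieldNormedType.Exports.
Local Open Scope classical_set_scope.
Local Open Scope ring_scope.
Set Implicit Arguments. Unset Strict Implicit. Unset Printing Implicit Defensive.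

(** * Integration *)

(** [M] and [f] are merely continuous, so the Nehari set need not be a manifold and there is no
    multiplier to compute; every derivative is replaced by a one-sided inequality coming from the
    monotonicity of [M] and [f]. The number 4 is the critical degree along rays: by (M3) [M t - m0]
    grows at most linearly, so [M (N u) * N u] has degree at most 4 for large multiples of [u],
    while (f4) gives [f (u) * u] degree at least 4. The excess [m0] in [M] has lower degree, and
    this produces the strict term [(1 - t^2)^2]. The obstacle is the nonlocal coefficient [M (N u)]:
    the norm is only lower semicontinuous along the sequence, so the limit equation first carries a
    number [A] that must be identified afterwards. Weak convergence is derived from almost
    everywhere convergence and norm bounds, and one ultrafilter on [nat] provides all limits at
    once, those of the norms and those of the dyadic averages. *)

Notation intg mu f := (mu.-integrable [set: _] (EFin \o f)).

Lemma le_limn_einf (R : realType) (u v : nat -> \bar R) :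
  (forall n, u n <= v n)%E -> (limn_einf u <= limn_einf v)%E.
Proof.
move=> uv; rewrite !limn_einf_lim; apply: lee_lim; [exact: is_cvg_einfs..|].
apply: nearW => n; apply: le_ereal_inf_tmp => _ [m /= nm <-].
by rewrite (le_trans _ (uv m))//; apply: ereal_inf_lbound; exists m.
Qed.

Lemma limn_einf_cvg (R : realType) (u : nat -> \bar R) l :
  u n @[n --> \oo] --> l -> limn_einf u = l.
Proof. by move/cvg_limn_einf_sup => []. Qed.

Section RealIntegral.
Context d (T : measurableType d) (R : realType).
Variable mu : {measure set T -> \bar R}.
Implicit Types (f g h : T -> R) (c k : R).

Lemma intg_measurable f : intg mu f -> measurable_fun setT f.
Proof. by move=> /integrableP[/measurable_EFinP]. Qed.

Lemma intg_dom f g : measurable_fun setT f -> intg mu g ->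
  (forall x, `|f x| <= g x) -> intg mu f.
Proof.
move=> mf ig fg; apply: (le_integrable _ _ _ ig) => //; first exact/measurable_EFinP.
by move=> x _ /=; rewrite lee_fin (le_trans (fg x))// ler_norm.
Qed.

Lemma intgD f g : intg mu f -> intg mu g -> intg mu (fun x => f x + g x).
Proof. by move=> fi gi; exact: (integrableD measurableT fi gi). Qed.

Lemma intgZ c f : intg mu f -> intg mu (fun x => c * f x).
Proof. by move=> fi; exact: (integrableZl measurableT c fi). Qed.

Lemma intgB f g : intg mu f -> intg mu g -> intg mu (fun x => f x - g x).
Proof. by move=> fi gi; exact: (integrableB measurableT fi gi). Qed.

Lemma intg_norm f : intg mu f -> intg mu (fun x => `|f x|).
Proof. by move=> ?; apply: integrable_norm. Qed.

Lemma intg_ge0P f : measurable_fun setT f -> (forall x, 0 <= f x) ->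
  (\int[mu]_x (f x)%:E < +oo)%E <-> intg mu f.
Proof.
move=> mf f0; split => [fi|/integrableP[_]].
  apply/integrableP; split; first exact/measurable_EFinP.
  by under eq_integral do rewrite /= ger0_norm//.
by under eq_integral do rewrite /= ger0_norm//.
Qed.

Lemma EFin_Rint f : intg mu f -> (Rintegral mu setT f)%:E = (\int[mu]_x (f x)%:E)%E.
Proof. by move=> fi; rewrite fineK//; apply: integrable_fin_num. Qed.

Lemma intg_le_bound f c : measurable_fun setT f -> (forall x, 0 <= f x) ->
  (\int[mu]_x (f x)%:E <= c%:E)%E -> intg mu f /\ Rintegral mu setT f <= c.
Proof.
move=> mf f0 fc; have fi : intg mu f.
  by apply/intg_ge0P => //; rewrite (le_lt_trans fc)// ltry.
by split=> //; rewrite -lee_fin EFin_Rint.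
Qed.

Lemma le_Rint f g : intg mu f -> intg mu g -> (forall x, f x <= g x) ->
  Rintegral mu setT f <= Rintegral mu setT g.
Proof. by move=> fi gi fg; apply: le_Rintegral. Qed.

Lemma Rint_ae_eq0 f : measurable_fun setT f -> (forall x, 0 <= f x) ->
  (\int[mu]_x (f x)%:E <= 0)%E -> {ae mu, forall x, f x = 0}.
Proof.
move=> mf f0 fi.
have : (\int[mu]_x `|(f x)%:E| = 0)%E.
  under eq_integral do rewrite /= ger0_norm//.
  by apply/eqP; rewrite eq_le fi integral_ge0// => x _; rewrite lee_fin.
move/ae_eq_integral_abs => /(_ measurableT).
have : measurable_fun setT (EFin \o f) by exact/measurable_EFinP.
move=> /[swap] /[apply]; apply: filterS => x /(_ I) [].
by [].
Qed.

Lemma Rint_dominated (f_ : nat -> T -> R) f g :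
  (forall n, measurable_fun setT (f_ n)) -> measurable_fun setT f ->
  intg mu g -> (forall n x, `|f_ n x| <= g x) ->
  {ae mu, forall x, f_ n x @[n --> \oo] --> f x} ->
  intg mu f /\ Rintegral mu setT (f_ n) @[n --> \oo] --> Rintegral mu setT f.
Proof.
move=> mf_ mf gi fg cf.
have [||||fi _ cv] := @dominated_convergence _ _ _ mu setT measurableT
  (fun n x => (f_ n x)%:E) (EFin \o f) (EFin \o g) _ _ _ gi.
- by move=> n; exact/measurable_EFinP.
- exact/measurable_EFinP.
- by apply: filterS cf => x cx _; apply: cvg_EFin => //; exact: nearW.
- by apply/aeW => x n _ /=; rewrite lee_fin.
split=> //; apply: (fine_cvg _).
by rewrite EFin_Rint.
Qed.

(** Fatou's lemma for a uniform bound on real integrals. Integrability of the limit is part of the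
    conclusion, since [Rintegral] turns an infinite integral into 0. *)
Lemma Rint_fatou (f_ : nat -> T -> R) f c :
  (forall n, intg mu (f_ n)) -> (forall n x, 0 <= f_ n x) ->
  measurable_fun setT f -> (forall x, 0 <= f x) ->
  {ae mu, forall x, f_ n x @[n --> \oo] --> f x} ->
  (forall n, Rintegral mu setT (f_ n) <= c) ->
  intg mu f /\ Rintegral mu setT f <= c.
Proof.
move=> fi f0 mf f0' cf fc; apply: intg_le_bound => //.
have mE n : measurable_fun setT (fun x => (f_ n x)%:E).
  by apply/measurable_EFinP/intg_measurable.
have -> : (\int[mu]_x (f x)%:E = \int[mu]_x limn_einf (fun n => (f_ n x)%:E))%E.
  apply: ge0_ae_eq_integral => //.
  - exact/measurable_EFinP.
  - by rewrite /limn_einf; apply: measurableT_comp => //; apply: measurable_fun_limn_esup => n; apply: measurableT_comp.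
  - by move=> x _; rewrite lee_fin.
  - move=> x _; rewrite -(@limn_einf_cvg R _ _ (cvg_cst 0%E)).
    by apply: le_limn_einf => n; rewrite lee_fin.
  - apply: filterS cf => x cx _.
    by rewrite (@limn_einf_cvg R _ (f x)%:E)//; apply: cvg_EFin => //; exact: nearW.
apply: (le_trans (fatou mu measurableT mE _)) => [n x _|]; first by rewrite lee_fin.
by rewrite -(@limn_einf_cvg R _ _ (cvg_cst c%:E)); apply: le_limn_einf => n; rewrite -EFin_Rint// lee_fin.
Qed.

End RealIntegral.

(** * Vanishing integrals, Cauchy-Schwarz and weak convergence in [L2] *)

Section L2.
Context d (T : measurableType d) (R : realType).
Variable mu : {measure set T -> \bar R}.
Implicit Types (f g h : T -> R) (c k : R).

(** A substitute for Vitali's theorem: [min |h n| |H|] has integral tending to 0 by dominated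
    convergence, and what exceeds it is at most [e * G n], of integral at most [e * C]. The majorant
    [H] may depend on [e]. *)
Lemma Rint_vanish (h G : nat -> T -> R) C :
  (forall n, measurable_fun setT (h n)) ->
  (forall n, intg mu (G n)) -> (forall n x, 0 <= G n x) ->
  (forall n, Rintegral mu setT (G n) <= C) ->
  (forall e, 0 < e -> exists2 H, intg mu H &
     forall n x, `|h n x| <= e * G n x + H x) ->
  {ae mu, forall x, h n x @[n --> \oo] --> 0} ->
  Rintegral mu setT (fun x => `|h n x|) @[n --> \oo] --> 0.
Proof.
move=> mh iG G0 GC hH h0; apply/cvgrPdist_le => e e0.
have C0 : 0 <= C by rewrite (le_trans _ (GC 0%N))// Rintegral_ge0.
pose e' := e / 2 / (C + 1).
have e'0 : 0 < e' by rewrite /e' !divr_gt0// ltr_wpDl.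
have [H iH hGH] := hH _ e'0.
have mH := intg_measurable iH.
have ih n : intg mu (fun x => `|h n x|).
  apply: (@intg_dom _ _ _ _ _ (fun x => e' * G n x + H x)).
  - by apply: measurableT_comp.
  - by apply: intgD => //; exact: intgZ.
  - by move=> x; rewrite normr_id.
pose m n x := Num.min `|h n x| `|H x|.
have mm n : measurable_fun setT (m n).
  by apply: measurable_minr; apply: measurableT_comp.
have m0 n x : 0 <= m n x by rewrite le_min !normr_ge0.
have [||||_ mcv] := @Rint_dominated _ _ _ mu m (cst 0) (fun x => `|H x|) mm.
- exact: measurable_cst.
- exact: intg_norm.
- by move=> n x; rewrite ger0_norm// ge_min lexx orbT.
- apply: filterS h0 => x hx.
  apply: (@squeeze_cvgr _ _ _ _ (cst 0) (fun n => `|h n x|)).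
  + by apply: nearW => n; rewrite m0 /m ge_min lexx.
  + exact: cvg_cst.
  + by rewrite -(@normr0 _ R); apply: cvg_norm.
have {}mcv : Rintegral mu setT (m n) @[n --> \oo] --> 0.
  by move: mcv; rewrite Rintegral_cst// mul0r.
move/cvgrPdist_le : mcv => /(_ (e / 2)) []; first by rewrite divr_gt0.
move=> N _ Nm; exists N => // n /Nm; rewrite !sub0r !normrN => mn.
have im : intg mu (m n).
  apply: (@intg_dom _ _ _ _ _ (fun x => `|h n x|)) => // x.
  by rewrite ger0_norm// ge_min lexx.
rewrite ger0_norm ?Rintegral_ge0//.
apply: (@le_trans _ _ (Rintegral mu setT (fun x => m n x + e' * G n x))).
  apply: le_Rint => //; first by apply: intgD => //; exact: intgZ.
  move=> x; rewrite /m /Num.min; case: ifPn => _.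
    by rewrite lerDl mulr_ge0// ltW.
  by rewrite addrC (le_trans (hGH n x))// lerD2l ler_norm.
rewrite RintegralD//; last exact: intgZ.
rewrite RintegralZl// [leRHS](splitr e) lerD//.
  by rewrite (le_trans _ mn)// ler_norm.
rewrite (@le_trans _ _ (e' * (C + 1)))//.
  by rewrite ler_pM2l// (le_trans (GC n))// lerDl.
by rewrite /e' divfK// gt_eqF// ltr_wpDl.
Qed.

Lemma cvg_Rint_diff (h : nat -> T -> R) f :
  (forall n, intg mu (h n)) -> intg mu f ->
  Rintegral mu setT (fun x => `|h n x - f x|) @[n --> \oo] --> 0 ->
  Rintegral mu setT (h n) @[n --> \oo] --> Rintegral mu setT f.
Proof.
move=> ih fi cv; apply/cvgrPdist_le => e e0.
move/cvgrPdist_le : cv => /(_ e e0) [N _ Ne]; exists N => // n /Ne.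
rewrite sub0r normrN ger0_norm ?Rintegral_ge0// => /(le_trans _); apply.
rewrite distrC -RintegralB//; apply: le_normr_Rintegral => //.
exact: intgB.
Qed.

Definition L2 f := measurable_fun setT f /\ intg mu (fun x => f x ^+ 2).

Lemma L2_mul f g : L2 f -> L2 g -> intg mu (fun x => f x * g x).
Proof.
move=> [mf fi] [mg gi]; apply: (intg_dom _ (intgD fi gi)).
  exact: measurable_funM.
move=> x; rewrite ler_norml; apply/andP; split; nra.
Qed.

Lemma L2Z c f : L2 f -> L2 (fun x => c * f x).
Proof.
move=> [mf fi]; split; first exact: measurable_funM.
by under [X in _.-integrable _ X]eq_fun do rewrite /= exprMn; exact: intgZ.
Qed.

Lemma L2D f g : L2 f -> L2 g -> L2 (fun x => f x + g x).
Proof.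
move=> Lf Lg; have [mf fi] := Lf; have [mg gi] := Lg.
have mfg := measurable_funD mf mg; split => //.
apply: (intg_dom _ (intgD (intgZ 2 fi) (intgZ 2 gi))).
  exact: measurable_funX.
by move=> x; rewrite ger0_norm ?sqr_ge0//; have := sqr_ge0 (f x - g x); nra.
Qed.

Lemma L2_dom f g : measurable_fun setT f -> L2 g ->
  (forall x, `|f x| <= `|g x|) -> L2 f.
Proof.
move=> mf [mg gi] fg; split=> //; apply: (intg_dom _ gi).
  exact: measurable_funX.
by move=> x; rewrite normrX -[leRHS](real_normK (num_real _)) ler_pXn2r ?nnegrE.
Qed.

Lemma Rint_CS f g : L2 f -> L2 g ->
  (Rintegral mu setT (fun x => f x * g x)) ^+ 2 <=
  Rintegral mu setT (fun x => f x ^+ 2) * Rintegral mu setT (fun x => g x ^+ 2).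
Proof.
move=> Lf Lg; have [mf fi] := Lf; have [mg gi] := Lg.
set A := Rintegral _ _ _; set B := Rintegral _ _ _; set D := Rintegral _ _ _.
have ifg := L2_mul Lf Lg.
have q t : 0 <= B - 2 * t * A + t ^+ 2 * D.
  rewrite -RintegralZl// -RintegralZl// -RintegralB//; last exact: intgZ.
  rewrite -RintegralD//; [|by apply: intgB => //; exact: intgZ|exact: intgZ].
  apply: Rintegral_ge0 => x _.
  by have := sqr_ge0 (f x - t * g x); nra.
have D0 : 0 <= D by apply: Rintegral_ge0 => x _; exact: sqr_ge0.
have [D00|Dn0] := eqVneq D 0; last first.
  have Dp : 0 < D by rewrite lt_neqAle eq_sym Dn0.
  have := q (A / D).
  have -> : B - 2 * (A / D) * A + (A / D) ^+ 2 * D = (B * D - A ^+ 2) / D by field.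
  by rewrite pmulr_lge0 ?invr_gt0// subr_ge0.
rewrite D00 mulr0.
have [->|An0] := eqVneq A 0; first by rewrite expr0n.
(* With [D = 0] the quadratic is affine in [t]; at this [t] it equals -1, so [A] has to vanish. *)
have := q ((B + 1) / (2 * A)); rewrite D00 mulr0 addr0.
have -> : B - 2 * ((B + 1) / (2 * A)) * A = -1 by field.
by rewrite oppr_ge0 ler10.
Qed.

(** Almost everywhere convergence and an [L2] bound give weak convergence: [|(g_ n - g) * f|] is at
    most [e * (g_ n ^+ 2 + g ^+ 2) + 2 / e * f ^+ 2], the form required by [Rint_vanish]. *)
Lemma L2_weak (g_ : nat -> T -> R) g f C :
  (forall n, L2 (g_ n)) -> L2 g -> L2 f ->
  (forall n, Rintegral mu setT (fun x => g_ n x ^+ 2) <= C) ->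
  {ae mu, forall x, g_ n x @[n --> \oo] --> g x} ->
  Rintegral mu setT (fun x => g_ n x * f x) @[n --> \oo] -->
  Rintegral mu setT (fun x => g x * f x).
Proof.
move=> Lg_ Lg Lf gC cg; apply: cvg_Rint_diff; [by move=> n; exact: L2_mul|exact: L2_mul|].
apply: (@Rint_vanish _ (fun n x => g_ n x ^+ 2 + g x ^+ 2)
    (C + Rintegral mu setT (fun x => g x ^+ 2))).
- by move=> n; apply: measurable_funB; apply: measurable_funM;
    [case: (Lg_ n)|case: Lf|case: Lg|case: Lf].
- by move=> n; apply: intgD; [case: (Lg_ n)|case: Lg].
- by move=> n x; rewrite addr_ge0// sqr_ge0.
- by move=> n; rewrite RintegralD//; [rewrite lerD2r|case: (Lg_ n)|case: Lg].
- move=> e e0; exists (fun x => 2 / e * f x ^+ 2); first by apply: intgZ; case: Lf.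
  move=> n x; rewrite -mulrBl.
  have ei : e * e^-1 = 1 by rewrite mulfV// gt_eqF.
  have ip : 0 < e^-1 by rewrite invr_gt0.
  have K (a b : R) : a * b <= e * a ^+ 2 + e^-1 * b ^+ 2.
    have : 0 <= e^-1 * ((e * a - b) ^+ 2 + (b ^+ 2 + (e * a) ^+ 2)).
      by rewrite mulr_ge0 ?addr_ge0 ?sqr_ge0// ltW.
    have -> : e^-1 * ((e * a - b) ^+ 2 + (b ^+ 2 + (e * a) ^+ 2)) =
      2 * (e * e^-1) * (e * a ^+ 2) - 2 * (e * e^-1) * (a * b) + 2 * (e^-1 * b ^+ 2).
      by ring.
    by rewrite ei; lra.
  have := K (g_ n x) (f x); have := K (g x) (f x).
  have := K (- g_ n x) (f x); have := K (- g x) (f x).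
  rewrite !sqrrN !mulNr mulrBl => h1 h2 h3 h4.
  by rewrite ler_norml; apply/andP; split; lra.
- apply: filterS cg => x cx; rewrite -(subrr (g x * f x)).
  by apply: cvgB; [apply: cvgMl|exact: cvg_cst].
Qed.

End L2.

(** * The nonlinearities *)

Section Primitive.
Context (R : realType).
Notation mu := (@lebesgue_measure R).
Implicit Types (g : R -> R) (a b c : R).

(** The comparison functions for integrands: constants where only monotonicity is used, [k = 1] for
    [M] because of (M3), [k = 3] for [f] because of (f4). *)
Let affpow (c0 c : R) (k : nat) (r : R) := c0 + c * r ^+ k.

Let affpow_cont c0 c k : continuous (affpow c0 c k).
Proof.
move=> x; apply: cvgD; first exact: cvg_cst.
by apply: cvgMr; exact: exprn_continuous.
Qed.

Let integrable_cc g a b : {within `[a, b], continuous g} ->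
  mu.-integrable `[a, b] (EFin \o g).
Proof. by move=> cg; apply: continuous_compact_integrable => //; exact: segment_compact. Qed.

Let Rint_affpow c0 c k a b : a <= b ->
  Rintegral mu `[a, b] (affpow c0 c k) =
  c0 * (b - a) + c * (b ^+ k.+1 - a ^+ k.+1) / k.+1%:R.
Proof.
rewrite le_eqVlt => /predU1P[->|ab].
  by rewrite set_itv1 Rintegral_set1 !subrr !mulr0 mul0r addr0.
pose P (r : R) := c0 * r + c / k.+1%:R * r ^+ k.+1.
have dP (x : R) : is_derive x (1:R) P (affpow c0 c k x).
  have -> : P = horner (c0 *: 'X + (c / k.+1%:R) *: 'X^(k.+1)).
    by apply/funext => y; rewrite /P !hornerE.
  apply: (is_derive_eq (is_derive_poly _ _)).
  rewrite derivD !derivZ derivX derivXn /= !hornerE /affpow hornerMn hornerXn.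
  by rewrite -[x ^+ k *+ _]mulr_natl mulrA divfK ?pnatr_eq0.
rewrite /Rintegral (@continuous_FTC2 _ _ P)//.
- have : k.+1%:R != 0 :> R by rewrite pnatr_eq0.
  by rewrite /= /P; move: (k.+1%:R) => K Kn; field.
- by apply: continuous_subspaceT; exact: affpow_cont.
- split.
  + by move=> x _; apply: ex_derive.
  + apply: cvg_at_right_filter; apply: differentiable_continuous; apply/derivable1_diffP.
    by apply: ex_derive.
  + apply: cvg_at_left_filter; apply: differentiable_continuous; apply/derivable1_diffP.
    by apply: ex_derive.
- by move=> x _; rewrite derive1E; apply: derive_val.
Qed.

Lemma primF_le0 g t : t <= 0 -> primF g t = 0.
Proof.
rewrite le_eqVlt => /predU1P[->|t0]; first by rewrite /primF set_itv1 Rintegral_set1.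
by rewrite /primF set_itv_ge ?Rintegral_set0// bnd_simp -ltNge.
Qed.

Lemma primF_sub g a b : {within `[0, +oo[, continuous g} -> 0 <= a -> a <= b ->
  primF g b - primF g a = Rintegral mu `[a, b] g.
Proof.
move=> cg a0 ab; rewrite /primF.
have ig : mu.-integrable `[0, b] (EFin \o g).
  apply: integrable_cc; apply: continuous_subspaceW cg.
  by apply: subset_itvl; rewrite bnd_simp.
rewrite (@Rintegral_itvB _ g (BLeft 0) (BRight b) a)//; try by rewrite bnd_simp.
apply: Rintegral_itv_obnd_cbnd; apply: integrableS ig => //.
by apply: subset_itvr; rewrite bnd_simp.
Qed.

Lemma primF_sub_bounds g a b c0 c k :
  {within `[0, +oo[, continuous g} -> 0 <= a -> a <= b ->
  ((forall r, a <= r <= b -> g r <= c0 + c * r ^+ k) ->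
    primF g b - primF g a <= c0 * (b - a) + c * (b ^+ k.+1 - a ^+ k.+1) / k.+1%:R) /\
  ((forall r, a <= r <= b -> c0 + c * r ^+ k <= g r) ->
    c0 * (b - a) + c * (b ^+ k.+1 - a ^+ k.+1) / k.+1%:R <= primF g b - primF g a).
Proof.
move=> cg a0 ab; rewrite primF_sub// -Rint_affpow//.
have ig : mu.-integrable `[a, b] (EFin \o g).
  apply: integrable_cc; apply: continuous_subspaceW cg.
  by apply: subset_itv; rewrite bnd_simp.
have ip : mu.-integrable `[a, b] (EFin \o affpow c0 c k).
  by apply: integrable_cc; apply: continuous_subspaceT; exact: affpow_cont.
by split=> h; apply: le_Rintegral => // r /=; rewrite in_itv /=; exact: h.
Qed.

End Primitive.

(** * The Kirchhoff function and its primitive *)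

Section Kirchhoff.
Context (R : realType) (m0 : R) (M : R -> R).
Hypothesis Mc : {within `[0, +oo[, continuous M}.
Hypothesis m0_gt0 : 0 < m0.
Hypothesis M1 : forall t, 0 <= t -> m0 <= M t.
Hypothesis M2 : forall t1 t2, 0 <= t1 -> t1 < t2 -> M t1 < M t2.
Hypothesis M3 : forall t1 t2, 0 < t2 -> t2 <= t1 ->
     M t1 / t1 - M t2 / t2 <= m0 * (t1^-1 - t2^-1).

Lemma kirchhoff_homo a b : 0 <= a -> a <= b -> M a <= M b.
Proof.
by move=> a0; rewrite le_eqVlt => /predU1P[->//|ab]; rewrite ltW// M2.
Qed.

(** (M3) says that [(M t - m0) / t] is nonincreasing; here it is cross-multiplied. *)
Lemma kirchhoff_slope a b : 0 < a -> a <= b -> (M b - m0) * a <= (M a - m0) * b.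
Proof.
move=> a0 ab; have b0 : 0 < b by apply: lt_le_trans ab.
have := M3 a0 ab.
have -> : M b / b - M a / a = (M b * a - M a * b) / (a * b) by field; lra.
have -> : m0 * (b^-1 - a^-1) = m0 * (a - b) / (a * b) by field; lra.
by rewrite ler_pM2r ?invr_gt0 ?mulr_gt0//; lra.
Qed.

(** [M t / t] is nonincreasing as well, because [m0 / t] is. Hence [M (t^2 a) <= t^2 M a] for
    [t >= 1], the degree 4 along rays. *)
Lemma kirchhoff_growth a b : 0 < a -> a <= b -> M b * a <= M a * b.
Proof.
move=> a0 ab; have := kirchhoff_slope a0 ab.
by have := ler_wpM2l (ltW m0_gt0) ab; lra.
Qed.

(** The primitive of a monotone function is convex. The slope is taken at the end point [b], which
    makes this an upper bound for the increment. *)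
Lemma kirchhoff_convex a b : 0 <= a -> 0 <= b ->
  primF M b - primF M a <= M b * (b - a).
Proof.
move=> a0 b0; have [ab|/ltW ba] := leP a b.
  have [+ _] := primF_sub_bounds (M b) 0 0 Mc a0 ab.
  rewrite !mul0r addr0; apply=> r /andP[ar rb].
  by rewrite mul0r addr0 kirchhoff_homo// (le_trans a0).
have [_] := primF_sub_bounds (M b) 0 0 Mc b0 ba.
move=> h; suff : M b * (a - b) <= primF M a - primF M b by lra.
rewrite (le_trans _ (h _))// ?mul0r ?mulr0 ?mul0r ?addr0// => r /andP[ar rb].
by rewrite mul0r addr0 kirchhoff_homo.
Qed.

(** The line [m0 + c * r] through [(0, m0)] and [(a, M a)] lies below [M] on []0, a]] and above it
    beyond [a]. Integrated between [t^2 a] and [a], its part [c * r] is exactly homogeneous of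
    degree 4 in [t], and the constant [m0] leaves the square. *)
Lemma kirchhoff_fiber a t : 0 <= a -> 0 <= t ->
  (1 - t ^+ 4) / 4 * (M a * a) + m0 / 4 * a * (1 - t ^+ 2) ^+ 2 <=
  (primF M a - primF M (t ^+ 2 * a)) / 2.
Proof.
rewrite le_eqVlt => /predU1P[<- _|a0 t0]; first by rewrite !mulr0 subrr mul0r addr0.
have ai : (M a - m0) / a * a = M a - m0 by rewrite divfK// gt_eqF.
set c := (M a - m0) / a in ai.
have ta0 : 0 <= t ^+ 2 * a by rewrite mulr_ge0 ?sqr_ge0// ltW.
have [t1|/ltW t1] := leP t 1.
  have ta : t ^+ 2 * a <= a by rewrite ger_pMl// expr_le1.
  unshelve epose proof (proj2 (primF_sub_bounds m0 c 1 Mc ta0 ta) _) as h.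
  move=> r /andP[tr ra].
    rewrite expr1; have [->|rn0] := eqVneq r 0; first by rewrite mulr0 addr0 M1.
    have r0 : 0 < r by rewrite lt_neqAle eq_sym rn0 (le_trans ta0).
    have := kirchhoff_slope r0 ra; rewrite -ai.
    have -> : c * a * r = c * r * a by ring.
    by rewrite ler_pM2r//; lra.
  move: h; have -> : m0 * (a - t ^+ 2 * a) + c * (a ^+ 2 - (t ^+ 2 * a) ^+ 2) / 2%:R =
    m0 * (a - t ^+ 2 * a) + (c * a) * a * (1 - t ^+ 4) / 2 by ring.
  by rewrite ai; lra.
have ta : a <= t ^+ 2 * a by rewrite ler_peMl ?expr_ge1// ltW.
unshelve epose proof (proj1 (primF_sub_bounds m0 c 1 Mc (ltW a0) ta) _) as h.
  move=> r /andP[tr ra].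
  rewrite expr1.
  have := kirchhoff_slope a0 tr; rewrite -ai.
  have -> : c * a * r = c * r * a by ring.
  by rewrite ler_pM2r//; lra.
move: h; have -> : m0 * (t ^+ 2 * a - a) + c * ((t ^+ 2 * a) ^+ 2 - a ^+ 2) / 2%:R =
    m0 * (t ^+ 2 * a - a) + (c * a) * a * (t ^+ 4 - 1) / 2 by ring.
by rewrite ai; lra.
Qed.

(** The same line, drawn at [b], bounds [M] from below on [[a, b]]; the leftover [c * a * a] is at
    most [(M a - m0) * a]. With [a = 0] this is the coercivity of the energy on the Nehari set; for
    general [a] it detects a loss of norm in the limit. *)
Lemma kirchhoff_gap a b : 0 <= a -> a <= b ->
  m0 / 4 * (b - a) <= (primF M b / 2 - M b * b / 4) - (primF M a / 2 - M a * a / 4).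
Proof.
move=> a0 ab; have [b0|bn0] := eqVneq b 0.
  have -> : a = 0 by apply/le_anti/andP; split=> //; rewrite -b0.
  by rewrite b0 !subrr mulr0.
  have bp : 0 < b by lra.
have bi : (M b - m0) / b * b = M b - m0 by rewrite divfK// gt_eqF.
set c := (M b - m0) / b in bi.
unshelve epose proof (proj2 (primF_sub_bounds m0 c 1 Mc a0 ab) _) as h.
  move=> r /andP[ar rb].
  rewrite expr1; have [->|rn0] := eqVneq r 0; first by rewrite mulr0 addr0 M1.
  have r0 : 0 < r by lra.
  have := kirchhoff_slope r0 rb; rewrite -bi.
  have -> : c * b * r = c * r * b by ring.
  by rewrite ler_pM2r//; lra.
move: h; have -> : m0 * (b - a) + c * (b ^+ 2 - a ^+ 2) / 2%:R =
    m0 * (b - a) + (c * b) * b / 2 - c * a * a / 2 by ring.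
rewrite bi.
have : c * a * a <= (M a - m0) * a.
  rewrite ler_wpM2r//; have [->|an0] := eqVneq a 0.
    by rewrite mulr0 subr_ge0 M1.
  have ap : 0 < a by lra.
  have := kirchhoff_slope ap ab; rewrite -bi.
  have -> : c * b * a = c * a * b by ring.
  by rewrite ler_pM2r.
lra.
Qed.

End Kirchhoff.

(** * The nonlinearity and its primitive *)

Section Nonlinearity.
Context (R : realType) (q theta : R) (f : R -> R).
Hypothesis fc : continuous f.
Hypothesis fneg : forall t, t < 0 -> f t = 0.
Hypothesis f1 : (fun t => f t / t ^+ 3) @ 0^'+ --> 0.
Hypothesis q4 : 4 < q.
Hypothesis f2 : (fun t => f t / t `^ (q - 1)) @ +oo --> 0.
Hypothesis theta4 : 4 < theta.
Hypothesis f3 : forall t, 0 < t -> 0 < theta * primF f t /\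
                      theta * primF f t <= f t * t.
Hypothesis f4 : forall t1 t2, 0 < t1 -> t1 <= t2 ->
     f t1 / t1 ^+ 3 <= f t2 / t2 ^+ 3.

Let fcw : {within `[0, +oo[, continuous f}.
Proof. exact: continuous_subspaceT. Qed.

Lemma f_le0 t : t <= 0 -> f t = 0.
Proof.
rewrite le_eqVlt => /predU1P[->|]; last exact: fneg.
have h1 : f x @[x --> (0:R)^'-] --> f 0 by apply: cvg_at_left_filter; exact: fc.
apply: (cvg_unique _ h1) => //.
apply: (@cvg_trans _ (cst 0 x @[x --> (0:R)^'-])); last exact: cvg_cst.
apply: near_eq_cvg; near do rewrite /= fneg//.
Unshelve. all: by end_near.
Qed.

Lemma f_gt0 t : 0 < t -> 0 < f t.
Proof.
move=> t0; have [h1 h2] := f3 t0.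
by rewrite -(pmulr_lgt0 _ t0) (lt_le_trans h1).
Qed.

Lemma f_ge0 t : 0 <= f t.
Proof. by have [/f_le0->//|/f_gt0/ltW] := leP t 0. Qed.

Let f4' a b : 0 < a -> a <= b -> f a <= f b / b ^+ 3 * a ^+ 3.
Proof.
by move=> a0 ab; rewrite -ler_pdivrMr ?exprn_gt0//; apply: f4.
Qed.

Let f4'' a b : 0 < a -> a <= b -> f a / a ^+ 3 * b ^+ 3 <= f b.
Proof.
move=> a0 ab; rewrite -ler_pdivlMr ?exprn_gt0//; first exact: f4.
exact: lt_le_trans ab.
Qed.

(** For positive arguments [f t] is the product of the nondecreasing nonnegative functions
    [f t / t ^+ 3] and [t ^+ 3]. *)
Lemma f_homo a b : a <= b -> f a <= f b.
Proof.
move=> ab; have [a0|a0] := leP a 0; first by rewrite f_le0// f_ge0.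
rewrite (le_trans _ (f4'' a0 ab))// -mulrA ler_peMr ?f_ge0//.
rewrite mulrC -expr_div_n exprn_ege1// ler_pdivlMr// mul1r//.
Qed.

Lemma F_convex a b : f a * (b - a) <= primF f b - primF f a.
Proof.
have [a0|a0] := leP a 0.
  rewrite f_le0// mul0r (primF_le0 _ a0) subr0; have [b0|b0] := leP b 0.
    by rewrite primF_le0.
  have [+ _] := f3 b0; have := theta4 => th4; rewrite pmulr_rgt0; last lra.
  exact: ltW.
have [ab|/ltW ba] := leP a b.
  unshelve epose proof (proj2 (primF_sub_bounds (f a) 0 0 fcw (ltW a0) ab) _) as h.
    by move=> r /andP[ar rb]; rewrite mul0r addr0 f_homo.
  by move: h; lra.
(* For [b <= 0 < a]: [F a <= f a * a <= f a * (a - b)], as [f] is nondecreasing and nonnegative. *)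
have [b0|b0] := leP b 0.
  rewrite (primF_le0 _ b0).
  unshelve epose proof (proj1 (primF_sub_bounds (f a) 0 0 fcw (lexx 0) (ltW a0)) _) as h.
    by move=> r /andP[ar rb]; rewrite mul0r addr0 f_homo.
  move: h; rewrite (@primF_le0 _ _ 0)//.
  have := f_ge0 a; nra.
unshelve epose proof (proj1 (primF_sub_bounds (f a) 0 0 fcw (ltW b0) ba) _) as h.
  by move=> r /andP[ar rb]; rewrite mul0r addr0 f_homo.
by move: h; lra.
Qed.

(** (f4) compares [f r] with the cubic [c * r ^+ 3] that agrees with it at [x]: [f] is below for
    [r <= x] and above for [r >= x]. The primitive of the cubic is homogeneous of degree 4. *)
Lemma F_fiber x t : 0 <= t ->
  primF f x - primF f (t * x) <= (1 - t ^+ 4) / 4 * (f x * x).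
Proof.
move=> t0; have [x0|x0] := leP x 0.
  by rewrite f_le0// mul0r mulr0 !primF_le0 ?subrr// mulr_ge0_le0.
have xi : f x / x ^+ 3 * x ^+ 3 = f x by rewrite divfK// expf_neq0// gt_eqF.
set c := f x / x ^+ 3 in xi.
have tx0 : 0 <= t * x by rewrite mulr_ge0// ltW.
rewrite -xi; have [t1|/ltW t1] := leP t 1.
  have tx : t * x <= x by rewrite ger_pMl.
  unshelve epose proof (proj1 (primF_sub_bounds 0 c 3 fcw tx0 tx) _) as h.
    move=> r /andP[tr rx]; rewrite add0r; have [r0|r0] := leP r 0.
      have -> : r = 0 by apply/le_anti; rewrite r0 (le_trans tx0).
      by rewrite expr0n mulr0 f_le0.
    exact: f4'.
  by move: h; lra.
have tx : x <= t * x by rewrite ler_peMl// ltW.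
unshelve epose proof (proj2 (primF_sub_bounds 0 c 3 fcw (ltW x0) tx) _) as h.
  by move=> r /andP[tr rx]; rewrite add0r f4''.
by move: h; lra.
Qed.

Lemma F_le_quarter x : primF f x <= f x * x / 4.
Proof.
have := F_fiber x (lexx 0); rewrite mul0r (@primF_le0 _ _ 0)//.
by rewrite expr0n/=; lra.
Qed.

Lemma F_ge0 x : 0 <= primF f x.
Proof. by have := F_convex 0 x; rewrite f_le0// (@primF_le0 _ _ 0)//; lra. Qed.

(** (f1) settles [t < e] and (f2) large [t]. In between, the monotone [f] is bounded by its value at
    the right end, and the power of [t] is bounded below by that of [e]. *)
Lemma f_growth eta : 0 < eta -> exists2 C, 0 <= C &
  forall t, f t <= eta * `|t| + C * `|t| `^ (q - 1).
Proof.
move=> eta0.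
have [d [d0 hd]] : exists d, 0 < d /\ forall t, 0 < t -> t < d -> f t <= t ^+ 3.
  move/cvgrPdist_le : f1 => /(_ 1 ltr01) [d /= d0 h].
  exists d; split=> // t t0 td; have := h t ^~ t0.
  rewrite /= => h'.
  have {h'} : `|f t / t ^+ 3| <= 1 by move: h'; rewrite sub0r normrN gtr0_norm// => /(_ td); rewrite sub0r normrN.
  rewrite ger0_norm ?divr_ge0 ?f_ge0 ?exprn_ge0 ?(ltW t0)//.
  by rewrite ler_pdivrMr ?exprn_gt0// mul1r.
have [K hK] : exists K, forall t, K < t -> 0 < t -> f t <= t `^ (q - 1).
  move/cvgrPdist_le : f2 => /(_ 1 ltr01) [K [_ h]].
  exists K => t Kt t0; have := h t Kt.
  rewrite sub0r normrN ger0_norm ?divr_ge0 ?f_ge0 ?powR_ge0//.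
  by rewrite ler_pdivrMr ?powR_gt0// mul1r.
(* [e <= 1] and [e <= eta] turn [f t <= t ^+ 3] into [f t <= eta * t]. *)
pose e := Num.min d (Num.min 1 eta).
have e0 : 0 < e by rewrite !lt_min d0 ltr01.
have K0 : 0 < Num.max K 1 by rewrite lt_max ltr01 orbT.
exists (1 + f (Num.max K 1) / e `^ (q - 1)).
  by rewrite addr_ge0// divr_ge0 ?f_ge0 ?powR_ge0.
move=> t; have [t0|t0] := leP t 0.
  rewrite f_le0// addr_ge0// mulr_ge0 ?powR_ge0 ?(ltW eta0)//.
  by rewrite addr_ge0// divr_ge0 ?f_ge0 ?powR_ge0.
rewrite gtr0_norm//; have p0 := powR_ge0 t (q - 1).
have c0 : 0 <= f (Num.max K 1) / e `^ (q - 1) by rewrite divr_ge0 ?f_ge0 ?powR_ge0.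
have [te|et] := ltP t e.
  rewrite ler_wpDr ?mulr_ge0 ?addr_ge0//.
  move: te; rewrite !lt_min => /and3P[td t1 te].
  rewrite (le_trans (hd _ t0 td))// exprS ler_pM// ?exprn_ge0 ?(ltW t0)//.
    exact: ltW.
  by rewrite expr2 ger_pMr// ltW.
have [tK|Kt] := leP t (Num.max K 1).
  rewrite ler_wpDl ?mulr_ge0// ?(ltW eta0) ?(ltW t0)// mulrDl mul1r ler_wpDl//.
  rewrite -mulrA (le_trans (f_homo tK))// ler_peMr ?f_ge0//.
  rewrite mulrC ler_pdivlMr ?powR_gt0// mul1r.
  by have := q4 => q4'; apply: ge0_ler_powR; rewrite ?nnegrE; lra.
rewrite ler_wpDl ?mulr_ge0// ?(ltW eta0) ?(ltW t0)// mulrDl mul1r ler_wpDr; first 1 last.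
- by rewrite mulr_ge0.
- by apply: hK => //; apply: le_lt_trans Kt; rewrite le_max lexx.
- by [].
Qed.

Lemma f_superquartic L : exists2 K, 0 < K & forall t, K <= t -> L * t ^+ 3 <= f t.
Proof.
(* Otherwise [f t / t^3] is bounded; inserting [f r >= h t * r^3] into [theta F <= f t] makes its
   supremum at least [theta / 4] times itself. *)
apply: contrapT => hN.
pose h t := f t / t ^+ 3.
have hL t : 0 < t -> h t <= L.
  move=> t0; rewrite leNgt; apply/negP => ht; apply: hN; exists t => // r tr.
  have r0 := lt_le_trans t0 tr.
  rewrite -ler_pdivlMr ?exprn_gt0//; apply: le_trans (f4 t0 tr); exact: ltW.
pose S := [set h t | t in [set t | 0 < t]].
have hS : has_sup S.
  split; first by exists (h 1); exists 1 => //=; exact: ltr01.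
  by exists L => _ [t /= t0 <-]; exact: hL.
have hle t : 0 < t -> h t <= sup S.
  by move=> t0; apply: sup_upper_bound => //; exists t.
have S0 : 0 < sup S.
  apply: lt_le_trans (hle 1 ltr01); rewrite /h expr1n divr1; exact: f_gt0.
have := theta4 => th4; pose k := theta / 4; have k1 : 1 < k by rewrite /k ltr_pdivlMr//; lra.
have step t m : 0 < t -> 1 <= m -> k * h t * (1 - (m ^+ 4)^-1) <= h (m * t).
  move=> t0 m1; have m0 : 0 < m by lra.
  have mt0 : 0 < m * t by rewrite mulr_gt0.
  have tmt : t <= m * t by rewrite ler_peMl// ltW.
  unshelve epose proof (proj2 (primF_sub_bounds 0 (h t) 3 fcw (ltW t0) tmt) _) as hh.
    by move=> r /andP[tr rx]; rewrite add0r f4''.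
  have [_] := f3 mt0; have := F_ge0 t => F0 hm.
  have : theta * (h t * ((m * t) ^+ 4 - t ^+ 4) / 4) <= f (m * t) * (m * t).
    apply: le_trans hm; rewrite ler_pM2l; last lra.
    by move: hh; rewrite mul0r add0r; lra.
  have -> : f (m * t) * (m * t) = h (m * t) * (m * t) ^+ 4.
    by rewrite /h; field; rewrite !gt_eqF.
  have -> : theta * (h t * ((m * t) ^+ 4 - t ^+ 4) / 4) =
     (k * h t * (1 - (m ^+ 4)^-1)) * (m * t) ^+ 4.
    by rewrite /k; field; rewrite !gt_eqF.
  by rewrite ler_pM2r// exprn_gt0.
(* This [m] satisfies [k * (1 - m^-1) = 1]; since [m^-4 < m^-1], the factor [k * (1 - m^-4)] exceeds
   1. *)
pose m := 1 + 1 / (k - 1) ; have m1 : 1 <= m by rewrite lerDl divr_ge0; lra.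
have mk : 1 < k * (1 - (m ^+ 4)^-1).
  have m0 : 0 < m by lra.
  have mp : m * (k - 1) = k by rewrite /m; field; lra.
  have m41 : (m ^+ 4)^-1 * m ^+ 4 = 1 by rewrite mulVf// expf_neq0// gt_eqF.
  have im0 : 0 < (m ^+ 4)^-1 by rewrite invr_gt0 exprn_gt0.
  have m2 : m < m ^+ 4.
    have : 1 < m by rewrite /m ltrDl divr_gt0; lra.
    by move=> ?; rewrite -[ltLHS]expr1 ltr_eXn2l.
  have : m * (m ^+ 4)^-1 < 1.
    by rewrite -[ltRHS]m41 [ltRHS]mulrC ltr_pM2r.
  by nra.
pose k' := k * (1 - (m ^+ 4)^-1).
have : sup S <= sup S / k'.
  apply: sup_le_ub; first by case: hS.
  move=> _ [t /= t0 <-]; rewrite ler_pdivlMr; last by rewrite /k'; lra.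
  rewrite (le_trans _ (hle (m * t) _))//; last by rewrite mulr_gt0//; lra.
  by rewrite (le_trans _ (step _ _ t0 m1))// /k'; lra.
rewrite -/k' in mk; rewrite ler_pdivlMr; last lra.
by rewrite leNgt -[ltLHS]mulr1 ltr_pM2l// mk.
Qed.

End Nonlinearity.

(** * Translations *)

(* [filterS] does not find the filter instance of [almost_everywhere] on [leb3] and [leb6]. *)
Lemma ae_mono d (T : measurableType d) (R : realType)
    (mu : {measure set T -> \bar R}) (P Q : T -> Prop) :
  (forall x, P x -> Q x) -> {ae mu, forall x, P x} -> {ae mu, forall x, Q x}.
Proof. by move=> PQ; apply: filterS. Qed.

Lemma ae_and d (T : measurableType d) (R : realType)
    (mu : {measure set T -> \bar R}) (P Q : T -> Prop) :
  {ae mu, forall x, P x} -> {ae mu, forall x, Q x} ->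
  {ae mu, forall x, P x /\ Q x}.
Proof. exact: filterI. Qed.

Section MeasurePreserving.
Context (R : realType).
Local Open Scope ereal_scope.

Definition preserves d (T : measurableType d) (m : {measure set T -> \bar R})
    (phi : T -> T) :=
  measurable_fun setT phi /\ forall A, measurable A -> m (phi @^-1` A) = m A.

Lemma preserves_integral d (T : measurableType d) (m : {measure set T -> \bar R})
    (phi : T -> T) (f : T -> \bar R) : preserves m phi ->
  measurable_fun setT f -> (forall x, 0 <= f x) ->
  \int[m]_x f (phi x) = \int[m]_x f x.
Proof.
move=> [mphi mp] mf f0.
rewrite -[LHS](@ge0_integral_pushforward _ _ _ _ R phi mphi m setT f)//.
by apply: eq_measure_integral => A mA _; exact: mp.
Qed.

Lemma preserves_prod d1 d2 (T1 : measurableType d1) (T2 : measurableType d2)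
    (m1 : {sigma_finite_measure set T1 -> \bar R})
    (m2 : {sigma_finite_measure set T2 -> \bar R}) phi1 phi2 :
  preserves m1 phi1 -> preserves m2 phi2 ->
  preserves (m1 \x m2) (fun z => (phi1 z.1, phi2 z.2)).
Proof.
move=> [mp1 h1] [mp2 h2].
set phi := fun z => _.
have mphi : measurable_fun setT phi.
  by apply: measurable_fun_pair; apply: measurableT_comp.
split=> // X mX.
rewrite -[LHS]/(pushforward (m1 \x m2) phi X).
apply/esym/product_measure_unique => // A B mA mB; rewrite /= /pushforward.
have -> : phi @^-1` (A `*` B) = (phi1 @^-1` A) `*` (phi2 @^-1` B) by [].
rewrite product_measure1E ?h1 ?h2//; rewrite -[X in measurable X]setTI.
- exact: mp1.
- exact: mp2.
Qed.

Lemma lebesgue_shift (a : R) :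
  preserves (@lebesgue_measure R) (fun x => x + a)%R.
Proof.
have ms : measurable_fun setT ((fun x => x + a)%R : R -> measurableTypeR R).
  exact: measurable_funD.
split=> // A mA.
rewrite -[LHS]/(pushforward lebesgue_measure ((fun x => x + a)%R : R -> measurableTypeR R) A).
apply/esym/lebesgue_measure_unique => // _ [[b c] /= bc <-]; rewrite /pushforward.
have -> : (fun x : R => x + a)%R @^-1` `]b, c] = `]b - a, c - a]%classic%R.
  by apply/seteqP; split=> x /=; rewrite !in_itv/= ltrBlDr lerBrDr.
by rewrite !lebesgue_measure_itv/= !lte_fin ltrD2r -!EFinD opprD opprK addrACA addNr addr0.
Qed.

Definition shift3 (a x : R3 R) : R3 R :=
  ((x.1.1 + a.1.1, x.1.2 + a.1.2), x.2 + a.2)%R.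

Lemma leb3_shift a : preserves (@leb3 R) (shift3 a).
Proof.
have h2 := preserves_prod (lebesgue_shift a.1.1) (lebesgue_shift a.1.2).
exact: (@preserves_prod _ _ _ _ (@leb2 R) (@lebesgue_measure R) _ _ h2 (lebesgue_shift a.2)).
Qed.

Lemma leb6_shift a : preserves (@leb6 R) (fun z => (shift3 a z.1, shift3 a z.2)).
Proof.
exact: (@preserves_prod _ _ _ _ (@leb3 R) (@leb3 R) _ _ (leb3_shift a) (leb3_shift a)).
Qed.

(** Carries almost everywhere statements about [u] over to [quot u], which is a function of
    pairs. *)
Lemma leb6_fst_snd_ae (P : R3 R -> Prop) : {ae @leb3 R, forall x, P x} ->
  {ae @leb6 R, forall z, P z.1 /\ P z.2}.
Proof.
move=> [N [mN N0 PN]].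
exists (N `*` setT `|` setT `*` N); split.
- by apply: measurableU; apply: measurableX.
- rewrite null_set_setU//.
  + by apply: measurableX.
  + by apply: measurableX.
  + by rewrite [LHS](@product_measure1E _ _ _ _ _ (@leb3 R) (@leb3 R))// [X in X * _]N0 mul0e.
  + by rewrite [LHS](@product_measure1E _ _ _ _ _ (@leb3 R) (@leb3 R))// [X in _ * X]N0 mule0.
- move=> z /= nP; have [Pz1|nP1] := pselect (P z.1).
    by right; split=> //; apply: PN => /= Pz2; apply: nP.
  by left; split=> //; apply: PN.
Qed.

End MeasurePreserving.

(** * The fractional Sobolev space *)

Section FractionalSpace.
Context (R : realType) (s V0 : R).
Implicit Types (u v w : R3 R -> R) (c : R).

(** The square root of the kernel. It turns the Gagliardo form into the [L2] product of [quot u] and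
    [quot v] over [leb6], so that both halves of [bform] obey the same [L2] lemmas. *)
Definition gagw (z : R3 R * R3 R) : R :=
  Num.sqrt (dist3 z.1 z.2 `^ (3 + 2 * s))^-1.

Definition quot u (z : R3 R * R3 R) : R := (u z.1 - u z.2) * gagw z.

Lemma gagw_sqr z : gagw z ^+ 2 = (dist3 z.1 z.2 `^ (3 + 2 * s))^-1.
Proof. by rewrite /gagw sqr_sqrtr// invr_ge0 powR_ge0. Qed.

Lemma gag_quot u v z : gag_integrand s u v z = quot u z * quot v z.
Proof. by rewrite /gag_integrand /quot -gagw_sqr; ring. Qed.

Lemma measurable_dist3 :
  measurable_fun setT (fun z : R3 R * R3 R => dist3 z.1 z.2).
Proof.
rewrite /dist3; apply: measurableT_comp.
  by apply: continuous_measurable_fun; exact: sqrt_continuous.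
have m1 : measurable_fun setT (fun z : R3 R * R3 R => z.1.1.1).
  by apply: measurableT_comp => //; apply: measurableT_comp.
have m2 : measurable_fun setT (fun z : R3 R * R3 R => z.1.1.2).
  by apply: measurableT_comp => //; apply: measurableT_comp.
have m3 : measurable_fun setT (fun z : R3 R * R3 R => z.1.2).
  by apply: measurableT_comp.
have m4 : measurable_fun setT (fun z : R3 R * R3 R => z.2.1.1).
  by apply: measurableT_comp => //; apply: measurableT_comp.
have m5 : measurable_fun setT (fun z : R3 R * R3 R => z.2.1.2).
  by apply: measurableT_comp => //; apply: measurableT_comp.
have m6 : measurable_fun setT (fun z : R3 R * R3 R => z.2.2).
  by apply: measurableT_comp.
apply: measurable_funD; [apply: measurable_funD|];
  by apply: measurable_funX; apply: measurable_funB.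
Qed.

Lemma measurable_gagw : measurable_fun setT gagw.
Proof.
apply: measurableT_comp.
  by apply: continuous_measurable_fun; exact: sqrt_continuous.
under eq_fun do rewrite -powRN.
apply: (measurableT_comp (measurable_powR _)).
exact: measurable_dist3.
Qed.

Lemma measurable_fst_snd u : measurable_fun setT u ->
  measurable_fun setT (fun z : R3 R * R3 R => u z.1) /\
  measurable_fun setT (fun z : R3 R * R3 R => u z.2).
Proof. by move=> mu; split; apply: measurableT_comp. Qed.

Lemma measurable_quot u : measurable_fun setT u -> measurable_fun setT (quot u).
Proof.
move=> /measurable_fst_snd[m1 m2]; apply: measurable_funM; last exact: measurable_gagw.
exact: measurable_funB.
Qed.

Lemma HsP u : Hs s u <-> L2 (@leb3 R) u /\ L2 (@leb6 R) (quot u).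
Proof.
have gE : gag_integrand s u u = fun z => quot u z ^+ 2.
  by apply/funext => z; rewrite gag_quot expr2.
rewrite /Hs /L2 /gagliardo2 gE; split.
- move=> [mu [iu gu]]; have mD := measurable_quot mu.
  by split; split=> //; apply/intg_ge0P => //;
    [exact: measurable_funX|by move=> x; exact: sqr_ge0
    |exact: measurable_funX|by move=> x; exact: sqr_ge0].
- move=> [[mu iu] [mD gu]]; split=> //.
  by split; apply/intg_ge0P => //;
    [exact: measurable_funX|by move=> x; exact: sqr_ge0
    |exact: measurable_funX|by move=> x; exact: sqr_ge0].
Qed.

Lemma Hs_meas u : Hs s u -> measurable_fun setT u. Proof. by case. Qed.

Lemma Hs_L2 u : Hs s u -> L2 (@leb3 R) u. Proof. by case/HsP. Qed.

Lemma Hs_quot u : Hs s u -> L2 (@leb6 R) (quot u). Proof. by case/HsP. Qed.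

Lemma quotD u v z : quot (fun x => u x + v x) z = quot u z + quot v z.
Proof. by rewrite /quot; ring. Qed.

Lemma quotZ c u z : quot (fun x => c * u x) z = c * quot u z.
Proof. by rewrite /quot; ring. Qed.

Lemma HsD u v : Hs s u -> Hs s v -> Hs s (fun x => u x + v x).
Proof.
move=> /HsP[u2 Du] /HsP[v2 Dv]; apply/HsP; split; first exact: L2D.
have -> : quot (fun x => u x + v x) = fun z => quot u z + quot v z.
  by apply/funext => z; exact: quotD.
exact: L2D.
Qed.

Lemma HsZ c u : Hs s u -> Hs s (fun x => c * u x).
Proof.
move=> /HsP[u2 Du]; apply/HsP; split; first exact: L2Z.
have -> : quot (fun x => c * u x) = fun z => c * quot u z.
  by apply/funext => z; exact: quotZ.
exact: L2Z.
Qed.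

Lemma HsB u v : Hs s u -> Hs s v -> Hs s (fun x => u x - v x).
Proof.
move=> Hu Hv; have := HsD Hu (HsZ (-1) Hv).
by under [X in Hs _ X -> _]eq_fun do rewrite mulN1r.
Qed.

Lemma Hs_contraction u v : measurable_fun setT v -> Hs s u ->
  (forall x, `|v x| <= `|u x|) ->
  (forall x y, `|v x - v y| <= `|u x - u y|) -> Hs s v.
Proof.
move=> mv /HsP[u2 Du] vu dvu; apply/HsP; split; first exact: L2_dom u2 _.
apply: L2_dom Du _ => //; first exact: measurable_quot.
by move=> z; rewrite !normrM ler_wpM2r.
Qed.

Definition bform u v : R :=
  Rintegral (@leb6 R) setT (gag_integrand s u v)
  + Rintegral (@leb3 R) setT (fun x => V0 * u x * v x).

Lemma bformE u v : bform u v = Rintegral (@leb6 R) setT (fun z => quot u z * quot v z)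
  + Rintegral (@leb3 R) setT (fun x => V0 * (u x * v x)).
Proof.
have -> : (fun z => quot u z * quot v z) = gag_integrand s u v.
  by apply/funext => z; rewrite gag_quot.
have -> // : (fun x => V0 * (u x * v x)) = fun x => V0 * u x * v x.
by apply/funext => x; rewrite mulrA.
Qed.

Lemma normVE u : normV s V0 u = bform u u.
Proof.
congr (_ + _).
by apply: eq_Rintegral => z _; rewrite -mulrA expr2.
Qed.

Lemma bformC u v : bform u v = bform v u.
Proof.
rewrite !bformE; congr (_ + _); apply: eq_Rintegral => z _; ring.
Qed.

Lemma bform_intg u v : Hs s u -> Hs s v ->
  intg (@leb6 R) (fun z => quot u z * quot v z) /\
  intg (@leb3 R) (fun x => V0 * (u x * v x)).
Proof.
move=> Hu Hv; split; first by apply: L2_mul; exact: Hs_quot.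
by apply/intgZ/L2_mul; exact: Hs_L2.
Qed.

Lemma bformDl u v w : Hs s u -> Hs s v -> Hs s w ->
  bform (fun x => u x + v x) w = bform u w + bform v w.
Proof.
move=> Hu Hv Hw; have [a1 a2] := bform_intg Hu Hw; have [b1 b2] := bform_intg Hv Hw.
rewrite !bformE addrACA -!RintegralD//; congr (_ + _); apply: eq_Rintegral => z _.
  by rewrite quotD; ring.
by ring.
Qed.

Lemma bformZl c u w : Hs s u -> Hs s w -> bform (fun x => c * u x) w = c * bform u w.
Proof.
move=> Hu Hw; have [a1 a2] := bform_intg Hu Hw.
rewrite !bformE mulrDr -!RintegralZl//; congr (_ + _); apply: eq_Rintegral => z _.
  by rewrite quotZ; ring.
by ring.
Qed.

Lemma bformDr u v w : Hs s u -> Hs s v -> Hs s w ->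
  bform w (fun x => u x + v x) = bform w u + bform w v.
Proof. by move=> *; rewrite bformC bformDl// !(bformC w). Qed.

Lemma bformZr c u w : Hs s u -> Hs s w -> bform w (fun x => c * u x) = c * bform w u.
Proof. by move=> *; rewrite bformC bformZl// (bformC w). Qed.

Lemma normV_addZ c u v : Hs s u -> Hs s v ->
  normV s V0 (fun x => u x + c * v x) =
  normV s V0 u + 2 * c * bform u v + c ^+ 2 * normV s V0 v.
Proof.
move=> Hu Hv; have Hcv := HsZ c Hv; rewrite !normVE.
rewrite bformDl//; last exact: HsD.
rewrite !bformDr// !(bformZl, bformZr)// (bformC v u); ring.
Qed.

Lemma normVZ c u : Hs s u -> normV s V0 (fun x => c * u x) = c ^+ 2 * normV s V0 u.
Proof. by move=> Hu; rewrite !normVE bformZl ?bformZr// ?mulrA//; exact: HsZ. Qed.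

Hypothesis V0_gt0 : 0 < V0.

Lemma normV_split u : Hs s u ->
  normV s V0 u = Rintegral (@leb6 R) setT (fun z => quot u z ^+ 2) +
     V0 * Rintegral (@leb3 R) setT (fun x => u x ^+ 2).
Proof.
move=> Hu; rewrite normVE bformE; have [_ iu] := Hs_L2 Hu.
by rewrite -RintegralZl.
Qed.

Lemma normV_ge0 u : 0 <= normV s V0 u.
Proof.
rewrite normVE bformE addr_ge0// Rintegral_ge0// => x _; rewrite -expr2 ?sqr_ge0//.
by rewrite mulr_ge0 ?sqr_ge0// ltW.
Qed.

Lemma normV_ge_quot u : Hs s u ->
  Rintegral (@leb6 R) setT (fun z => quot u z ^+ 2) <= normV s V0 u.
Proof.
move=> Hu; rewrite normV_split// lerDl mulr_ge0 ?(ltW V0_gt0)//.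
by apply: Rintegral_ge0 => x _; exact: sqr_ge0.
Qed.

Lemma normV_ge_L2 u : Hs s u ->
  Rintegral (@leb3 R) setT (fun z => u z ^+ 2) <= normV s V0 u / V0.
Proof.
move=> Hu; rewrite ler_pdivlMr// mulrC normV_split// lerDr.
by apply: Rintegral_ge0 => x _; exact: sqr_ge0.
Qed.

(** Additive form of Cauchy-Schwarz: the squared norms of the sum and of the difference are
    nonnegative. *)
Lemma bform_CS u v : Hs s u -> Hs s v ->
  `|bform u v| <= (normV s V0 u + normV s V0 v) / 2.
Proof.
move=> Hu Hv.
have P c : 0 <= normV s V0 u + 2 * c * bform u v + c ^+ 2 * normV s V0 v.
  by rewrite -normV_addZ// normV_ge0.
by have := P 1; have := P (-1); rewrite ler_norml => h1 h2; apply/andP; split; lra.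
Qed.

Lemma normV_eq0 u : Hs s u -> normV s V0 u <= 0 -> {ae @leb3 R, forall x, u x = 0}.
Proof.
move=> Hu u0; have [mu iu] := Hs_L2 Hu.
have : {ae @leb3 R, forall x, u x ^+ 2 = 0}.
  apply: Rint_ae_eq0; [exact: measurable_funX|by move=> x; exact: sqr_ge0|].
  rewrite -EFin_Rint// lee_fin (le_trans (normV_ge_L2 Hu))//.
  by rewrite pmulr_lle0// invr_gt0.
by apply: (@ae_mono _ _ _ (@leb3 R)) => x /eqP; rewrite sqrf_eq0 => /eqP.
Qed.

(** Almost everywhere convergence passes to [quot], as a statement about pairs. Fatou's lemma then
    puts the limit in the space, and [L2_weak] applies to each half of the form. *)
Lemma Hs_weak (u_ : nat -> R3 R -> R) u C :
  (forall n, Hs s (u_ n)) -> (forall n, normV s V0 (u_ n) <= C) ->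
  measurable_fun setT u ->
  {ae @leb3 R, forall x, u_ n x @[n --> \oo] --> u x} ->
  Hs s u /\ forall v, Hs s v -> bform (u_ n) v @[n --> \oo] --> bform u v.
Proof.
move=> Hu_ uC mu cu.
have cq : {ae @leb6 R, forall z, quot (u_ n) z @[n --> \oo] --> quot u z}.
  apply: (@ae_mono _ _ _ (@leb6 R)) (leb6_fst_snd_ae cu) => z [c1 c2].
  by apply: cvgMl; apply: cvgB.
have sqr_cvg (a : nat -> R) (l : R) : a n @[n --> \oo] --> l -> (a n) ^+ 2 @[n --> \oo] --> l ^+ 2.
  by move=> al; apply: cvgM.
have [iu _] : intg (@leb3 R) (fun x => u x ^+ 2) /\
    Rintegral (@leb3 R) setT (fun x => u x ^+ 2) <= C / V0.
  apply: (@Rint_fatou _ _ _ (@leb3 R) (fun n x => u_ n x ^+ 2)).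
  - by move=> n; case: (Hs_L2 (Hu_ n)).
  - by move=> n x; exact: sqr_ge0.
  - exact: measurable_funX.
  - by move=> x; exact: sqr_ge0.
  - by apply: (@ae_mono _ _ _ (@leb3 R)) cu => x; exact: sqr_cvg.
  - move=> n; rewrite (le_trans (normV_ge_L2 (Hu_ n)))// ler_pM2r ?invr_gt0//.
have mq := measurable_quot mu.
have [iq _] : intg (@leb6 R) (fun x => quot u x ^+ 2) /\
    Rintegral (@leb6 R) setT (fun x => quot u x ^+ 2) <= C.
  apply: (@Rint_fatou _ _ _ (@leb6 R) (fun n x => quot (u_ n) x ^+ 2)).
  - by move=> n; case: (Hs_quot (Hu_ n)).
  - by move=> n x; exact: sqr_ge0.
  - exact: measurable_funX.
  - by move=> x; exact: sqr_ge0.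
  - by apply: (@ae_mono _ _ _ (@leb6 R)) cq => x; exact: sqr_cvg.
  - by move=> n; rewrite (le_trans (normV_ge_quot (Hu_ n))).
have Hu : Hs s u by apply/HsP.
split=> // v Hv; under eq_fun do rewrite bformE; rewrite bformE.
apply: cvgD.
  apply: (@L2_weak _ _ _ (@leb6 R) _ _ _ C) => //.
  - by move=> n; exact: Hs_quot.
  - exact: Hs_quot.
  - by move=> n; rewrite (le_trans (normV_ge_quot (Hu_ n))).
rewrite RintegralZl//; last by apply: L2_mul; exact: Hs_L2.
have -> : (fun n => Rintegral (@leb3 R) setT (fun x => V0 * (u_ n x * v x))) =
    fun n => V0 * Rintegral (@leb3 R) setT (fun x => u_ n x * v x).
  by apply/funext => n; rewrite RintegralZl//; apply: L2_mul; exact: Hs_L2.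
apply: cvgMr; apply: (@L2_weak _ _ _ (@leb3 R) _ _ _ (C / V0)) => //.
- by move=> n; exact: Hs_L2.
- exact: Hs_L2.
- by move=> n; rewrite (le_trans (normV_ge_L2 (Hu_ n)))// ler_pM2r ?invr_gt0.
Qed.

(** Pass to the limit in [2 * bform (u_ n) u <= normV (u_ n) + normV u]. *)
Lemma normV_weak_le (u_ : nat -> R3 R -> R) u C A :
  (forall n, Hs s (u_ n)) -> (forall n, normV s V0 (u_ n) <= C) ->
  measurable_fun setT u ->
  {ae @leb3 R, forall x, u_ n x @[n --> \oo] --> u x} ->
  normV s V0 (u_ n) @[n --> \oo] --> A -> normV s V0 u <= A.
Proof.
move=> Hu_ uC mu cu cA; have [Hu /(_ _ Hu) cw] := Hs_weak Hu_ uC mu cu.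
suff : 2 * normV s V0 u <= A + normV s V0 u by lra.
have c1 : (2 * bform (u_ n) u) @[n --> \oo] --> 2 * normV s V0 u.
  by rewrite normVE; apply: cvgMr.
have c2 : (normV s V0 (u_ n) + normV s V0 u) @[n --> \oo] --> A + normV s V0 u.
  by apply: cvgD => //; exact: cvg_cst.
apply: (ler_cvg_to c1 c2).
apply: nearW => n; have := bform_CS (Hu_ n) Hu.
by rewrite ler_norml => /andP[_]; lra.
Qed.

End FractionalSpace.

(** * Dyadic averages and the subcritical embedding *)

Section Cells.
Context (R : realType).
Implicit Types (x y z : R3 R) (u : R3 R -> R) (k : nat).

(** Index of the half-open dyadic interval of length [2^-k] containing [t]; three equal indices mean
    the same dyadic cube. *)
Definition flr k (t : R) : int := Num.floor (2 ^+ k * t).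

Definition samecell k x y : bool :=
  [&& flr k x.1.1 == flr k y.1.1, flr k x.1.2 == flr k y.1.2 & flr k x.2 == flr k y.2].

Definition chi k x y : R := (samecell k x y)%:R.

Lemma flr_eq_dist k (a b : R) : flr k a = flr k b -> `|a - b| <= (2 ^+ k)^-1.
Proof.
move=> e; have p : 0 < 2 ^+ k :> R by rewrite exprn_gt0.
have := floor_itv (2 ^+ k * a); have := floor_itv (2 ^+ k * b).
rewrite -/(flr k a) -/(flr k b) e intrD => /andP[b1 b2] /andP[a1 a2].
rewrite -(ler_pM2l p) mulfV ?gt_eqF// -[X in X * _]gtr0_norm// -normrM mulrBr.
by rewrite ler_norml; apply/andP; split; lra.
Qed.

Lemma flrS k (a b : R) : flr k.+1 a = flr k.+1 b -> flr k a = flr k b.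
Proof.
wlog ab : a b / a <= b => [h e|e].
  by have [/h->//|/ltW/h->] := leP a b.
have p : 0 < 2 ^+ k :> R by rewrite exprn_gt0.
have := floor_itv (2 ^+ k * a); have := floor_itv (2 ^+ k * b).
rewrite -/(flr k a) -/(flr k b) !intrD => /andP[b1 b2] /andP[a1 a2].
apply/eqP; rewrite eq_le le_floor ?ler_pM2l//= leNgt; apply/negP => h.
have {}h : (flr k a + 1 <= flr k b)%R by rewrite lezD1.
have h1 : (flr k a)%:~R + 1 <= (flr k b)%:~R :> R by rewrite -(ler_int R) intrD in h.
(* The integer [2 * flr k b] would separate [a] from [b] at the finer level. *)
have : (2 * flr k b <= flr k.+1 b)%R.
  by rewrite floor_ge_int intrM exprS -mulrA ler_pM2l.
rewrite -e floor_ge_int intrM exprS -mulrA ler_pM2l//; lra.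
Qed.

Lemma samecell_eq k x y : samecell k x y -> samecell k x = samecell k y.
Proof. by move=> /and3P[/eqP a /eqP b /eqP c]; apply/funext => z; rewrite /samecell a b c. Qed.

Lemma samecellS k x y : samecell k.+1 x y -> samecell k x y.
Proof.
by move=> /and3P[/eqP a /eqP b /eqP c]; apply/and3P; split; apply/eqP; apply: flrS.
Qed.

Lemma samecell0 k x y : samecell k x y -> samecell 0 x y.
Proof. by elim: k => // k IH /samecellS. Qed.

Lemma samecell_dist k x y : samecell k x y -> dist3 x y <= 2 * (2 ^+ k)^-1.
Proof.
move=> /and3P[/eqP/flr_eq_dist a /eqP/flr_eq_dist b /eqP/flr_eq_dist c].
have p : 0 <= (2 ^+ k)^-1 :> R by rewrite invr_ge0 exprn_ge0.
have K (t : R) : `|t| <= (2 ^+ k)^-1 -> t ^+ 2 <= (2 ^+ k)^-1 ^+ 2.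
  by move=> h; rewrite -(real_normK (num_real t)) ler_pXn2r ?nnegrE.
rewrite /dist3 -[leRHS]ger0_norm ?mulr_ge0// -sqrtr_sqr ler_wsqrtr//.
by have := K _ a; have := K _ b; have := K _ c; rewrite exprMn; nra.
Qed.

Lemma dist3_eq0 x y : dist3 x y = 0 -> x = y.
Proof.
case: x => [[x1 x2] x3]; case: y => [[y1 y2] y3]; rewrite /dist3 /= => /eqP.
rewrite sqrtr_eq0 => h.
have := sqr_ge0 (x1 - y1); have := sqr_ge0 (x2 - y2); have := sqr_ge0 (x3 - y3) => h1 h2 h3.
have /eqP : (x1 - y1) ^+ 2 = 0 by lra.
have /eqP : (x2 - y2) ^+ 2 = 0 by lra.
have /eqP : (x3 - y3) ^+ 2 = 0 by lra.
by rewrite !sqrf_eq0 !subr_eq0 => /eqP-> /eqP-> /eqP->.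
Qed.

Lemma measurable_flr k : measurable_fun setT (fun t : R => (flr k t)%:~R : R).
Proof.
apply: nondecreasing_measurable => // a b ab.
by rewrite ler_int le_floor// ler_pM2l// exprn_gt0.
Qed.

Lemma measurable_samecell k :
  measurable_fun setT (fun z : R3 R * R3 R => samecell k z.1 z.2).
Proof.
have E (a b : R) : (flr k a == flr k b) = ((flr k a)%:~R == (flr k b)%:~R :> R).
  by rewrite eqr_int.
have m1 : measurable_fun setT (fun z : R3 R * R3 R => z.1.1.1).
  by apply: measurableT_comp => //; apply: measurableT_comp.
have m2 : measurable_fun setT (fun z : R3 R * R3 R => z.1.1.2).
  by apply: measurableT_comp => //; apply: measurableT_comp.
have m3 : measurable_fun setT (fun z : R3 R * R3 R => z.1.2).
  by apply: measurableT_comp.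
have m4 : measurable_fun setT (fun z : R3 R * R3 R => z.2.1.1).
  by apply: measurableT_comp => //; apply: measurableT_comp.
have m5 : measurable_fun setT (fun z : R3 R * R3 R => z.2.1.2).
  by apply: measurableT_comp => //; apply: measurableT_comp.
have m6 : measurable_fun setT (fun z : R3 R * R3 R => z.2.2).
  by apply: measurableT_comp.
have mf := measurable_flr k.
rewrite /samecell; under eq_fun do rewrite !E.
apply: measurable_and; last apply: measurable_and; apply: measurable_fun_eqr;
  exact: (measurableT_comp mf).
Qed.

Lemma chi_ge0 k x y : 0 <= chi k x y. Proof. by rewrite ler0n. Qed.

Lemma chi_sqr k x y : chi k x y ^+ 2 = chi k x y.
Proof. by rewrite /chi; case: samecell; rewrite ?expr1n ?expr0n. Qed.

Lemma measurable_chi2 k : measurable_fun setT (fun z : R3 R * R3 R => chi k z.1 z.2).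
Proof.
have -> : (fun z : R3 R * R3 R => chi k z.1 z.2) =
   fun z : R3 R * R3 R => if samecell k z.1 z.2 then 1 else 0.
  by apply/funext => z; rewrite /chi; case: samecell.
by apply: measurable_fun_ifT => //; exact: measurable_samecell.
Qed.

Lemma measurable_chi k x : measurable_fun setT (chi k x).
Proof. exact: (measurable_fun_pair2 _ (measurable_chi2 k)). Qed.

Let slab k (t : R) : set R := `[(flr k t)%:~R / 2 ^+ k, (flr k t + 1)%:~R / 2 ^+ k[%classic.

Let slabP k (t r : R) : slab k t r <-> flr k t = flr k r.
Proof.
have p : 0 < 2 ^+ k :> R by rewrite exprn_gt0.
rewrite /slab /= in_itv /= ler_pdivrMr// ltr_pdivlMr// ![r * _]mulrC.
rewrite -floor_eq -/(flr k r).
by split => [/eqP//|->].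
Qed.

Lemma chi_int k x : (\int[@leb3 R]_y (chi k x y)%:E = ((8 ^+ k)^-1)%:E)%E.
Proof.
have mS t : measurable (slab k t : set (measurableTypeR R)) by exact: measurable_itv.
have lS t : lebesgue_measure (slab k t) = ((2 ^+ k)^-1)%:E.
  rewrite lebesgue_measure_itv/= lte_fin ltr_pM2r ?invr_gt0 ?exprn_gt0//.
  by rewrite ltr_int ltzD1 lexx -EFinB -mulrBl intrD addrC addKr mul1r.
pose A := (slab k x.1.1 `*` slab k x.1.2) `*` slab k x.2.
have -> : (fun y => (chi k x y)%:E) = fun y => (\1_A y)%:E.
  apply/funext => y; congr EFin; rewrite /chi indicE; congr (nat_of_bool _)%:R.
  apply/idP/idP.
    by move=> /and3P[/eqP a /eqP b /eqP c]; apply/mem_set; split; [split|]; apply/slabP.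
  by move/set_mem => [[/slabP a /slabP b] /slabP c]; apply/and3P; split; apply/eqP.
have mA12 : measurable ((slab k x.1.1 `*` slab k x.1.2) :
   set (measurableTypeR R * measurableTypeR R)%type) by exact: measurableX.
rewrite integral_indic//; last exact: measurableX.
rewrite setIT [LHS](@product_measure1E _ _ _ _ _ (@leb2 R) (@lebesgue_measure R))//.
rewrite [X in (X * _)%E](@product_measure1E _ _ _ _ _ (@lebesgue_measure R) (@lebesgue_measure R))//.
rewrite [X in (_ * X)%E]lS [X in (X * _ * _)%E]lS [X in (_ * X * _)%E]lS -!EFinM -!invfM -!exprMn.
congr ((_ ^+ _)^-1)%:E; ring.
Qed.

Lemma chi_intg k x : intg (@leb3 R) (chi k x).
Proof.
apply/intg_ge0P; [exact: measurable_chi|exact: chi_ge0|].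
by rewrite [X in (X < _)%E]chi_int ltry.
Qed.

Lemma chi_Rint k x : Rintegral (@leb3 R) setT (chi k x) = (8 ^+ k)^-1.
Proof. by rewrite /Rintegral [X in fine X]chi_int. Qed.

Lemma chi_L2 k x : L2 (@leb3 R) (chi k x).
Proof.
split; first exact: measurable_chi.
by under [X in integrable _ _ X]eq_fun do rewrite /= chi_sqr; exact: chi_intg.
Qed.

End Cells.

Section Averages.
Context (R : realType) (s : R).
Implicit Types (x y : R3 R) (u : R3 R -> R) (k : nat) (c : R).
Notation mu := (@leb3 R).

(** [8 ^+ k] is the inverse of the volume of a dyadic cube of side [2^-k]. *)
Definition avg k u x : R := 8 ^+ k * Rintegral mu setT (fun y => chi k x y * u y).

(** The mean square distance of [u x] from the values of [u] on the cell of [x]. It dominates the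
    squared distance to the average, and its integral decays geometrically in [k]. *)
Definition osc k u x : R :=
  8 ^+ k * Rintegral mu setT (fun y => chi k x y * (u x - u y) ^+ 2).

Lemma chi_sqr_intg k u x c : L2 mu u ->
  intg mu (fun y => chi k x y * (c - u y) ^+ 2).
Proof.
move=> Lu; have [mu_ iu] := Lu.
apply: (intg_dom _ (intgD (intgZ (2 * c ^+ 2) (chi_intg k x)) (intgZ 2 iu))).
  apply: measurable_funM; first exact: measurable_chi.
  by apply: measurable_funX; apply: measurable_funB.
move=> y; rewrite ger0_norm; last by rewrite mulr_ge0 ?chi_ge0 ?sqr_ge0.
rewrite /chi; case: samecell; rewrite ?mul1r ?mulr1 ?mul0r ?mulr0 ?add0r.
  have := sqr_ge0 (c + u y); lra.
by rewrite mulr_ge0// sqr_ge0.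
Qed.

(** Jensen's inequality on the cell of [x], obtained as Cauchy-Schwarz for [chi] and
    [chi * (c - u)]; [chi] is its own square. *)
Lemma avg_jensen k u x c : L2 mu u ->
  (c - avg k u x) ^+ 2 <=
  8 ^+ k * Rintegral mu setT (fun y => chi k x y * (c - u y) ^+ 2).
Proof.
move=> Lu; have [mu_ iu] := Lu.
have p : 0 < 8 ^+ k :> R by rewrite exprn_gt0.
have ic := chi_intg k x; have Lc := chi_L2 k x.
have icu := L2_mul Lc Lu.
have Lg : L2 mu (fun y => chi k x y * (c - u y)).
  split.
    apply: measurable_funM; first exact: measurable_chi.
    exact: measurable_funB.
  under [X in integrable _ _ X]eq_fun do rewrite /= exprMn chi_sqr.
  exact: chi_sqr_intg.
have -> : c - avg k u x =
    8 ^+ k * Rintegral mu setT (fun y => chi k x y * (chi k x y * (c - u y))).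
  have -> : (fun y => chi k x y * (chi k x y * (c - u y))) =
      fun y => c * chi k x y - chi k x y * u y.
    by apply/funext => y; rewrite mulrA -expr2 chi_sqr; ring.
  rewrite RintegralB//; last exact: intgZ.
  rewrite RintegralZl// chi_Rint mulrBr [c * _]mulrC mulrA mulfV ?gt_eqF// mul1r//.
rewrite exprMn.
have := Rint_CS Lc Lg.
have -> : (fun y => (chi k x y * (c - u y)) ^+ 2) =
  fun y => chi k x y * (c - u y) ^+ 2.
  by apply/funext => y; rewrite exprMn chi_sqr.
have -> : (fun y => chi k x y ^+ 2) = chi k x by apply/funext => y; rewrite chi_sqr.
rewrite chi_Rint => h; rewrite (le_trans (ler_wpM2l (sqr_ge0 _) h))//.
by rewrite expr2 -mulrA [X in _ * X]mulrA mulfV ?gt_eqF// mul1r.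
Qed.

Lemma avg_samecell k u x y : samecell k x y -> avg k u x = avg k u y.
Proof. by move=> /samecell_eq e; rewrite /avg /chi e. Qed.

Lemma osc_ge0 k u x : 0 <= osc k u x.
Proof.
rewrite mulr_ge0 ?exprn_ge0// Rintegral_ge0// => y _.
by rewrite mulr_ge0 ?chi_ge0 ?sqr_ge0.
Qed.

Lemma avg_osc k u x : L2 mu u -> (u x - avg k u x) ^+ 2 <= osc k u x.
Proof. exact: avg_jensen. Qed.

Hypothesis s_gt0 : 0 < s.

(** Two points of one cell are at distance at most [2 * 2^-k]; the power [3 + 2 * s] of this number
    is [D / D ^+ k]. *)
Let D : R := 2 `^ (3 + 2 * s).

Let D_gt0 : 0 < D. Proof. exact: powR_gt0. Qed.

Let powR_scale k : (2 * (2 ^+ k)^-1) `^ (3 + 2 * s) = D / D ^+ k.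
Proof.
rewrite powRM// ?invr_ge0 ?exprn_ge0//; congr (_ * _).
rewrite -powR_inv1 ?exprn_ge0// powRAC powR_inv1 ?powR_ge0//; congr _^-1.
by rewrite -[2 ^+ k]powR_mulrn// powRAC powR_mulrn// powR_ge0.
Qed.

(** Within a cell the kernel is at least [D ^+ k / D], so the squared increments are dominated by
    [quot ^+ 2]; the normalisation [8 ^+ k] leaves the rate [8 / D = 2^(-2s)]. *)
Lemma osc_int k u : Hs s u -> intg mu (osc k u) /\
  Rintegral mu setT (osc k u) <=
    D * (8 / D) ^+ k * Rintegral (@leb6 R) setT (fun z => quot s u z ^+ 2).
Proof.
move=> Hu; have Lu := Hs_L2 Hu; have [mu_ iu] := Lu; have [mq iq] := Hs_quot Hu.
pose g (z : R3 R * R3 R) := chi k z.1 z.2 * (u z.1 - u z.2) ^+ 2.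
have [m1 m2] := measurable_fst_snd mu_.
have mg : measurable_fun setT g.
  apply: measurable_funM; first exact: measurable_chi2.
  by apply: measurable_funX; exact: measurable_funB.
have mgE : measurable_fun setT (EFin \o g) by exact/measurable_EFinP.
have g0 z : (0 <= (EFin \o g) z)%E.
  by rewrite lee_fin mulr_ge0 ?chi_ge0 ?sqr_ge0.
have oE x : (osc k u x)%:E = ((8 ^+ k)%:E * \int[mu]_y (g (x, y))%:E)%E.
  by rewrite /osc EFinM EFin_Rint//; exact: chi_sqr_intg.
have mo : measurable_fun setT (fun x => \int[mu]_y (g (x, y))%:E)%E.
  exact: (measurable_fun_fubini_tonelli_F (m2 := @leb3 R) (EFin \o g) mgE g0).
have p : 0 < 8 ^+ k :> R by rewrite exprn_gt0.
have c0 : 0 <= D / D ^+ k by rewrite divr_ge0 ?exprn_ge0 ?powR_ge0.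
have gle z : g z <= D / D ^+ k * quot s u z ^+ 2.
  rewrite /g /chi; case: (boolP (samecell k z.1 z.2)) => [sc|_]; last first.
    by rewrite mul0r mulr_ge0// sqr_ge0.
  rewrite mul1r; have [d0|dn0] := eqVneq (dist3 z.1 z.2) 0.
    by rewrite (dist3_eq0 d0) subrr expr0n/= mulr_ge0// sqr_ge0.
  have d0 : 0 < dist3 z.1 z.2 by rewrite lt_neqAle eq_sym dn0 sqrtr_ge0.
  rewrite /quot exprMn gagw_sqr mulrCA ler_peMr ?sqr_ge0// ler_pdivlMr ?powR_gt0// mul1r.
  rewrite -powR_scale; apply: ge0_ler_powR; rewrite ?nnegrE ?sqrtr_ge0//.
  - by rewrite addr_ge0// mulr_ge0// ltW.
  - exact: samecell_dist.
apply: intg_le_bound.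
- apply/measurable_EFinP.
  have -> : (EFin \o osc k u) = (fun x => (8 ^+ k)%:E * \int[mu]_y (g (x, y))%:E)%E.
    by apply/funext => x; exact: oE.
  by apply: emeasurable_funM.
- exact: osc_ge0.
- under eq_integral do rewrite oE.
  rewrite ge0_integralZl//; first last.
  + by move=> x _; apply: integral_ge0 => y _; exact: g0.
  have -> : (\int[mu]_x \int[mu]_y (g (x, y))%:E = \int[@leb6 R]_z (g z)%:E)%E.
    by rewrite -[LHS](fubini_tonelli1 (m1 := @leb3 R) (m2 := @leb3 R) (EFin \o g) mgE g0).
  have -> : D * (8 / D) ^+ k = 8 ^+ k * (D / D ^+ k).
    by rewrite expr_div_n; ring.
  rewrite -mulrA EFinM lee_pmul2l// -RintegralZl// EFin_Rint; last exact: intgZ.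
  apply: ge0_le_integral => //.
  + by move=> z _; rewrite lee_fin mulr_ge0// sqr_ge0.
  + by apply/measurable_EFinP; apply: measurable_funM => //; exact: measurable_funX.
  + by move=> z _; rewrite lee_fin.
Qed.

(** The average at scale [k] is constant on the cell at scale [k.+1], so Jensen's inequality bounds
    the step by [8 ^+ k.+1] times the integral of [osc k]. The resulting rate is
    [64 / D = 2^(3 - 2s)]. *)
Lemma avg_step k u x : Hs s u ->
  (avg k u x - avg k.+1 u x) ^+ 2 <=
  8 * D * (64 / D) ^+ k * Rintegral (@leb6 R) setT (fun z => quot s u z ^+ 2).
Proof.
move=> Hu; have Lu := Hs_L2 Hu; have [io ho] := osc_int k Hu.
apply: (le_trans (avg_jensen k.+1 x _ Lu)).
have p : 0 < 8 ^+ k.+1 :> R by rewrite exprn_gt0.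
set Q := Rintegral (@leb6 R) _ _ in ho *.
have -> : 8 * D * (64 / D) ^+ k * Q = 8 ^+ k.+1 * (D * (8 / D) ^+ k * Q).
  have -> : 64 / D = 8 * (8 / D) by ring.
  by rewrite exprS [X in _ * X * Q]exprMn; ring.
rewrite ler_pM2l//; apply: le_trans ho.
apply: le_Rint => //; first exact: chi_sqr_intg.
move=> y; rewrite /chi; case: (boolP (samecell _ _ _)) => [sc|_]; last first.
  by rewrite mul0r osc_ge0.
by rewrite mul1r (avg_samecell _ (samecellS sc)) -sqrrN opprB avg_osc.
Qed.

End Averages.

Lemma geometric_small (R : realType) (r C e : R) : 0 <= r -> r < 1 -> 0 <= C -> 0 < e ->
  exists n, C * r ^+ n <= e.
Proof.
move=> r0 r1 C0 e0.
have C1 : 0 < C + 1 by rewrite ltr_wpDl.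
have h : (fun n => r ^+ n) @ \oo --> 0 by apply: cvg_expr; rewrite ger0_norm.
move/cvgrPdist_le : h => /(_ (e / (C + 1)) (divr_gt0 e0 C1)) [n _ /(_ n (leqnn n))].
rewrite sub0r normrN ger0_norm ?exprn_ge0// ler_pdivlMr// => h; exists n.
by rewrite (le_trans _ h)// mulrC ler_wpM2l ?exprn_ge0// lerDl.
Qed.

Lemma powR_split2 (R : realType) (q x : R) : 2 < q -> 0 <= x ->
  x `^ q = x `^ (q - 2) * x ^+ 2.
Proof.
move=> q2 x0; rewrite -(powR_mulrn 2 x0) -powRD ?subrK//.
by apply/implyP => /eqP; lra.
Qed.

Lemma pow2_gt1 (R : realType) (x : R) : 0 < x -> 1 < 2 `^ x :> R.
Proof.
by move=> x0; rewrite -[ltLHS](congr1 (@^~ x) (powR1 R)) gt0_ltr_powR ?nnegrE// ltr1n.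
Qed.

Lemma pow2_lt1 (R : realType) (x : R) : x < 0 -> 2 `^ x < 1 :> R.
Proof.
by move=> x0; rewrite -[x]opprK powRN invf_lt1 ?powR_gt0// pow2_gt1// oppr_gt0.
Qed.

(** * The subcritical embedding and Lions' vanishing lemma *)

Section Sobolev.
Context (R : realType) (s q : R).
Hypotheses (s_gt0 : 0 < s) (s_lt1 : s < 1) (q_gt2 : 2 < q) (q_lt : q < 6 / (3 - 2 * s)).
Implicit Types (x y : R3 R) (u : R3 R -> R) (k : nat) (c T : R).
Notation mu := (@leb3 R).

Let D : R := 2 `^ (3 + 2 * s).
(** [b] is the growth rate of the averages, [b ^+ 2 = 64 / D]; [a = 2^(-2s)] is the decay rate of
    the oscillations; [r] is the rate of the oscillations weighted by the level to the power
    [q - 2]. The condition [r < 1] amounts to [q < 6 / (3 - 2 * s)]. *)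
Let b : R := 2 `^ (3 / 2 - s).
Let a : R := 8 / D.
Let r : R := b `^ (q - 2) * a.

Let D_gt0 : 0 < D. Proof. exact: powR_gt0. Qed.

Let b_gt1 : 1 < b.
Proof.
have sl := s_lt1.
by apply: pow2_gt1; lra.
Qed.

Let b_gt0 : 0 < b. Proof. exact: lt_trans b_gt1. Qed.

Let pow2nat n : 2 `^ (n%:R) = 2 ^+ n :> R. Proof. exact: powR_mulrn. Qed.

Let bD : b ^+ 2 = 64 / D.
Proof.
rewrite -powR_mulrn ?powR_ge0// -powRrM.
have -> : 64 = 2 `^ (6%:R) :> R by rewrite pow2nat; ring.
by rewrite /D -powRN -powRD ?pnatr_eq0 ?implybT//; congr (_ `^ _); lra.
Qed.

Let aE : a = 2 `^ (- (2 * s)).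
Proof.
rewrite /a; have -> : 8 = 2 `^ (3%:R) :> R by rewrite pow2nat; ring.
by rewrite /D -powRN -powRD ?pnatr_eq0 ?implybT//; congr (_ `^ _); lra.
Qed.

Let a_gt0 : 0 < a. Proof. by rewrite divr_gt0. Qed.

Let a_lt1 : a < 1.
Proof.
have sl := s_gt0.
by rewrite aE pow2_lt1//; lra.
Qed.

Let r_ge0 : 0 <= r. Proof. by rewrite mulr_ge0 ?powR_ge0// ltW. Qed.

Let r_lt1 : r < 1.
Proof.
have sl := s_lt1; have ql := q_lt.
rewrite /r aE /b -powRrM -powRD ?pnatr_eq0 ?implybT//.
apply: pow2_lt1.
have h : q * (3 - 2 * s) < 6 by rewrite -ltr_pdivlMr//; lra.
lra.
Qed.

Let c0 : R := Num.sqrt (8 * D).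
(** Chosen so that [Kc + c0 <= Kc * b], which carries the bound [Kc * T * b ^+ k] on the averages
    from one scale to the next. *)
Let Kc : R := 1 + c0 / (b - 1).

Let Kc_ge1 : 1 <= Kc.
Proof. by rewrite lerDl divr_ge0 ?sqrtr_ge0// subr_ge0 ltW. Qed.

Let lam T k := 2 * Kc * T * b ^+ k.

Let lam_gt0 T k : 0 < T -> 0 < lam T k.
Proof.
move=> T0; rewrite !mulr_gt0 ?exprn_gt0//; exact: lt_le_trans Kc_ge1.
Qed.

(** The [H^s] norm, not its square, is at most [T]; the potential [V0] is kept out of the
    embedding. *)
Definition bounded2 u T :=
  Rintegral mu setT (fun x => u x ^+ 2) +
  Rintegral (@leb6 R) setT (fun z => quot s u z ^+ 2) <= T ^+ 2.

Let avg_lam k u T x : Hs s u -> 0 < T -> bounded2 u T -> 2 * `|avg k u x| <= lam T k.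
Proof.
move=> Hu T0 uT; have Lu := Hs_L2 Hu; have [mu_ iu] := Lu.
have i20 : 0 <= Rintegral mu setT (fun x => u x ^+ 2).
  by apply: Rintegral_ge0 => y _; exact: sqr_ge0.
have q20 : 0 <= Rintegral (@leb6 R) setT (fun z => quot s u z ^+ 2).
  by apply: Rintegral_ge0 => y _; exact: sqr_ge0.
have i2T : Rintegral mu setT (fun x => u x ^+ 2) <= T ^+ 2 by rewrite (le_trans _ uT)// lerDl.
have q2T : Rintegral (@leb6 R) setT (fun z => quot s u z ^+ 2) <= T ^+ 2.
  by rewrite (le_trans _ uT)// lerDr.
have sq (v w : R) : 0 <= w -> v ^+ 2 <= w ^+ 2 -> `|v| <= w.
  by move=> w0; rewrite -(real_normK (num_real v)) ler_pXn2r ?nnegrE.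
rewrite /lam -!mulrA ler_pM2l//.
elim: k => [|k IH].
  apply: sq; first by rewrite expr0 mulr1 mulr_ge0// ltW// (lt_le_trans _ Kc_ge1).
  have := avg_jensen 0 x 0 Lu; rewrite sub0r sqrrN expr0 mul1r => /le_trans; apply.
  apply: (@le_trans _ _ (T ^+ 2)); last first.
    rewrite expr0 mulr1 exprMn ler_peMl ?sqr_ge0//.
    by rewrite expr_ge1// (le_trans _ Kc_ge1).
  apply: le_trans i2T; apply: le_Rint => //; first exact: chi_sqr_intg.
  move=> y; rewrite sub0r sqrrN /chi; case: samecell; rewrite ?mul1r// mul0r sqr_ge0//.
have st := avg_step s_gt0 k x Hu.
have {}st : `|avg k u x - avg k.+1 u x| <= c0 * b ^+ k * T.
  apply: sq; first by rewrite !mulr_ge0 ?sqrtr_ge0 ?exprn_ge0// ltW.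
  apply: (le_trans st); rewrite -/D -bD.
  have D8 : 0 <= 8 * D by rewrite mulr_ge0// ltW.
  have -> : (c0 * b ^+ k * T) ^+ 2 = 8 * D * (b ^+ 2) ^+ k * T ^+ 2.
    by rewrite exprAC -(sqr_sqrtr D8) -/c0; ring.
  by apply: ler_wpM2l => //; apply: mulr_ge0 => //; rewrite exprn_ge0// sqr_ge0.
have -> : avg k.+1 u x = avg k u x - (avg k u x - avg k.+1 u x) by ring.
rewrite (le_trans (ler_normB _ _))// (le_trans (lerD IH st))//.
have -> : Kc * (T * b ^+ k) + c0 * b ^+ k * T = (Kc + c0) * (T * b ^+ k) by ring.
have -> : Kc * (T * b ^+ k.+1) = (Kc * b) * (T * b ^+ k) by rewrite exprS; ring.
rewrite ler_wpM2r ?mulr_ge0 ?exprn_ge0 ?(ltW T0) ?(ltW b_gt0)//.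
have b10 : 0 < b - 1 by rewrite subr_gt0.
have : (Kc - 1) * (b - 1) = c0 by rewrite /Kc addrC addKr divfK// gt_eqF.
lra.
Qed.

(** Cut-off at the height [lam T k], which tends to infinity with [k]; Fatou's lemma removes it in
    the end. *)
Let tr u T k x : R := if `|u x| <= lam T k then `|u x| `^ q else 0.

(** [|u x| > m >= 2 |avg|] forces [|u x| <= 2 |u x - avg|]. Two of the [q] powers are spent on this,
    the other [q - 2] on [|u x| <= l]. *)
Let powR_le_osc u k x (l m : R) : L2 mu u -> 2 * `|avg k u x| <= m ->
  m < `|u x| -> `|u x| <= l ->
  `|u x| `^ q <= 4 * l `^ (q - 2) * osc k u x.
Proof.
move=> Lu am mu_ ul.
rewrite powR_split2// [4 * _]mulrC -mulrA.
have q20 : 0 <= q - 2 by have := q_gt2 => ?; lra.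
apply: ler_pM; rewrite ?powR_ge0 ?sqr_ge0//.
  by apply: ge0_ler_powR; rewrite ?nnegrE// (le_trans _ ul).
apply: (@le_trans _ _ (4 * (u x - avg k u x) ^+ 2)); last by rewrite ler_pM2l// avg_osc.
rewrite -(real_normK (num_real (u x - _))).
have : `|u x| <= 2 * `|u x - avg k u x|.
  have := ler_normD (u x - avg k u x) (avg k u x); rewrite subrK; lra.
have := normr_ge0 (u x); nra.
Qed.

(** Three ranges of [|u x|]: up to [d]; from [d] to [lam T J], measured against the averages at
    scale [m]; and the levels above [lam T J], one scale each. The embedding takes [m = J = 0] and
    [d = lam T 0], Lions' lemma tunes all three. *)
Let tr_le u T d m J n x : Hs s u -> 0 < T -> bounded2 u T -> 0 < d -> (forall x, 2 * `|avg m u x| <= d) ->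
  tr u T (J + n) x <= d `^ (q - 2) * u x ^+ 2 + 4 * lam T J `^ (q - 2) * osc m u x +
     \sum_(k < n) 4 * lam T (J + k).+1 `^ (q - 2) * osc (J + k) u x.
Proof.
move=> Hu T0 uT d0 ad; have Lu := Hs_L2 Hu.
have p1 : 0 <= d `^ (q - 2) * u x ^+ 2 by rewrite mulr_ge0 ?powR_ge0 ?sqr_ge0.
have p2 k l : 0 <= 4 * lam T k `^ (q - 2) * osc l u x.
  by rewrite mulr_ge0 ?osc_ge0// mulr_ge0 ?powR_ge0.
elim: n => [|n IH].
  rewrite big_ord0 addn0 addr0 /tr; case: ifPn => [uJ|_]; last by rewrite addr_ge0.
  have [ud|du] := leP `|u x| d; last first.
    by rewrite ler_wpDl// (@powR_le_osc _ _ _ _ d).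
  rewrite ler_wpDr// powR_split2// real_normK ?num_real// ler_wpM2r ?sqr_ge0//.
  by have ? := q_gt2; apply: ge0_ler_powR; rewrite ?nnegrE ?(ltW d0)//; lra.
rewrite big_ord_recr /= addrA; have [un|nu] := leP `|u x| (lam T (J + n)).
  rewrite ler_wpDr//; apply: le_trans IH.
  by rewrite /tr un; case: ifPn => // _; exact: powR_ge0.
apply: ler_wpDl; first by rewrite !addr_ge0// sumr_ge0.
rewrite /tr addnS; case: ifPn => // uS.
by apply: (@powR_le_osc _ _ _ _ (lam T (J + n))) => //; exact: avg_lam.
Qed.

Let lamS T k : 0 < T -> lam T k.+1 `^ (q - 2) = (lam T 1) `^ (q - 2) * (b `^ (q - 2)) ^+ k.
Proof.
move=> T0; have -> : lam T k.+1 = lam T 1 * b ^+ k by rewrite /lam exprS expr1; ring.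
rewrite powRM ?exprn_ge0 ?(ltW (lam_gt0 _ _)) ?(ltW b_gt0)//; congr (_ * _).
by rewrite -[b ^+ k]powR_mulrn ?(ltW b_gt0)// powRAC powR_mulrn ?powR_ge0.
Qed.

Let geo J n : \sum_(k < n) r ^+ (J + k) <= r ^+ J / (1 - r).
Proof.
have r1 : 0 < 1 - r by have := r_lt1 => ?; lra.
rewrite ler_pdivlMr//.
have -> : (\sum_(k < n) r ^+ (J + k)) * (1 - r) = r ^+ J - r ^+ (J + n).
  elim: n => [|n IH]; first by rewrite big_ord0 mul0r addn0 subrr.
  by rewrite big_ord_recr /= mulrDl IH addnS exprS; ring.
by rewrite lerBlDr lerDl exprn_ge0.
Qed.

(* Where [|u|] exceeds [lam T k], hence twice its average at scale [k], it is at most twice its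
   distance to that average; so the part of [|u|^q] between the levels [lam T k] and
   [lam T k.+1] is controlled by the oscillation at scale [k], and the sum over [k] is
   geometric because [q] is subcritical. *)
Lemma Lq_core u T d m J : Hs s u -> 0 < T -> bounded2 u T -> 0 < d ->
  (forall x, 2 * `|avg m u x| <= d) ->
  intg mu (fun x => `|u x| `^ q) /\
  Rintegral mu setT (fun x => `|u x| `^ q) <=
    d `^ (q - 2) * T ^+ 2 + 4 * lam T J `^ (q - 2) * (D * a ^+ m * T ^+ 2) +
    4 * lam T 1 `^ (q - 2) * (D * T ^+ 2) * (r ^+ J / (1 - r)).
Proof.
move=> Hu T0 uT d0 ad; have Lu := Hs_L2 Hu; have [mu_ iu] := Lu.
have i2T : Rintegral mu setT (fun x => u x ^+ 2) <= T ^+ 2.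
  by rewrite (le_trans _ uT)// lerDl Rintegral_ge0// => z _; exact: sqr_ge0.
have q2T : Rintegral (@leb6 R) setT (fun z => quot s u z ^+ 2) <= T ^+ 2.
  by rewrite (le_trans _ uT)// lerDr Rintegral_ge0// => z _; exact: sqr_ge0.
have oT k : Rintegral mu setT (osc k u) <= D * a ^+ k * T ^+ 2.
  have [_ h] := osc_int s_gt0 k Hu; apply: (le_trans h); apply: ler_wpM2l => //.
have io k : intg mu (osc k u) by case: (osc_int s_gt0 k Hu).
have mau : measurable_fun setT (fun x => `|u x|) by apply: measurableT_comp.
have mq : measurable_fun setT (fun x => `|u x| `^ q).
  by apply: (measurableT_comp (measurable_powR _)).
pose G n x := d `^ (q - 2) * u x ^+ 2 + 4 * lam T J `^ (q - 2) * osc m u x +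
     \sum_(k < n) 4 * lam T (J + k).+1 `^ (q - 2) * osc (J + k) u x.
have iG n : intg mu (G n).
  apply: intgD; first by apply: intgD; exact: intgZ.
  elim: n => [|n IH].
    under [X in integrable _ _ X]eq_fun do rewrite /= big_ord0.
    exact: integrable0.
  under [X in integrable _ _ X]eq_fun do rewrite /= big_ord_recr /=.
  by apply: intgD => //; exact: intgZ.
have GT n : Rintegral mu setT (G n) <= d `^ (q - 2) * T ^+ 2 +
    4 * lam T J `^ (q - 2) * (D * a ^+ m * T ^+ 2) +
    4 * lam T 1 `^ (q - 2) * (D * T ^+ 2) * (\sum_(k < n) r ^+ (J + k)).
  elim: n => [|n IH].
    have -> : G 0%N = fun x => d `^ (q - 2) * u x ^+ 2 + 4 * lam T J `^ (q - 2) * osc m u x.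
      by apply/funext => x; rewrite /G big_ord0 addr0.
    rewrite RintegralD//; [|exact: intgZ..].
    rewrite big_ord0 mulr0 addr0 RintegralZl// [X in _ + X]RintegralZl//.
    apply: lerD; apply: ler_wpM2l => //; first exact: powR_ge0.
    by rewrite mulr_ge0 ?powR_ge0.
  have -> : G n.+1 = fun x => G n x + 4 * lam T (J + n).+1 `^ (q - 2) * osc (J + n) u x.
    by apply/funext => x; rewrite /G big_ord_recr /= addrA.
  rewrite RintegralD//; last exact: intgZ.
  rewrite big_ord_recr /= mulrDr addrA lerD// RintegralZl//.
  have -> : 4 * lam T 1 `^ (q - 2) * (D * T ^+ 2) * r ^+ (J + n) =
    4 * lam T (J + n).+1 `^ (q - 2) * (D * a ^+ (J + n) * T ^+ 2).
    have -> : r ^+ (J + n) = (b `^ (q - 2)) ^+ (J + n) * a ^+ (J + n) by rewrite -exprMn.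
    by rewrite (lamS (J + n))//; ring.
  by rewrite ler_wpM2l// mulr_ge0 ?powR_ge0.
have itr n : intg mu (tr u T (J + n)).
  apply: (intg_dom _ (iG n)).
    apply: measurable_fun_ifT => //.
    by apply: measurable_fun_ler.
  move=> x; rewrite ger0_norm; first exact: tr_le.
  by rewrite /tr; case: ifPn => // _; exact: powR_ge0.
apply: (@Rint_fatou _ _ _ mu (fun n => tr u T (J + n))) => //.
- by move=> n x; rewrite /tr; case: ifPn => // _; exact: powR_ge0.
- apply: (@aeW _ _ _ mu) => x.
  have [N hN] : exists N, `|u x| <= lam T N.
    have bi0 : 0 <= b^-1 by rewrite invr_ge0 ltW.
    have bi1 : b^-1 < 1 by rewrite invf_lt1.
    have [N h] := geometric_small bi0 bi1 (normr_ge0 (u x)) (lam_gt0 0 T0).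
    exists N; move: h; rewrite exprVn ler_pdivrMr ?exprn_gt0//.
    by rewrite /lam expr0 mulr1.
  apply: (@cvg_trans _ ((fun=> `|u x| `^ q) @ \oo)); last exact: cvg_cst.
  apply: near_eq_cvg; exists N => // n /= Nn; rewrite /tr ifT//.
  rewrite (le_trans hN)// /lam ler_pM2l ?mulr_gt0//; last exact: lt_le_trans Kc_ge1.
  by rewrite ler_weXn2l ?(ltW b_gt1)// (leq_trans Nn)// leq_addl.
- move=> n; rewrite (@le_trans _ _ (Rintegral mu setT (G n)))//.
    by apply: le_Rint => // x; exact: tr_le.
  rewrite (le_trans (GT n))// lerD2l ler_wpM2l//.
  by rewrite !mulr_ge0 ?powR_ge0 ?(ltW D_gt0) ?(ltW T0).
Qed.

Lemma Lq_bound : exists2 C, 0 < C & forall u T, Hs s u -> 0 < T -> bounded2 u T ->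
  intg mu (fun x => `|u x| `^ q) /\
  Rintegral mu setT (fun x => `|u x| `^ q) <= C * T `^ q.
Proof.
have r1 : 0 < 1 - r by have := r_lt1 => ?; lra.
have K0 : 0 < 2 * Kc by rewrite mulr_gt0// (lt_le_trans _ Kc_ge1).
exists ((2 * Kc) `^ (q - 2) + 4 * (2 * Kc) `^ (q - 2) * D +
        4 * (2 * Kc * b) `^ (q - 2) * D / (1 - r)).
  rewrite ltr_pwDr ?addr_ge0 ?powR_ge0//.
  - by rewrite divr_gt0// !mulr_gt0// powR_gt0// mulr_gt0.
  - by rewrite !mulr_ge0 ?powR_ge0 ?(ltW D_gt0).
move=> u T Hu T0 uT.
have [iq h] := @Lq_core u T (lam T 0) 0 0 Hu T0 uT (lam_gt0 0 T0) (fun x => avg_lam 0 x Hu T0 uT).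
split=> //; apply: (le_trans h).
have e0 : lam T 0 `^ (q - 2) * T ^+ 2 = (2 * Kc) `^ (q - 2) * T `^ q.
  by rewrite /lam expr0 mulr1 powRM ?(ltW K0) ?(ltW T0)// (powR_split2 q_gt2 (ltW T0)) mulrA.
have e1 : lam T 1 `^ (q - 2) * T ^+ 2 = (2 * Kc * b) `^ (q - 2) * T `^ q.
  have -> : lam T 1 = 2 * Kc * b * T by rewrite /lam; ring.
  have Kb0 : 0 <= 2 * Kc * b by rewrite ltW// mulr_gt0.
  by rewrite powRM ?(ltW T0)// (powR_split2 q_gt2 (ltW T0)) mulrA.
rewrite !expr0 e0.
have -> : 4 * lam T 0 `^ (q - 2) * (D * 1 * T ^+ 2) = 4 * D * (lam T 0 `^ (q - 2) * T ^+ 2) by ring.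
have -> : 4 * lam T 1 `^ (q - 2) * (D * T ^+ 2) * (1 / (1 - r)) =
   4 * D / (1 - r) * (lam T 1 `^ (q - 2) * T ^+ 2) by ring.
by rewrite e0 e1 le_eqVlt; apply/orP; left; apply/eqP; ring.
Qed.

(* Lions: if the mass in unit cells is uniformly small, so is the [L^q] norm. *)
Lemma Lq_vanish T e : 0 < T -> 0 < e -> exists2 del, 0 < del &
  forall u, Hs s u -> bounded2 u T ->
  (forall x, Rintegral mu setT (fun y => chi 0 x y * u y ^+ 2) <= del) ->
  Rintegral mu setT (fun x => `|u x| `^ q) <= e.
Proof.
move=> T0 e0; have e3 : 0 < e / 3 by rewrite divr_gt0.
have r1 : 0 < 1 - r by have := r_lt1 => ?; lra.
have q20 : 0 < q - 2 by have := q_gt2 => ?; lra.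
have T2 : 0 < T ^+ 2 by rewrite exprn_gt0.
have C1 : 0 <= 4 * lam T 1 `^ (q - 2) * (D * T ^+ 2) / (1 - r).
  by rewrite divr_ge0 ?(ltW r1)// !mulr_ge0 ?powR_ge0 ?(ltW D_gt0) ?(ltW T0).
(* The order of the choices matters: [J] makes the tail small, then [m], which depends on [J], the
   middle range; [d] takes care of small values. *)
have [J hJ] := @geometric_small _ r (4 * lam T 1 `^ (q - 2) * (D * T ^+ 2) / (1 - r)) (e / 3)
  r_ge0 r_lt1 C1 e3.
have C2 : 0 <= 4 * lam T J `^ (q - 2) * (D * T ^+ 2).
  by rewrite !mulr_ge0 ?powR_ge0 ?(ltW D_gt0) ?(ltW T0).
have [m hm] := @geometric_small _ a (4 * lam T J `^ (q - 2) * (D * T ^+ 2)) (e / 3)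
  (ltW a_gt0) a_lt1 C2 e3.
pose d := (e / 3 / T ^+ 2) `^ (q - 2)^-1.
have d0 : 0 < d by rewrite powR_gt0// divr_gt0.
have hd : d `^ (q - 2) * T ^+ 2 = e / 3.
  have x0 : 0 <= e / 3 / T ^+ 2 by rewrite ltW// divr_gt0.
  rewrite /d -powRrM mulVf ?gt_eqF// powRr1//.
  by rewrite divfK// gt_eqF.
(* A cell at scale [m] lies in a unit cell, and averaging over it costs the factor [8 ^+ m]; the
   half serves the requirement [2 * |avg| <= d]. *)
exists ((d / 2) ^+ 2 / 8 ^+ m); first by rewrite divr_gt0 ?exprn_gt0 ?divr_gt0.
move=> u Hu uT ud; have Lu := Hs_L2 Hu; have [mu_ iu] := Lu.
have ad x : 2 * `|avg m u x| <= d.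
  have p : 0 < 8 ^+ m :> R by rewrite exprn_gt0.
  have : avg m u x ^+ 2 <= (d / 2) ^+ 2.
    have := avg_jensen m x 0 Lu; rewrite sub0r sqrrN => /le_trans; apply.
    rewrite -ler_pdivlMl// mulrC; apply: le_trans (ud x).
    apply: le_Rint; first exact: chi_sqr_intg.
      have := chi_sqr_intg 0 x 0 Lu.
      by under [X in integrable _ _ X -> _]eq_fun do rewrite /= sub0r sqrrN.
    move=> y; rewrite sub0r sqrrN ler_wpM2r ?sqr_ge0// /chi.
    case: (boolP (samecell m x y)) => [/samecell0->//|_]; exact: ler0n.
  rewrite -(real_normK (num_real (avg _ _ _))) ler_pXn2r ?nnegrE ?divr_ge0 ?(ltW d0)//.
  lra.
have [_ h] := @Lq_core u T d m J Hu T0 uT d0 ad.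
apply: (le_trans h); rewrite hd.
have ee : e = e / 3 + e / 3 + e / 3 by field.
rewrite [leRHS]ee !lerD//.
  by move: hm; congr (_ <= _); ring.
by move: hJ; congr (_ <= _); ring.
Qed.

End Sobolev.

(** * Local compactness *)

Lemma cvg_of_geometric_steps (R : realType) (v : nat -> R) (C : R) (j0 : nat) :
  (forall j, (j0 <= j)%N -> `|v j.+1 - v j| <= C * (2^-1) ^+ j) -> cvgn v.
Proof.
move=> h; pose w n := v (n + j0)%N.
suff /cvg_ex[l wl] : cvgn w by apply/cvg_ex; exists l; rewrite -(cvg_shiftn j0).
have C0 : 0 <= C.
  have := h j0 (leqnn _); have p : 0 < (2^-1 : R) ^+ j0 by rewrite exprn_gt0// invr_gt0.
  by move/(le_trans (normr_ge0 _)); rewrite pmulr_lge0.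
have sw : cvgn (series (telescope w)).
  apply: normed_cvg; apply: (@series_le_cvg _ _ (geometric C 2^-1)).
  - by move=> n /=; exact: normr_ge0.
  - by move=> n /=; rewrite mulr_ge0// exprn_ge0// invr_ge0.
  - move=> n /=; rewrite /telescope /w /= (le_trans (h _ (leq_addl _ _)))//.
    rewrite ler_wpM2l// ler_wiXn2l ?invr_ge0 ?leq_addr//.
    by rewrite invf_le1// ler1n.
  - by apply: is_cvg_geometric_series; rewrite ger0_norm ?invr_ge0// invf_lt1// ltr1n.
have -> : w = fun n => series (telescope w) n + w 0%N.
  by apply/funext => n; rewrite telescopeK subrK.
by apply: is_cvgD => //; exact: is_cvg_cst.
Qed.

(** The weights [4 ^+ j] against the bounds [8^-j] leave an integrable sum, finite almost
    everywhere. Where its value is [K] and [bx j x = 1], consecutive terms differ by at most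
    [sqrt K * 2^-j]. *)
Lemma cvg_ae_of_steps d (T : measurableType d) (R : realType)
    (mu : {measure set T -> \bar R}) (v bx : nat -> T -> R) :
  (forall n, measurable_fun setT (v n)) -> (forall n, measurable_fun setT (bx n)) ->
  (forall n x, 0 <= bx n x) ->
  (forall x, exists j0, forall j, (j0 <= j)%N -> bx j x = 1) ->
  (forall j, intg mu (fun x => bx j x * (v j.+1 x - v j x) ^+ 2) /\
    Rintegral mu setT (fun x => bx j x * (v j.+1 x - v j x) ^+ 2) <= (8 ^+ j)^-1) ->
  exists u : T -> R, measurable_fun setT u /\
    {ae mu, forall x, v n x @[n --> \oo] --> u x}.
Proof.
move=> mv mb b0 b1 hv.
pose g j x := 4 ^+ j * (bx j x * (v j.+1 x - v j x) ^+ 2).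
have g0 j x : 0 <= g j x by apply: mulr_ge0; rewrite ?exprn_ge0// mulr_ge0 ?sqr_ge0.
have mg j : measurable_fun setT (g j).
  by apply: measurable_funM => //; apply: measurable_funM => //; apply: measurable_funX;
     exact: measurable_funB.
have mgE j : measurable_fun setT (fun x => (g j x)%:E) by exact/measurable_EFinP.
pose h x := (\sum_(0 <= j <oo) (g j x)%:E)%E.
have mh : measurable_fun setT h.
  by apply: ge0_emeasurable_sum => // j x _ _; rewrite lee_fin.
have h0 x : (0 <= h x)%E by apply: nneseries_ge0 => j _ _; rewrite lee_fin.
have ih : (\int[mu]_x h x <= 2%:E)%E.
  rewrite integral_nneseries//; last by move=> j x _; rewrite lee_fin.
  apply: lime_le.
    by apply: is_cvg_nneseries => j _ _; apply: integral_ge0 => x _; rewrite lee_fin.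
  apply: nearW => n.
  apply: (@le_trans _ _ (\sum_(0 <= j < n) ((2^-1 : R) ^+ j)%:E)%E).
    apply: lee_sum => j _; have [ij hj] := hv j.
    rewrite -EFin_Rint; last exact: intgZ.
    rewrite lee_fin RintegralZl// (le_trans (ler_wpM2l _ hj)) ?exprn_ge0//.
    by rewrite -exprVn -exprMn; rewrite (_ : 4 * 8^-1 = 2^-1)//; field.
  rewrite sumEFin lee_fin.
  have -> : \sum_(0 <= j < n) (2^-1 : R) ^+ j = 2 - 2 * (2^-1) ^+ n.
    elim: n => [|n IH]; first by rewrite big_geq// expr0 mulr1 subrr.
    by rewrite big_nat_recr//= IH exprS; field.
  by rewrite gerBl mulr_ge0// exprn_ge0// invr_ge0.
have hfin : {ae mu, forall x, h x \is a fin_num}.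
  have : mu.-integrable setT h.
    apply/integrableP; split => //.
    under eq_integral do rewrite gee0_abs//.
    by rewrite (le_lt_trans ih)// ltry.
  by move/(integrable_ae measurableT); apply: filterS => x; apply.
(* The upper limit is measurable on the whole space, also where the sequence diverges. *)
exists (fun x => fine (limn_esup (fun n => (v n x)%:E))); split.
  apply: (measurableT_comp (f := fine)) => //.
  by apply: measurable_fun_limn_esup => n; exact/measurable_EFinP.
apply: filterS hfin => x hx.
have cv : cvgn (fun n => v n x).
  have [j0 hj0] := b1 x.
  have hr := fineK hx; set K := fine (h x) in hr.
  have K0 : 0 <= K by rewrite -lee_fin hr.
  apply: (@cvg_of_geometric_steps _ _ (Num.sqrt K) j0) => j jj.
  have gK : g j x <= K.
    rewrite -lee_fin hr; have := @nneseries_lim_ge _ (fun j => (g j x)%:E) xpredT 0 j.+1.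
    move=> /(_ (fun _ _ _ => g0 _ x)); apply: le_trans.
    rewrite big_nat_recr//= leeDr// sume_ge0// => i _.
    by rewrite lee_fin.
  rewrite /g hj0// mul1r in gK.
  have p : 0 < 2 ^+ j :> R by rewrite exprn_gt0.
  rewrite exprVn ler_pdivlMr// -[X in _ * X]gtr0_norm// -normrM.
  rewrite -sqrtr_sqr ler_wsqrtr// exprMn exprAC.
  by rewrite (_ : 2 ^+ 2 = 4) 1?mulrC//; ring.
have /cvg_ex[l cl] := cv.
have -> // : fine (limn_esup (fun n => (v n x)%:E)) = l.
have : (v n x)%:E @[n --> \oo] --> l%:E by apply: cvg_EFin => //; exact: nearW.
by move/cvg_limn_einf_sup => [_ ->].
Qed.

Section Boxes.
Context (R : realType).
Implicit Types (c x y : R3 R) (r : R).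

Definition inbox r x y : bool :=
  [&& `|x.1.1 - y.1.1| <= r, `|x.1.2 - y.1.2| <= r & `|x.2 - y.2| <= r].

Definition box r x y : R := (inbox r x y)%:R.

Lemma measurable_box2 r : measurable_fun setT (fun z : R3 R * R3 R => box r z.1 z.2).
Proof.
have -> : (fun z : R3 R * R3 R => box r z.1 z.2) =
   fun z => if inbox r z.1 z.2 then 1 else 0.
  by apply/funext => z; rewrite /box; case: inbox.
apply: measurable_fun_ifT => //.
have m1 : measurable_fun setT (fun z : R3 R * R3 R => z.1.1.1).
  by apply: measurableT_comp => //; apply: measurableT_comp.
have m2 : measurable_fun setT (fun z : R3 R * R3 R => z.1.1.2).
  by apply: measurableT_comp => //; apply: measurableT_comp.
have m3 : measurable_fun setT (fun z : R3 R * R3 R => z.1.2).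
  by apply: measurableT_comp.
have m4 : measurable_fun setT (fun z : R3 R * R3 R => z.2.1.1).
  by apply: measurableT_comp => //; apply: measurableT_comp.
have m5 : measurable_fun setT (fun z : R3 R * R3 R => z.2.1.2).
  by apply: measurableT_comp => //; apply: measurableT_comp.
have m6 : measurable_fun setT (fun z : R3 R * R3 R => z.2.2).
  by apply: measurableT_comp.
apply: measurable_and; last apply: measurable_and; apply: measurable_fun_ler => //;
  by apply: measurableT_comp => //; exact: measurable_funB.
Qed.

Lemma measurable_box r x : measurable_fun setT (box r x).
Proof. exact: (measurable_fun_pair2 _ (measurable_box2 r)). Qed.

Lemma box_ge0 r x y : 0 <= box r x y. Proof. exact: ler0n. Qed.

Lemma boxC r x y : box r x y = box r y x.
Proof.
by rewrite /box /inbox ![`|y.1.1 - _|]distrC ![`|y.1.2 - _|]distrC ![`|y.2 - _|]distrC.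
Qed.

Lemma box_int r x : 0 <= r ->
  (\int[@leb3 R]_y (box r x y)%:E = ((2 * r) ^+ 3)%:E)%E.
Proof.
move=> r0; pose S (t : R) : set R := `[t - r, t + r]%classic.
have SP (t a : R) : S t a <-> `|t - a| <= r.
  by rewrite /S /= in_itv /= ler_norml; split => /andP[h1 h2]; apply/andP; split; lra.
have mS t : measurable (S t : set (measurableTypeR R)) by exact: measurable_itv.
have lS t : lebesgue_measure (S t) = (2 * r)%:E.
  rewrite lebesgue_measure_itv/= lte_fin.
  case: ifPn => [_|]; first by rewrite -EFinB; congr EFin; ring.
  by rewrite -leNgt => h; congr EFin; lra.
pose A := (S x.1.1 `*` S x.1.2) `*` S x.2.
have -> : (fun y => (box r x y)%:E) = fun y => (\1_A y)%:E.
  apply/funext => y; congr EFin; rewrite /box indicE; congr (nat_of_bool _)%:R.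
  apply/idP/idP.
    by move=> /and3P[a b c]; apply/mem_set; split; [split|]; apply/SP.
  by move/set_mem => [[/SP a /SP b] /SP c]; apply/and3P; split.
have mA12 : measurable ((S x.1.1 `*` S x.1.2) :
   set (measurableTypeR R * measurableTypeR R)%type) by exact: measurableX.
rewrite integral_indic//; last exact: measurableX.
rewrite setIT [LHS](@product_measure1E _ _ _ _ _ (@leb2 R) (@lebesgue_measure R))//.
rewrite [X in (X * _)%E](@product_measure1E _ _ _ _ _ (@lebesgue_measure R) (@lebesgue_measure R))//.
rewrite [X in (_ * X)%E]lS [X in (X * _ * _)%E]lS [X in (_ * X * _)%E]lS -!EFinM.
congr EFin; ring.
Qed.

Lemma box_intg r x : 0 <= r -> intg (@leb3 R) (box r x).
Proof.
move=> r0; apply/intg_ge0P; [exact: measurable_box|exact: box_ge0|].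
by rewrite [X in (X < _)%E]box_int// ltry.
Qed.

Lemma box_Rint r x : 0 <= r -> Rintegral (@leb3 R) setT (box r x) = (2 * r) ^+ 3.
Proof. by move=> r0; rewrite /Rintegral [X in fine X]box_int. Qed.

End Boxes.

Lemma ultra_bounded_limit (R : realType) (U : set_system nat) (a : nat -> R) (C : R) :
  UltraFilter U -> (forall n, `|a n| <= C) ->
  exists l : R, forall e, 0 < e -> U [set n | `|a n - l| <= e].
Proof.
move=> UU aC; have PU := @ultra_proper _ _ UU.
have [|p [_ cl]] := @segment_compact R (- C) C (a @ U) _.
  apply: (@filterS _ U _ setT) => [n _|]; last exact: filterT.
  by rewrite /= in_itv/= -ler_norml; exact: aC.
pose l : R := p; exists l => e e0; have [//|nU] := in_ultra_setVsetC [set n | `|a n - l| <= e] UU.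
have h : (a @ U) [set t | e < `|t - l|].
  suff : U [set n | e < `|a n - l|] by [].
  by apply: filterS nU => n /= nle; have [h|//] := leP `|a n - l| e; case: nle.
have [t [/= t1]] := cl _ _ h (nbhsx_ballx l e e0).
by rewrite /ball/= distrC => /ltW; rewrite leNgt t1.
Qed.

Lemma sqr_triangle3 (R : realType) (x y a b : R) :
  (x - y) ^+ 2 <= 3 * (x - a) ^+ 2 + 3 * (y - b) ^+ 2 + 3 * (a - b) ^+ 2.
Proof.
have := sqr_ge0 ((x - a) - (a - b)); have := sqr_ge0 ((x - a) + (y - b)).
by have := sqr_ge0 ((a - b) + (y - b)); lra.
Qed.

Section Compactness.
Context (R : realType) (s : R).
Hypothesis s_gt0 : 0 < s.
Notation mu := (@leb3 R).

Lemma flr_grid k (r : R) : 0 <= r -> exists m (p : 'I_m -> R),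
  forall t, `|t| <= r -> exists i, flr k t = flr k (p i).
Proof.
move=> r0; have p0 : 0 < 2 ^+ k :> R by rewrite exprn_gt0.
have kr : 0 <= 2 ^+ k * r by rewrite mulr_ge0// ltW.
have := archi_boundP kr; set M := Num.bound _ => hM.
exists (M + M)%N, (fun i => (i%:Z - M%:Z)%:~R / 2 ^+ k) => t tr.
have lo : (- M%:Z <= flr k t)%R.
  rewrite floor_ge_int mulrNz; move: tr; rewrite ler_norml => /andP[h _].
  have : 2 ^+ k * (- r) <= 2 ^+ k * t by rewrite ler_pM2l.
  by move: hM; rewrite -pmulrn; lra.
have hi : (flr k t < M%:Z)%R.
  rewrite floor_lt_int; move: tr; rewrite ler_norml => /andP[_ h].
  apply: le_lt_trans hM; by rewrite ler_pM2l.
have hi' : (absz (flr k t + M%:Z)%R < M + M)%N by lia.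
exists (Ordinal hi') => /=.
have -> : ((absz (flr k t + M%:Z)%R)%:Z - M%:Z)%R = flr k t by lia.
by rewrite [RHS]/flr mulrC divfK ?gt_eqF// intrKfloor.
Qed.

Lemma osc_small T e : 0 < e -> exists k, forall u, Hs s u -> bounded2 s u T ->
  Rintegral mu setT (osc k u) <= e.
Proof.
move=> e0; pose D : R := 2 `^ (3 + 2 * s).
have D0 : 0 < D by exact: powR_gt0.
have D8 : 8 / D < 1.
  rewrite ltr_pdivrMr// mul1r /D powRD ?pnatr_eq0 ?implybT//.
  have := s_gt0 => sp; have : 1 < 2 `^ (2 * s) :> R by apply: pow2_gt1; lra.
  by rewrite powR_mulrn//; nra.
have D80 : 0 <= 8 / D by rewrite divr_ge0// ltW.
have C0 : 0 <= D * T ^+ 2 by rewrite mulr_ge0 ?sqr_ge0// ltW.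
have [k hk] := geometric_small D80 D8 C0 e0.
exists k => u Hu uT; have [_ h] := osc_int s_gt0 k Hu.
apply: (le_trans h); apply: le_trans hk.
have -> : D * T ^+ 2 * (8 / D) ^+ k = D * (8 / D) ^+ k * T ^+ 2 by ring.
apply: ler_wpM2l; first by rewrite mulr_ge0 ?exprn_ge0// ltW.
by apply: le_trans uT; rewrite lerDr Rintegral_ge0// => x _; exact: sqr_ge0.
Qed.

Lemma box_diff_intg r (u v : R3 R -> R) : L2 mu u -> L2 mu v ->
  intg mu (fun y => box r 0 y * (u y - v y) ^+ 2).
Proof.
move=> [mu_ iu] [mv iv].
apply: (intg_dom _ (intgD (intgZ 2 iu) (intgZ 2 iv))).
  by apply: measurable_funM; [exact: measurable_box|];
     apply: measurable_funX; exact: measurable_funB.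
move=> x; rewrite ger0_norm; last by rewrite mulr_ge0 ?box_ge0 ?sqr_ge0.
have h := sqr_ge0 (u x + v x); have h1 := sqr_ge0 (u x); have h2 := sqr_ge0 (v x).
by rewrite /box; case: inbox; rewrite ?mul1r ?mul0r; lra.
Qed.

(* At a fine scale the functions are close to their averages, and on a bounded box only finitely
   many averages occur, each of which converges along the ultrafilter. *)
Lemma ultra_local_cauchy (u_ : nat -> R3 R -> R) T U r e :
  UltraFilter U -> 0 < T -> (forall n, Hs s (u_ n)) -> (forall n, bounded2 s (u_ n) T) ->
  0 <= r -> 0 < e ->
  exists S : set nat, U S /\ forall n m, S n -> S m ->
    Rintegral mu setT (fun y => box r 0 y * (u_ n y - u_ m y) ^+ 2) <= e.
Proof.
move=> UU T0 Hu uT r0 e0; have PU := @ultra_proper _ _ UU.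
(* [sqr_triangle3] puts a factor 3 on each of three terms: [3 * (e / 12) + 3 * (e / 12) + 3 * (e /
   6) = e]. *)
have [k hk] := @osc_small T (e / 12) (divr_gt0 e0 (ltr0n _ 12)).
have [m [p hp]] := flr_grid k r0.
pose P (i : 'I_m * 'I_m * 'I_m) : R3 R := ((p i.1.1, p i.1.2), p i.2).
have v0 : 0 <= (2 * r) ^+ 3 by rewrite exprn_ge0// mulr_ge0.
have v1 : 0 < (2 * r) ^+ 3 + 1 by rewrite ltr_wpDl.
pose eta := Num.sqrt (e / 6 / ((2 * r) ^+ 3 + 1)).
have eta0 : 0 < eta by rewrite sqrtr_gt0 !divr_gt0.
have eta2 : eta ^+ 2 * (2 * r) ^+ 3 <= e / 6.
  have x0 : 0 <= e / 6 / ((2 * r) ^+ 3 + 1) by rewrite ltW// !divr_gt0.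
  rewrite /eta sqr_sqrtr// -[leRHS](@divfK _ ((2 * r) ^+ 3 + 1)) ?gt_eqF//.
  by rewrite ler_wpM2l// lerDl.
have avg_bd i n : `|avg k (u_ n) (P i)| <= T * (8 ^+ k + 1).
  have e8 : 0 <= 8 ^+ k :> R by rewrite exprn_ge0.
  have x0 : 0 <= T * (8 ^+ k + 1) by rewrite mulr_ge0 ?(ltW T0)// addr_ge0.
  rewrite -[leRHS]ger0_norm// -!sqrtr_sqr ler_wsqrtr//.
  have [mu_ iu] := Hs_L2 (Hu n).
  have := avg_jensen k (P i) 0 (Hs_L2 (Hu n)); rewrite sub0r sqrrN => /le_trans; apply.
  apply: (@le_trans _ _ (8 ^+ k * T ^+ 2)).
    apply: ler_wpM2l => //.
    apply: (@le_trans _ _ (Rintegral mu setT (fun x => u_ n x ^+ 2))).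
      apply: le_Rint => //; first exact: (chi_sqr_intg _ _ _ (Hs_L2 (Hu n))).
      move=> y; rewrite sub0r sqrrN /chi; case: samecell; rewrite ?mul1r// mul0r sqr_ge0//.
    by apply: le_trans (uT n); rewrite lerDl Rintegral_ge0// => z _; exact: sqr_ge0.
  by rewrite exprMn [leRHS]mulrC ler_wpM2r ?sqr_ge0//; nra.
have : U [set n | forall i, `|avg k (u_ n) (P i) - xget 0 [set l | forall e, 0 < e ->
     U [set n | `|avg k (u_ n) (P i) - l| <= e]]| <= eta / 2].
  apply: filter_forall => i.
  have [l hl] := ultra_bounded_limit UU (avg_bd i).
  have := @xgetI _ 0 [set l | forall e, 0 < e -> U [set n | `|avg k (u_ n) (P i) - l| <= e]] l hl.
  by apply; rewrite divr_gt0.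
set S := [set n | _] => US; exists S; split=> // n n' Sn Sn'.
have [mn iN] := Hs_L2 (Hu n); have [mn' iN'] := Hs_L2 (Hu n').
have [io _] := osc_int s_gt0 k (Hu n); have [io' _] := osc_int s_gt0 k (Hu n').
have ib := box_intg (0 : R3 R) r0.
apply: (@le_trans _ _ (Rintegral mu setT
   (fun x => 3 * osc k (u_ n) x + 3 * osc k (u_ n') x + 3 * eta ^+ 2 * box r 0 x))).
  apply: le_Rint.
  - by apply: box_diff_intg; exact: Hs_L2.
  - by apply: intgD; [apply: intgD|]; exact: intgZ.
  move=> x; have o1 := osc_ge0 k (u_ n) x; have o2 := osc_ge0 k (u_ n') x.
  rewrite /box; case: (boolP (inbox r 0 x)) => [/and3P[]|_]; last first.
    by rewrite mul0r mulr0 addr0 addr_ge0// mulr_ge0.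
  rewrite /= !sub0r !normrN => b1 b2 b3; rewrite mul1r mulr1.
  have [i1 e1] := hp _ b1; have [i2 e2] := hp _ b2; have [i3 e3] := hp _ b3.
  have sc : samecell k x (P (i1, i2, i3)) by rewrite /samecell /= e1 e2 e3 !eqxx.
  have A1 := avg_osc k x (Hs_L2 (Hu n)); have A2 := avg_osc k x (Hs_L2 (Hu n')).
  rewrite !(avg_samecell _ sc) in A1 A2.
  have := Sn (i1, i2, i3); have := Sn' (i1, i2, i3).
  set l := xget _ _; move: A1 A2; set a := avg k (u_ n) _; set b := avg k (u_ n') _.
  move=> A1 A2 h1 h2.
  have : `|a - b| <= eta.
    have -> : a - b = (a - l) - (b - l) by ring.
    by rewrite (le_trans (ler_normB _ _))// [leRHS]splitr lerD.
  have ab0 := normr_ge0 (a - b).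
  move=> ab; have {ab} : (a - b) ^+ 2 <= eta ^+ 2.
    by rewrite -(real_normK (num_real (a - b))) ler_pXn2r ?nnegrE// ltW.
  move: A1 A2; set un := u_ n x; set un' := u_ n' x => A1 A2 A3.
  rewrite (le_trans (sqr_triangle3 un un' a b))//.
  by rewrite !lerD// ler_pM2l.
rewrite RintegralD//; [|by apply: intgD; exact: intgZ|exact: intgZ].
rewrite RintegralD//; [|exact: intgZ..].
rewrite RintegralZl// [X in _ + X + _]RintegralZl// [X in _ + _ + X]RintegralZl// box_Rint//.
suff K : forall a b c, a <= e / 12 -> b <= e / 12 -> c <= e / 6 -> 3 * a + 3 * b + 3 * c <= e.
  by rewrite -[3 * eta ^+ 2 * _]mulrA; apply: K => //; exact: hk.
by clear -R e; move=> a b c; lra.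
Qed.

(** Finitely many members of the ultrafilter and a tail have a common element. [phi] is not claimed
    to be increasing; [j <= phi j] is enough for limits at infinity. *)
Lemma diagonal_subsequence (U : set_system nat) (S : nat -> set nat) :
  UltraFilter U -> (forall N, U [set n | (N <= n)%N]) -> (forall j, U (S j)) ->
  exists phi : nat -> nat, forall j, (j <= phi j)%N /\
    forall i, (i <= j)%N -> S i (phi j).
Proof.
move=> UU Uoo US; have PU := @ultra_proper _ _ UU.
have h j : exists n, (j <= n)%N /\ forall i, (i <= j)%N -> S i n.
  have : U [set n | (j <= n)%N /\ forall i : 'I_j.+1, S i n].
    apply: filterI; first exact: Uoo.
    exact: (@filter_forall _ 'I_j.+1 (fun i n => S i n) U _ (fun i => US i)).
  move/filter_ex => [n [jn Sn]]; exists n; split=> // i ij.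
  exact: (Sn (Ordinal (ij : i < j.+1)%N)).
by have [phi hphi] := choice h; exists phi.
Qed.

End Compactness.

Section Compactness.
Context (R : realType) (s : R).
Hypothesis s_gt0 : 0 < s.
Notation mu := (@leb3 R).

(** [phi j] lies in the first [j.+1] sets of a list of members of the ultrafilter, each forcing both
    local closeness in [L2] and closeness of [A_] to [A]. The last clause keeps the limit nonzero:
    if [u = 0], Fatou's lemma applied to the differences with [u_ (phi j)] would leave mass at most
    [8^-j] in a fixed box. *)
Theorem compactness (u_ : nat -> R3 R -> R) (A_ : nat -> R) T C :
  0 < T -> (forall n, Hs s (u_ n)) -> (forall n, bounded2 s (u_ n) T) ->
  (forall n, `|A_ n| <= C) ->
  exists (phi : nat -> nat) (u : R3 R -> R) (A : R),
  [/\ (forall n, (n <= phi n)%N), measurable_fun setT u,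
    {ae mu, forall x, u_ (phi n) x @[n --> \oo] --> u x},
    A_ (phi n) @[n --> \oo] --> A &
    forall d, 0 < d ->
      (forall n, d <= Rintegral mu setT (fun y => box 1 0 y * u_ n y ^+ 2)) ->
      ~ {ae mu, forall x, u x = 0}].
Proof.
move=> T0 Hu uT AC.
have [U [UU sU]] := ultraFilterLemma (F := \oo) _.
have Uoo N : U [set n | (N <= n)%N] by apply: sU; exists N.
have [A hA] := ultra_bounded_limit UU AC.
have h1 j := ultra_local_cauchy s_gt0 UU T0 Hu uT (ler0n R j)
   (_ : 0 < (8 ^+ j)^-1 :> R).
have {}h1 j : exists S : set nat, U S /\ forall n m, S n -> S m ->
    Rintegral mu setT (fun y => box j%:R 0 y * (u_ n y - u_ m y) ^+ 2) <= (8 ^+ j)^-1.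
  by apply: h1 => i; rewrite invr_gt0 exprn_gt0.
have [S hS] := choice h1.
have PU := @ultra_proper _ _ UU.
pose S' j := S j `&` [set n | `|A_ n - A| <= (j.+1%:R)^-1].
have US' j : U (S' j) by apply: filterI; [case: (hS j)|apply: hA; rewrite invr_gt0].
have [phi hphi] := diagonal_subsequence UU Uoo US'.
have mu_ n : measurable_fun setT (u_ n) by exact: Hs_meas (Hu n).
have hc i j : (i <= j)%N -> Rintegral mu setT
   (fun y => box i%:R 0 y * (u_ (phi j) y - u_ (phi i) y) ^+ 2) <= (8 ^+ i)^-1.
  move=> ij; have [_ h] := hS i; apply: h.
  - by have [_ /(_ _ ij)[]] := hphi j.
  - by have [_ /(_ _ (leqnn i))[]] := hphi i.
have [u [mu0 cu]] : exists u : R3 R -> R, measurable_fun setT u /\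
    {ae mu, forall x, u_ (phi n) x @[n --> \oo] --> u x}.
  apply: (@cvg_ae_of_steps _ _ _ mu _ (fun j => box j%:R 0)).
  - by move=> n; exact: mu_.
  - by move=> n; exact: measurable_box.
  - by move=> n x; exact: box_ge0.
  - move=> x; exists (maxn (Num.bound `|x.1.1|) (maxn (Num.bound `|x.1.2|) (Num.bound `|x.2|))).
    have K (t : R) j : (Num.bound `|t| <= j)%N -> `|0 - t| <= j%:R.
      move=> h; rewrite sub0r normrN (le_trans (ltW (archi_boundP (normr_ge0 t))))//.
      by rewrite ler_nat.
    move=> j; rewrite !geq_max => /and3P[h1' h2 h3].
    by rewrite /box /inbox !K.
  - move=> j; split; first by apply: box_diff_intg; exact: Hs_L2.
    exact: hc.
exists phi, u, A; split=> //.
- by move=> n; case: (hphi n).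
- apply/cvgrPdist_le => e e0.
  have e1 : 0 < e^-1 by rewrite invr_gt0.
  exists (Num.bound e^-1) => // n /= hn; rewrite distrC.
  have [_ /(_ _ (leqnn n))[_ /=]] := hphi n => /le_trans; apply.
  rewrite invf_ple ?posrE//.
  rewrite (le_trans (ltW (archi_boundP (ltW e1))))// ler_nat (leq_trans hn)//.
- move=> d d0 hd u0.
  have d_le j : (1 <= j)%N -> d <= (8 ^+ j)^-1.
    move=> j1; rewrite (le_trans (hd (phi j)))//.
    have Lj := Hs_L2 (Hu (phi j)).
    have ij := fun i => box_diff_intg j%:R (Hs_L2 (Hu (phi (j + i)%N))) Lj.
    have Lz : L2 mu (fun _ => 0).
      split; first exact: measurable_cst.
      under [X in integrable _ _ X]eq_fun do rewrite /= expr0n/=.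
      exact: integrable0.
    have [i1 F1] : intg mu (fun y => box j%:R 0 y * u_ (phi j) y ^+ 2) /\
       Rintegral mu setT (fun y => box j%:R 0 y * u_ (phi j) y ^+ 2) <= (8 ^+ j)^-1.
      apply: (@Rint_fatou _ _ _ mu (fun i y =>
          box j%:R 0 y * (u_ (phi (j + i)%N) y - u_ (phi j) y) ^+ 2)) => //.
      + by move=> n x; rewrite mulr_ge0 ?box_ge0 ?sqr_ge0.
      + by apply: measurable_funM; [exact: measurable_box|apply: measurable_funX; exact: mu_].
      + by move=> x; rewrite mulr_ge0 ?box_ge0 ?sqr_ge0.
      + apply: (@ae_mono _ _ _ mu) (ae_and u0 cu) => x [ux0 cx].
        apply: cvgMr.
        have -> : u_ (phi j) x ^+ 2 = (u x - u_ (phi j) x) ^+ 2 by rewrite ux0 sub0r sqrrN.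
        have cx' : u_ (phi (j + i)%N) x @[i --> \oo] --> u x.
          rewrite -(cvg_shiftn j) in cx.
          by under eq_fun do rewrite addnC.
        by apply: cvgM; apply: cvgB => //; exact: cvg_cst.
      + by move=> n; apply: hc; exact: leq_addr.
    apply: le_trans F1; apply: le_Rint => //.
      have := box_diff_intg 1 Lj Lz.
      by under [X in integrable _ _ X -> _]eq_fun do rewrite /= subr0.
    move=> x; rewrite ler_wpM2r ?sqr_ge0// /box ler_nat.
    case: (boolP (inbox 1 0 x)) => //= /and3P[b1 b2 b3].
    have K (t : R) : t <= 1 -> t <= j%:R.
      by move=> h; rewrite (le_trans h)// ler1n.
    by rewrite /inbox !K.
  have i0 : 0 <= (8^-1 : R) by rewrite invr_ge0.
  have i1 : (8^-1 : R) < 1 by rewrite invf_lt1// ltr1n.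
  have [n hn] := geometric_small i0 i1 ler01 (divr_gt0 d0 (ltr0n _ 2)).
  have := d_le n.+1 isT; rewrite -exprVn exprS.
  rewrite mul1r in hn; have p : 0 <= (8^-1 : R) ^+ n by rewrite exprn_ge0.
  move=> h; have h2 : 8^-1 * (8^-1 : R) ^+ n <= (8^-1) ^+ n by rewrite ler_piMl// ltW.
  have := le_trans h (le_trans h2 hn); rewrite leNgt gtr_pMr//.
  by rewrite invf_lt1// ltr1n.
Qed.

End Compactness.

(** * Lipschitz bumps *)

Lemma dyadic_near (R : realType) (m : R) : 0 < m -> m <= 1 ->
  exists j, (2^-1) ^+ j.+1 < m /\ m <= (2^-1) ^+ j.
Proof.
move=> m0 m1; have i0 : 0 <= (2^-1 : R) by rewrite invr_ge0.
have i1 : (2^-1 : R) < 1 by rewrite invf_lt1// ltr1n.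
have ex : exists n, (2^-1) ^+ n < m.
  have [n hn] := geometric_small i0 i1 ler01 (divr_gt0 m0 (ltr0n _ 2)).
  by exists n; rewrite mul1r in hn; rewrite (le_lt_trans hn)// ltr_pdivrMr// ltr_pMr// ltr1n.
case: (ex_minnP ex) => -[|j]; first by rewrite expr0 ltNge m1.
move=> hj hmin; exists j; split=> //; rewrite leNgt; apply/negP => /hmin.
by rewrite ltnn.
Qed.

Lemma dyadic_far (R : realType) (m : R) : 1 < m ->
  exists j, 2 ^+ j < m /\ m <= 2 ^+ j.+1.
Proof.
move=> m1; have m0 : 0 < m by exact: lt_trans m1.
have [n [h1 h2]] : exists j, (2^-1) ^+ j.+1 < m^-1 /\ m^-1 <= (2^-1) ^+ j.
  by apply: dyadic_near; rewrite ?invr_gt0// invf_le1// ltW.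
have {}h1 : m < 2 ^+ n.+1.
  by rewrite exprVn ltf_pV2 ?posrE ?exprn_gt0// in h1.
have {}h2 : 2 ^+ n <= m.
  by rewrite exprVn lef_pV2 ?posrE ?exprn_gt0// in h2.
have [e|e] := eqVneq m (2 ^+ n); last by exists n; rewrite lt_neqAle eq_sym e h2 ltW.
case: n h1 h2 e => [|n] h1 h2 e; first by rewrite e expr0 ltxx in m1.
by exists n; rewrite e lexx; split=> //; rewrite ltr_eXn2l// ltr1n.
Qed.

Section Bump.
Context (R : realType) (s : R).
Hypotheses (s_gt0 : 0 < s) (s_lt1 : s < 1).
Implicit Types (x y : R3 R) (r : R).
Notation mu := (@leb3 R).

Definition md x y : R :=
  Num.max `|x.1.1 - y.1.1| (Num.max `|x.1.2 - y.1.2| `|x.2 - y.2|).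

Lemma inboxE r x y : inbox r x y = (md x y <= r).
Proof. by rewrite /md !ge_max. Qed.

Lemma md_ge0 x y : 0 <= md x y. Proof. by rewrite le_max normr_ge0. Qed.

Lemma mdC x y : md x y = md y x.
Proof. by rewrite /md ![`|y.1.1 - _|]distrC ![`|y.1.2 - _|]distrC ![`|y.2 - _|]distrC. Qed.

Lemma md_dist x y : md x y <= dist3 x y.
Proof.
have h1 := sqr_ge0 (x.1.1 - y.1.1); have h2 := sqr_ge0 (x.1.2 - y.1.2).
have h3 := sqr_ge0 (x.2 - y.2).
by rewrite /md /dist3 !ge_max; apply/and3P; split; rewrite -sqrtr_sqr ler_wsqrtr//; lra.
Qed.

Lemma md_triangle x y z : md x z <= md x y + md y z.
Proof.
have K (a b c : R) : `|a - c| <= `|a - b| + `|b - c|.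
  by rewrite (_ : a - c = (a - b) + (b - c)) ?ler_normD//; ring.
rewrite {1}/md !ge_max; apply/and3P; split.
- by apply: le_trans (K _ y.1.1 _) _; apply: lerD; rewrite /md !le_max lexx ?orbT.
- by apply: le_trans (K _ y.1.2 _) _; apply: lerD; rewrite /md !le_max lexx ?orbT.
- by apply: le_trans (K _ y.2 _) _; apply: lerD; rewrite /md !le_max lexx ?orbT.
Qed.

(** The cone of slope 1 over the box of radius [r] about the origin, an explicit element of [H^s]
    positive inside that box. It provides a ray meeting the Nehari set and the barrier [eta] of the
    maximum principle. *)
Definition bump r x : R := Num.max 0 (r - md 0 x).

Lemma bump_ge0 r x : 0 <= bump r x. Proof. by rewrite le_max lexx. Qed.

Lemma bump_le r x : 0 <= r -> bump r x <= r * box r 0 x.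
Proof.
move=> r0; rewrite /bump /box inboxE; have h := md_ge0 0 x.
case: (leP (md 0 x) r) => hr; rewrite ?mulr1 ?mulr0 ge_max; apply/andP; split; lra.
Qed.

Lemma bump_lip r x y : `|bump r x - bump r y| <= md x y.
Proof.
have h1 := md_triangle 0 y x; have h2 := md_triangle 0 x y; rewrite (mdC y x) in h1.
have h := md_ge0 x y; rewrite /bump.
have [a|a] := leP (r - md 0 x) 0; have [b|b] := leP (r - md 0 y) 0;
  rewrite ?(max_l a) ?(max_l b) ?(max_r (ltW a)) ?(max_r (ltW b)) ler_norml;
  apply/andP; split; lra.
Qed.

Lemma measurable_bump r : measurable_fun setT (bump r).
Proof.
have m1 : measurable_fun setT (fun x : R3 R => x.1.1) by apply: measurableT_comp.
have m2 : measurable_fun setT (fun x : R3 R => x.1.2) by apply: measurableT_comp.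
have m3 : measurable_fun setT (fun x : R3 R => x.2) by exact: measurable_snd.
apply: measurable_maxr => //; apply: measurable_funB => //.
by apply: measurable_maxr; last apply: measurable_maxr; apply: measurableT_comp => //;
   exact: measurable_funB.
Qed.

Lemma bump_L2 r : 0 <= r -> L2 mu (bump r).
Proof.
move=> r0; split; first exact: measurable_bump.
apply: (intg_dom _ (intgZ (r ^+ 2) (box_intg 0 r0))).
  by apply: measurable_funX; exact: measurable_bump.
move=> x; rewrite ger0_norm ?sqr_ge0//.
have := bump_le x r0; have := bump_ge0 r x; rewrite /box; case: inbox => /=; nra.
Qed.

Let D : R := 2 `^ (3 + 2 * s).
(** Near the diagonal the Lipschitz bound removes two powers from the kernel and leaves [1 + 2 * s].
    As 8 is the volume ratio of consecutive boxes, [E < 8] and [8 < D], that is [s < 1] and [0 < s],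
    make the near and far dyadic sums converge. *)
Let E : R := 2 `^ (1 + 2 * s).

Let D_gt8 : 8 < D.
Proof.
have := s_gt0 => sp; rewrite /D powRD ?pnatr_eq0 ?implybT//.
have : 1 < 2 `^ (2 * s) :> R by apply: pow2_gt1; lra.
by rewrite powR_mulrn//; nra.
Qed.

Let E_lt8 : E < 8.
Proof.
have := s_lt1 => sl.
have : 2 `^ (2 * s - 2) < 1 :> R by apply: pow2_lt1; lra.
have -> : E = 2 `^ (2 * s - 2) * 2 `^ 3.
  by rewrite /E -powRD ?pnatr_eq0 ?implybT//; congr (_ `^ _); ring.
by rewrite (powR_mulrn 3)//; nra.
Qed.

Let E_gt0 : 0 < E. Proof. exact: powR_gt0. Qed.
Let D_gt0 : 0 < D. Proof. exact: powR_gt0. Qed.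

(* Near the diagonal, [|x - y| ~ 2^-j], the first term comes from the Lipschitz bound; far from
   it, [|x - y| ~ 2^j], the second comes from [0 <= bump r <= r]. *)
Let ker r j x y : R :=
  E ^+ j.+1 * box ((2^-1) ^+ j) x y + r ^+ 2 / D ^+ j * box (2 ^+ j.+1) x y.

Let ker_ge0 r j x y : 0 <= ker r j x y.
Proof.
apply: addr_ge0; apply: mulr_ge0; rewrite ?box_ge0 ?exprn_ge0 ?(ltW E_gt0)//.
by apply: divr_ge0; rewrite ?sqr_ge0// exprn_ge0 ?(ltW D_gt0).
Qed.

Let ker_sym r j x y : ker r j x y = ker r j y x.
Proof. by rewrite /ker ![box _ y x]boxC. Qed.

Let powR_exp (a t : R) j : 0 < a -> (a ^+ j) `^ t = (a `^ t) ^+ j.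
Proof.
move=> a0; rewrite -[a ^+ j]powR_mulrn ?ltW// powRAC powR_mulrn ?powR_ge0//.
Qed.

(** One scale [j] suffices for each pair. The factor [box r 0 x + box r 0 y] records that the
    quotient vanishes unless one of the points lies in the box. *)
Let quot_le_ker r x y : 0 < r -> x != y -> exists j,
  quot s (bump r) (x, y) ^+ 2 <= (box r 0 x + box r 0 y) * ker r j x y.
Proof.
move=> r0 xy.
have d0 : 0 < dist3 x y.
  rewrite lt_neqAle sqrtr_ge0 andbT eq_sym; apply/eqP => /dist3_eq0 e.
  by rewrite e eqxx in xy.
have [b0|bn0] := eqVneq (box r 0 x + box r 0 y) 0.
  exists 0%N; rewrite b0 mul0r /quot /=.
  have bx : box r 0 x = 0 by have := box_ge0 r 0 x; have := box_ge0 r 0 y; lra.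
  have by_ : box r 0 y = 0 by have := box_ge0 r 0 x; have := box_ge0 r 0 y; lra.
  have := bump_le x (ltW r0); have := bump_le y (ltW r0).
  rewrite bx by_ mulr0 => h1 h2; have := bump_ge0 r x; have := bump_ge0 r y => h3 h4.
  have -> : bump r x - bump r y = 0 by lra.
  by rewrite mul0r expr0n.
have b1 : 1 <= box r 0 x + box r 0 y.
  by move: bn0; rewrite /box; case: inbox; case: inbox => /=; rewrite ?addr0 ?add0r ?eqxx ?lexx//;
    rewrite lerDl ler01.
suff [j hj] : exists j, quot s (bump r) (x, y) ^+ 2 <= ker r j x y.
  by exists j; rewrite (le_trans hj)// ler_peMl.
have lip := bump_lip r x y; have mdd := md_dist x y.
have bd : `|bump r x - bump r y| <= r.
  have := bump_le x (ltW r0); have := bump_le y (ltW r0).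
  have := bump_ge0 r x; have := bump_ge0 r y.
  have bxr z : r * box r 0 z <= r by rewrite ler_piMr ?(ltW r0)// /box; case: inbox.
  have := bxr x; have := bxr y => *; rewrite ler_norml; apply/andP; split; lra.
have m0 : 0 < md x y.
  rewrite lt_neqAle md_ge0 andbT eq_sym; apply/eqP => m0.
  have : `|x.1.1 - y.1.1| <= 0 /\ `|x.1.2 - y.1.2| <= 0 /\ `|x.2 - y.2| <= 0.
    by rewrite -m0 /md !le_max !lexx ?orbT.
  rewrite !normr_le0 !subr_eq0 => -[/eqP a [/eqP b /eqP c]].
  by move: xy; rewrite [x]surjective_pairing [y]surjective_pairing
    [x.1]surjective_pairing [y.1]surjective_pairing a b c eqxx.
rewrite /quot exprMn gagw_sqr /=.
have p0 : 0 < dist3 x y `^ (3 + 2 * s) by exact: powR_gt0.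
suff [j hj] : exists j, `|bump r x - bump r y| ^+ 2 <= ker r j x y * dist3 x y `^ (3 + 2 * s).
  by exists j; rewrite ler_pdivrMr// -(real_normK (num_real (bump r x - bump r y))).
have sp := s_gt0.
have [m1|m1] := leP (md x y) 1.
  have [j [h1 h2]] := dyadic_near m0 m1; exists j.
  have -> : dist3 x y `^ (3 + 2 * s) = dist3 x y ^+ 2 * dist3 x y `^ (1 + 2 * s).
    rewrite -(powR_mulrn 2) ?(ltW d0)// -powRD; last by apply/implyP => /eqP; lra.
    by congr (_ `^ _); ring.
  rewrite mulrCA -[leLHS]mulr1; apply: ler_pM; rewrite ?sqr_ge0//.
    by rewrite ler_pXn2r ?nnegrE ?(ltW d0)// (le_trans lip).
  apply: (@le_trans _ _ (E ^+ j.+1 * ((2^-1) ^+ j.+1) `^ (1 + 2 * s))).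
    rewrite powR_exp ?invr_gt0// -exprMn /E -powRM ?invr_ge0// mulfV ?pnatr_eq0//.
    by rewrite powR1 expr1n.
  have hE : E ^+ j.+1 <= ker r j x y.
    rewrite /ker [box (2^-1 ^+ j) x y]/box inboxE h2 mulr1 lerDl mulr_ge0 ?box_ge0//.
    by apply: divr_ge0; rewrite ?sqr_ge0// exprn_ge0 ?(ltW D_gt0).
  apply: ler_pM; rewrite ?powR_ge0 ?exprn_ge0 ?(ltW E_gt0)//.
  apply: ge0_ler_powR; rewrite ?nnegrE ?exprn_ge0 ?invr_ge0 ?(ltW d0)//; first lra.
  by rewrite (le_trans (ltW h1)).
have [j [h1 h2]] := dyadic_far m1; exists j.
have hD : r ^+ 2 / D ^+ j <= ker r j x y.
  rewrite /ker [box (2 ^+ j.+1) x y]/box inboxE h2 mulr1 lerDr.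
  by apply: mulr_ge0; rewrite ?box_ge0 ?exprn_ge0 ?(ltW E_gt0).
apply: (@le_trans _ _ (r ^+ 2 / D ^+ j * (2 ^+ j) `^ (3 + 2 * s))).
  rewrite powR_exp// -/D divfK ?expf_neq0 ?gt_eqF//.
  by rewrite ler_pXn2r ?nnegrE ?(ltW r0).
apply: ler_pM; rewrite ?powR_ge0//.
  by apply: divr_ge0; rewrite ?sqr_ge0// exprn_ge0 ?(ltW D_gt0).
apply: ge0_ler_powR; rewrite ?nnegrE ?exprn_ge0 ?(ltW d0)//; first lra.
by rewrite (le_trans (ltW h1)).
Qed.

Let kerE r x y := (\sum_(0 <= j <oo) (ker r j x y)%:E)%E.

Let measurable_ker r : measurable_fun setT (fun z : R3 R * R3 R => kerE r z.1 z.2).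
Proof.
apply: ge0_emeasurable_sum => [j z _ _|j]; first by rewrite lee_fin.
move=> _; apply/measurable_EFinP.
by apply: measurable_funD; apply: measurable_funM => //; exact: measurable_box2.
Qed.

Let ker_int r : exists C : R, 0 <= C /\ forall x, (\int[mu]_y kerE r x y <= C%:E)%E.
Proof.
have e8 : E / 8 < 1 by rewrite ltr_pdivrMr// mul1r.
have d8 : 8 / D < 1 by rewrite ltr_pdivrMr// mul1r.
have e80 : 0 <= E / 8 by rewrite divr_ge0// ltW.
have d80 : 0 <= 8 / D by rewrite divr_ge0// ltW.
have geo (a : R) n : 0 <= a -> a < 1 -> \sum_(0 <= k < n) a ^+ k <= 1 / (1 - a).
  move=> a0 a1; have a1' : 0 < 1 - a by lra.
  rewrite ler_pdivlMr//.
  have -> : (\sum_(0 <= k < n) a ^+ k) * (1 - a) = 1 - a ^+ n.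
    elim: n => [|n IH]; first by rewrite big_geq// mul0r expr0 subrr.
    by rewrite big_nat_recr//= mulrDl IH exprS; ring.
  by rewrite gerBl exprn_ge0.
exists (8 * E / (1 - E / 8) + 64 * r ^+ 2 / (1 - 8 / D)); split.
  apply: addr_ge0; apply: divr_ge0; rewrite ?subr_ge0 ?(ltW e8) ?(ltW d8)//.
    by rewrite mulr_ge0// ltW.
  by rewrite mulr_ge0// sqr_ge0.
move=> x; rewrite /kerE integral_nneseries//; first last.
- by move=> j y _; rewrite lee_fin.
- move=> j; apply/measurable_EFinP.
  by apply: measurable_funD; apply: measurable_funM => //; exact: measurable_box.
apply: lime_le.
  by apply: is_cvg_nneseries => j _ _; apply: integral_ge0 => y _; rewrite lee_fin.
apply: nearW => n.
have kj j : (\int[mu]_y (ker r j x y)%:E =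
   (8 * E * (E / 8) ^+ j + 64 * r ^+ 2 * (8 / D) ^+ j)%:E)%E.
  have b1 : 0 <= (2^-1 : R) ^+ j by rewrite exprn_ge0// invr_ge0.
  have b2 : 0 <= (2 : R) ^+ j.+1 by rewrite exprn_ge0.
  rewrite -EFin_Rint; last by apply: intgD; apply: intgZ; exact: box_intg.
  rewrite RintegralD//; [|by apply: intgZ; exact: box_intg|by apply: intgZ; exact: box_intg].
  rewrite RintegralZl//; last exact: box_intg.
  rewrite [X in _ + X]RintegralZl//; last exact: box_intg.
  rewrite !box_Rint//; congr EFin.
  have -> : (2 * 2^-1 ^+ j) ^+ 3 = 8 / 8 ^+ j :> R.
    rewrite exprMn exprAC exprVn exprVn; congr (_ / _ ^+ _); ring.
  have -> : (2 * 2 ^+ j.+1) ^+ 3 = 64 * 8 ^+ j :> R.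
    have -> : 8 ^+ j = (2 ^+ j) ^+ 3 :> R by rewrite exprAC; congr (_ ^+ _); ring.
    by rewrite [2 ^+ j.+1]exprS; ring.
  by rewrite !expr_div_n exprS; ring.
under eq_bigr do rewrite kj.
rewrite sumEFin lee_fin big_split /= -!mulr_sumr.
have g1 := geo _ n e80 e8; have g2 := geo _ n d80 d8; rewrite !div1r in g1 g2.
by apply: lerD; apply: ler_wpM2l => //; rewrite mulr_ge0 ?sqr_ge0 ?(ltW E_gt0).
Qed.

(** For a fixed first point the summed kernels have a uniformly bounded integral, and [box r 0] has
    finite volume. The half with the factor [box r 0 y] reduces to the other by Tonelli's theorem
    and the symmetry of [ker]. *)
Lemma bump_Hs r : 0 < r -> Hs s (bump r).
Proof.
move=> r0; apply/HsP; split; first exact: bump_L2 (ltW r0).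
have mq : measurable_fun setT (quot s (bump r)).
  by apply: measurable_quot; exact: measurable_bump.
split=> //; have [C [C0 hC]] := ker_int r.
have q0 z : 0 <= quot s (bump r) z ^+ 2 by exact: sqr_ge0.
have mq2 : measurable_fun setT (fun z => quot s (bump r) z ^+ 2) by exact: measurable_funX.
apply/intg_ge0P => //.
have k0 x y : (0 <= kerE r x y)%E by apply: nneseries_ge0 => j _ _; rewrite lee_fin.
have mb1 : measurable_fun setT (fun z : R3 R * R3 R => box r 0 z.1).
  by apply: (measurableT_comp (measurable_box r 0)).
have mb2 : measurable_fun setT (fun z : R3 R * R3 R => box r 0 z.2).
  by apply: (measurableT_comp (measurable_box r 0)).
pose g1 (z : R3 R * R3 R) := ((box r 0 z.1)%:E * kerE r z.1 z.2)%E.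
pose g2 (z : R3 R * R3 R) := ((box r 0 z.2)%:E * kerE r z.1 z.2)%E.
have mg1 : measurable_fun setT g1.
  by apply: emeasurable_funM; [exact/measurable_EFinP|exact: measurable_ker].
have mg2 : measurable_fun setT g2.
  by apply: emeasurable_funM; [exact/measurable_EFinP|exact: measurable_ker].
have g10 z : (0 <= g1 z)%E by rewrite mule_ge0// lee_fin box_ge0.
have g20 z : (0 <= g2 z)%E by rewrite mule_ge0// lee_fin box_ge0.
have mk x : measurable_fun setT (kerE r x).
  exact: (measurable_fun_pair2 x (measurable_ker r)).
have slice x : (\int[mu]_y ((box r 0 x)%:E * kerE r x y) <= (box r 0 x)%:E * C%:E)%E.
  rewrite ge0_integralZl//; [|exact: mk|by rewrite lee_fin box_ge0].
  by apply: lee_wpmul2l => //; rewrite lee_fin box_ge0.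
have bi : (\int[mu]_x ((box r 0 x)%:E * C%:E) < +oo)%E.
  under eq_integral do rewrite -EFinM mulrC.
  by rewrite -EFin_Rint ?ltry//; apply: intgZ; apply: box_intg; exact: ltW.
have I1 : (\int[@leb6 R]_z g1 z < +oo)%E.
  rewrite [X in (X < _)%E](fubini_tonelli1 (m1 := @leb3 R) (m2 := @leb3 R) g1 mg1 g10).
  apply: le_lt_trans bi; apply: ge0_le_integral => //.
  - by move=> x1 _; apply: integral_ge0 => y _; exact: g10.
  - exact: (measurable_fun_fubini_tonelli_F (m2 := @leb3 R) g1 mg1 g10).
  - by under eq_fun do rewrite -EFinM; apply/measurable_EFinP; apply: measurable_funM => //;
      exact: measurable_box.
  - by move=> x1 _; exact: slice.
have I2 : (\int[@leb6 R]_z g2 z < +oo)%E.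
  rewrite [X in (X < _)%E](fubini_tonelli2 (m1 := @leb3 R) (m2 := @leb3 R) g2 mg2 g20).
  apply: le_lt_trans bi; apply: ge0_le_integral => //.
  - by move=> x1 _; apply: integral_ge0 => y _; exact: g20.
  - exact: (measurable_fun_fubini_tonelli_G (m1 := @leb3 R) g2 mg2 g20).
  - by under eq_fun do rewrite -EFinM; apply/measurable_EFinP; apply: measurable_funM => //;
      exact: measurable_box.
  - move=> x1 _; apply: le_trans (slice x1); rewrite /fubini_G /g2 /=.
    apply: ge0_le_integral => //.
    + by move=> y _; exact: (g20 (y, x1)).
    + by have := measurable_fun_pair1 x1 mg2.
    + by apply: emeasurable_funM; [exact: measurable_cst|exact: mk].
    + move=> y _; rewrite /kerE; under eq_eseriesr do rewrite ker_sym.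
      by [].
apply: (@le_lt_trans _ _ (\int[@leb6 R]_z (g1 z + g2 z))%E).
  apply: ge0_le_integral => //.
  - by move=> z _; rewrite lee_fin.
  - exact/measurable_EFinP.
  - exact: emeasurable_funD.
  - move=> [x y] _; rewrite /g1 /g2 /= -ge0_muleDl ?lee_fin ?box_ge0//.
    have [<-|xy] := eqVneq x y.
      by rewrite /quot /= subrr mul0r expr0n mule_ge0// adde_ge0// lee_fin box_ge0.
    have [j hj] := quot_le_ker r0 xy.
    apply: (@le_trans _ _ (((box r 0 x + box r 0 y) * ker r j x y)%:E)); first by rewrite lee_fin.
    rewrite EFinM; apply: lee_wpmul2l; first by rewrite lee_fin addr_ge0// box_ge0.
    have := @nneseries_lim_ge _ (fun j => (ker r j x y)%:E) xpredT 0 j.+1.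
    move=> /(_ (fun _ _ _ => ker_ge0 r _ x y)); apply: le_trans.
    rewrite big_nat_recr//= leeDr// sume_ge0// => i _.
    by rewrite lee_fin.
by rewrite ge0_integralD//; exact: lte_add_pinfty.
Qed.

End Bump.

(** * The energy and the Nehari set *)

Record kirchhoff_problem (R : realType) (s V0 m0 q theta : R) (M f : R -> R) : Prop :=
  KirchhoffProblem {
    kp_s0 : 0 < s;
    kp_s1 : s < 1;
    kp_V0 : 0 < V0;
    kp_Mc : {within `[0, +oo[, continuous M};
    kp_m0 : 0 < m0;
    kp_M1 : forall t, 0 <= t -> m0 <= M t;
    kp_M2 : forall t1 t2, 0 <= t1 -> t1 < t2 -> M t1 < M t2;
    kp_M3 : forall t1 t2, 0 < t2 -> t2 <= t1 ->
      M t1 / t1 - M t2 / t2 <= m0 * (t1^-1 - t2^-1);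
    kp_fc : continuous f;
    kp_fneg : forall t, t < 0 -> f t = 0;
    kp_f1 : (fun t => f t / t ^+ 3) @ 0^'+ --> 0;
    kp_q4 : 4 < q;
    kp_q6 : q < 6 / (3 - 2 * s);
    kp_f2 : (fun t => f t / t `^ (q - 1)) @ +oo --> 0;
    kp_theta : 4 < theta;
    kp_f3 : forall t, 0 < t -> 0 < theta * primF f t /\ theta * primF f t <= f t * t;
    kp_f4 : forall t1 t2, 0 < t1 -> t1 <= t2 -> f t1 / t1 ^+ 3 <= f t2 / t2 ^+ 3 }.

Lemma powR_predr (R : realType) (q c : R) : 0 < q -> 0 <= c -> c `^ q = c `^ (q - 1) * c.
Proof.
move=> q0 c0; rewrite -[in X in _ * X](powRr1 c0) -powRD ?subrK//.
by rewrite gt_eqF.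
Qed.

(** Either [b <= e * a] or [a <= e^-1 * b]; each case yields one of the two terms. *)
Lemma powR_young (R : realType) (q e a b : R) : 1 < q -> 0 < e -> 0 <= a -> 0 <= b ->
  a `^ (q - 1) * b <= e * a `^ q + e^-1 `^ (q - 1) * b `^ q.
Proof.
move=> q1 e0 a0 b0; have q0 : 0 < q by lra.
rewrite !(powR_predr q0)//;  have [bea|/ltW aeb] := leP b (e * a).
  have h1 : a `^ (q - 1) * b <= a `^ (q - 1) * (e * a) by rewrite ler_wpM2l ?powR_ge0.
  have h2 : 0 <= e^-1 `^ (q - 1) * (b `^ (q - 1) * b) by rewrite !mulr_ge0 ?powR_ge0.
  by move: h1 h2; lra.
have ab : a <= e^-1 * b by rewrite mulrC ler_pdivlMr// mulrC.
have h1 : a `^ (q - 1) <= (e^-1 * b) `^ (q - 1).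
  by apply: ge0_ler_powR; rewrite ?nnegrE ?mulr_ge0 ?invr_ge0 ?(ltW e0)//; lra.
have := ler_wpM2r b0 h1; rewrite powRM ?invr_ge0 ?(ltW e0)// -mulrA.
by move/le_trans; apply; rewrite lerDr !mulr_ge0 ?powR_ge0 ?(ltW e0).
Qed.

Section Functional.
Context (R : realType) (s V0 m0 q theta : R) (M f : R -> R).
Hypothesis H : kirchhoff_problem s V0 m0 q theta M f.
Implicit Types (u v w : R3 R -> R).
Notation mu := (@leb3 R).
Notation N := (normV s V0).
Notation B := (bform s V0).
Notation F := (primF f).
Notation Rint := (Rintegral mu setT).

Let q1 : 1 < q. Proof. by have := kp_q4 H; lra. Qed.
Let q2 : 2 < q. Proof. by have := kp_q4 H; lra. Qed.
Let f0 := f_ge0 (kp_fc H) (kp_fneg H) (kp_f3 H).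
Let fle0 := f_le0 (kp_fc H) (kp_fneg H).
Let F0 := F_ge0 (kp_fc H) (kp_fneg H) (kp_theta H) (kp_f3 H) (kp_f4 H).
Let Fconv := F_convex (kp_fc H) (kp_fneg H) (kp_theta H) (kp_f3 H) (kp_f4 H).
Let F4 := F_le_quarter (kp_fc H) (kp_fneg H) (kp_f4 H).
Let N0 u : 0 <= N u. Proof. exact: normV_ge0 (kp_V0 H) u. Qed.

Lemma f_mul_ge0 t : 0 <= f t * t.
Proof. by have [/fle0->|/ltW t0] := leP t 0; rewrite ?mul0r ?mulr_ge0. Qed.

(** Convexity squeezes [F b - F a] between [f a * (b - a)] and [f b * (b - a)]. *)
Lemma primF_continuous : continuous F.
Proof.
move=> a; apply/subr_cvg0.
have h : (b - a) @[b --> a] --> 0 by apply/subr_cvg0; exact: cvg_id.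
apply: (@squeeze_cvgr _ _ _ _ (fun b => f a * (b - a)) (fun b => f b * (b - a))).
- apply: nearW => b; rewrite Fconv /=.
  by have := Fconv b a; lra.
- by rewrite -[X in _ --> X](mulr0 (f a)); apply: cvgMr.
- by rewrite -[X in _ --> X](mulr0 (f a)); apply: cvgM => //; exact: (kp_fc H).
Qed.

Let mf : measurable_fun setT f.
Proof. by apply: continuous_measurable_fun; exact: kp_fc H. Qed.

Let mF : measurable_fun setT F.
Proof. by apply: continuous_measurable_fun; exact: primF_continuous. Qed.

(** The common majorant of the nonlinear terms; its integral is bounded on bounded subsets of
    [H^s]. *)
Let G u x : R := u x ^+ 2 + `|u x| `^ q.

Let G0 u x : 0 <= G u x. Proof. by rewrite addr_ge0 ?sqr_ge0 ?powR_ge0. Qed.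

(** The small factor falls on [a], the value of a varying function, the large one on the value [b]
    of a test function: the asymmetry that [Rint_vanish] asks for. *)
Lemma f_young e : 0 < e -> exists2 C, 0 <= C & forall a b : R,
  `|f a * b| <= e * (a ^+ 2 + `|a| `^ q) + C * (b ^+ 2 + `|b| `^ q).
Proof.
move=> e0.
have [C1 C10 hC1] := f_growth (kp_fc H) (kp_fneg H) (kp_f1 H) (kp_q4 H) (kp_f2 H)
  (kp_f3 H) (kp_f4 H) ltr01.
pose e' := e / (C1 + 1); have C11 : 0 < C1 + 1 by lra.
have e'0 : 0 < e' by rewrite divr_gt0.
have e'e : e' * (C1 + 1) = e by rewrite divfK ?gt_eqF.
set c := e'^-1 `^ (q - 1); have c0 : 0 <= c by exact: powR_ge0.
have ei : e * e^-1 = 1 by rewrite mulfV// gt_eqF.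
have ei0 : 0 < e^-1 by rewrite invr_gt0.
exists (e^-1 + C1 * c); first by rewrite addr_ge0 ?mulr_ge0 ?(ltW ei0).
move=> a b; rewrite normrM (ger0_norm (f0 a)).
have h1 := ler_wpM2r (normr_ge0 b) (hC1 a).
have h2 := powR_young q1 e'0 (normr_ge0 a) (normr_ge0 b).
have h3 : `|a| * `|b| <= e * a ^+ 2 + e^-1 * b ^+ 2.
  rewrite -[a ^+ 2]real_normK ?num_real// -[b ^+ 2]real_normK ?num_real//.
  have h4 : 0 <= e * (`|a| - e^-1 * `|b|) ^+ 2 by rewrite mulr_ge0 ?sqr_ge0 ?ltW.
  have h5 : 0 <= `|a| * `|b| by rewrite mulr_ge0.
  have h6 : e * (`|a| - e^-1 * `|b|) ^+ 2 = e * `|a| ^+ 2 - 2 * (e * e^-1) * (`|a| * `|b|)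
     + (e * e^-1) * (e^-1 * `|b| ^+ 2) by ring.
  by move: h4; rewrite h6 ei; lra.
have h4 := ler_wpM2l C10 h2.
have h5 : C1 * (e' * `|a| `^ q) <= e * `|a| `^ q.
  rewrite -e'e; have : 0 <= e' * `|a| `^ q by rewrite mulr_ge0 ?powR_ge0 ?ltW.
  by lra.
have h6 : 0 <= e^-1 * `|b| `^ q by rewrite mulr_ge0 ?powR_ge0 ?ltW.
have h7 : 0 <= C1 * c * b ^+ 2 by apply: mulr_ge0; rewrite ?sqr_ge0// mulr_ge0.
rewrite -/c in h4; move: h1 h3 h4 h5 h6 h7; lra.
Qed.

Lemma bounded2_normV u C : Hs s u -> 0 <= C -> N u <= C ->
  bounded2 s u (Num.sqrt ((1 + V0^-1) * C)).
Proof.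
move=> Hu C0 uC; have V0p := kp_V0 H; have Vi : 0 < V0^-1 by rewrite invr_gt0.
rewrite /bounded2 sqr_sqrtr; last by apply: mulr_ge0 => //; lra.
have := normV_ge_quot V0p Hu; have := normV_ge_L2 V0p Hu.
have := ler_wpM2r (ltW Vi) uC; lra.
Qed.

Let powq u C : Hs s u -> 0 < C -> N u <= C ->
  intg mu (fun x => `|u x| `^ q).
Proof.
move=> Hu C0 uC; have [C1 _ hC] := Lq_bound (kp_s0 H) (kp_s1 H) q2 (kp_q6 H).
apply: (proj1 (hC u (Num.sqrt ((1 + V0^-1) * C)) Hu _ _)).
  by rewrite sqrtr_gt0 mulr_gt0// ltr_pwDl// invr_ge0 ltW// (kp_V0 H).
exact: bounded2_normV (ltW C0) uC.
Qed.

Let G_intg u : Hs s u -> intg mu (G u).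
Proof.
move=> Hu; apply: intgD; first by case: (Hs_L2 Hu).
by apply: (@powq _ (N u + 1)) => //; have := N0 u; lra.
Qed.

Let G_bound C : exists K, forall u, Hs s u -> N u <= C -> Rint (G u) <= K.
Proof.
have [C1 _ hC] := Lq_bound (kp_s0 H) (kp_s1 H) q2 (kp_q6 H).
have V0p := kp_V0 H.
have T0 : 0 < Num.sqrt ((1 + V0^-1) * (`|C| + 1)).
  by rewrite sqrtr_gt0; apply: mulr_gt0; [rewrite addr_gt0 ?invr_gt0|rewrite ltr_wpDl].
exists (C / V0 + C1 * Num.sqrt ((1 + V0^-1) * (`|C| + 1)) `^ q) => u Hu uC.
have [|iq hq] := hC u _ Hu T0.
  by apply: bounded2_normV => //; rewrite ?addr_ge0// (le_trans uC)// ler_wpDr// ler_norm.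
rewrite RintegralD//; last by case: (Hs_L2 Hu).
apply: lerD => //; apply: le_trans (normV_ge_L2 V0p Hu) _.
by rewrite ler_pM2r ?invr_gt0.
Qed.

Lemma nonlin_intg u v : Hs s u -> Hs s v -> intg mu (fun x => f (u x) * v x).
Proof.
move=> Hu Hv; have [C C0 hC] := f_young ltr01.
apply: (intg_dom _ (intgD (intgZ 1 (G_intg Hu)) (intgZ C (G_intg Hv)))).
  apply: measurable_funM; last exact: Hs_meas Hv.
  exact: measurableT_comp (Hs_meas Hu).
by move=> x; exact: hC.
Qed.

Lemma primF_intg u : Hs s u -> intg mu (fun x => F (u x)).
Proof.
move=> Hu; apply: (intg_dom _ (nonlin_intg Hu Hu)).
  exact: measurableT_comp (Hs_meas Hu).
move=> x; rewrite ger0_norm//; have := F4 (u x); have := f_mul_ge0 (u x); lra.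
Qed.

Lemma nonlin_bound C v : Hs s v -> exists K, forall u, Hs s u -> N u <= C ->
  `|Rint (fun x => f (u x) * v x)| <= K.
Proof.
move=> Hv; have [C1 C10 hC] := f_young ltr01; have [K hK] := G_bound C.
exists (K + C1 * Rint (G v)) => u Hu uC.
rewrite (le_trans (le_normr_Rintegral _ (nonlin_intg Hu Hv)))//.
apply: (@le_trans _ _ (Rint (fun x => 1 * G u x + C1 * G v x))).
  apply: le_Rint; [exact/intg_norm/nonlin_intg| |by move=> x; exact: hC].
  by apply: intgD; apply: intgZ; exact: G_intg.
rewrite RintegralD//; [|by apply: intgZ; exact: G_intg|by apply: intgZ; exact: G_intg].
rewrite !RintegralZl//; [|exact: G_intg|exact: G_intg].
by rewrite mul1r lerD2r; exact: hK.
Qed.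

(** The difference is at most [e] times a quantity of bounded integral plus a multiple of [G v]. As
    [v] is fixed, this also controls mass escaping to infinity. *)
Lemma nonlin_cvg (u_ : nat -> R3 R -> R) u C v :
  (forall n, Hs s (u_ n)) -> (forall n, N (u_ n) <= C) -> measurable_fun setT u ->
  {ae mu, forall x, u_ n x @[n --> \oo] --> u x} -> Hs s v ->
  Rint (fun x => f (u_ n x) * v x) @[n --> \oo] --> Rint (fun x => f (u x) * v x).
Proof.
move=> Hu_ uC m_u cu Hv; have [Hu _] := Hs_weak (kp_V0 H) Hu_ uC m_u cu.
apply: cvg_Rint_diff; [by move=> n; exact: nonlin_intg|exact: nonlin_intg|].
have [K hK] := G_bound C.
apply: (@Rint_vanish _ _ _ mu _ (fun n x => G (u_ n) x + G u x) (K + Rint (G u))).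
- move=> n; apply: (intg_measurable (mu := mu)).
  by apply: intgB; exact: nonlin_intg.
- by move=> n; apply: intgD; exact: G_intg.
- by move=> n x; rewrite addr_ge0.
- by move=> n; rewrite RintegralD ?lerD2r//; [exact: hK|exact: G_intg|exact: G_intg].
- move=> e e0; have [C1 C10 hC] := f_young e0.
  exists (fun x => (2 * C1) * G v x); first by apply: intgZ; exact: G_intg.
  move=> n x; have := hC (u_ n x) (v x); have := hC (u x) (v x).
  have := ler_normB (f (u_ n x) * v x) (f (u x) * v x); rewrite /G; lra.
- apply: ae_mono cu => x cx; rewrite -(subrr (f (u x) * v x)).
  apply: cvgB; last exact: cvg_cst.
  by apply: cvgMl; apply: continuous_cvg => //; exact: (kp_fc H).
Qed.

Definition nehari u : R := M (N u) * N u - Rint (fun x => f (u x) * u x).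
Definition energy u : R := primF M (N u) / 2 - Rint (fun x => F (u x)).

Lemma energy_fiber u t : Hs s u -> 0 <= t ->
  energy (fun x => t * u x) + (1 - t ^+ 4) / 4 * nehari u + m0 / 4 * N u * (1 - t ^+ 2) ^+ 2
    <= energy u.
Proof.
move=> Hu t0; have Htu := HsZ t Hu; rewrite /energy /nehari normVZ//.
have h1 := kirchhoff_fiber (kp_Mc H) (kp_M1 H) (kp_M3 H) (N0 u) t0.
have h2 : Rint (fun x => F (u x)) - Rint (fun x => F (t * u x)) <=
    (1 - t ^+ 4) / 4 * Rint (fun x => f (u x) * u x).
  rewrite -RintegralB//; [|exact: primF_intg|exact: (primF_intg Htu)].
  rewrite -RintegralZl//; last exact: nonlin_intg.
  apply: le_Rint; [by apply: intgB; [exact: primF_intg|exact: (primF_intg Htu)]| |].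
    by apply: intgZ; exact: nonlin_intg.
  by move=> x; exact: (F_fiber (kp_fc H) (kp_fneg H) (kp_f4 H)).
rewrite mulrBr; move: h1 h2; move: (_ / 4 * (M _ * _)) (m0 / 4 * _ * _) (primF M _) (primF M _).
move: (Rint _) (Rint _) (_ / 4 * Rint _) => *; lra.
Qed.

(** [M] enters at the new point and [f] at the old one, as convexity of the two primitives dictates
    for an upper bound. *)
Lemma energy_step u v c : Hs s u -> Hs s v ->
  energy (fun x => u x + c * v x) - energy u <=
  M (N (fun x => u x + c * v x)) * (c * B u v + c ^+ 2 / 2 * N v)
   - c * Rint (fun x => f (u x) * v x).
Proof.
move=> Hu Hv; have Huv := HsD Hu (HsZ c Hv); rewrite /energy.
have e1 : N (fun x => u x + c * v x) - N u = 2 * (c * B u v + c ^+ 2 / 2 * N v).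
  by rewrite normV_addZ//; field.
have h1 := kirchhoff_convex (kp_Mc H) (kp_M2 H) (N0 u) (N0 (fun x => u x + c * v x)).
have h2 : c * Rint (fun x => f (u x) * v x) <=
    Rint (fun x => F (u x + c * v x)) - Rint (fun x => F (u x)).
  rewrite -RintegralB//; [|exact: (primF_intg Huv)|exact: primF_intg].
  rewrite -RintegralZl//; last exact: nonlin_intg.
  apply: le_Rint; [by apply: intgZ; exact: nonlin_intg| |].
    by apply: intgB; [exact: (primF_intg Huv)|exact: primF_intg].
  move=> x; have := Fconv (u x) (u x + c * v x).
  by rewrite addrAC subrr add0r mulrCA.
move: h1 h2; rewrite e1 mulrCA.
move: (M _ * _) (primF M _) (primF M _); move: (Rintegral _ _ _) (Rintegral _ _ _) (Rintegral _ _ _) => *; lra.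
Qed.

Lemma energy_nehari u : Hs s u ->
  m0 / 4 * N u <= energy u - nehari u / 4.
Proof.
move=> Hu; have h1 := kirchhoff_gap (kp_Mc H) (kp_M1 H) (kp_M3 H) (lexx 0) (N0 u).
rewrite /energy /nehari; rewrite (primF_le0 M (lexx 0)) in h1.
have h2 : Rint (fun x => F (u x)) <= Rint (fun x => f (u x) * u x) / 4.
  rewrite mulrC -RintegralZl//; last exact: nonlin_intg.
  apply: le_Rint; [exact: primF_intg|by apply: intgZ; exact: nonlin_intg|].
  by move=> x; rewrite mulrC; exact: F4.
move: h1 h2; move: (M _ * _) (primF M _) (Rintegral _ _ _) (Rintegral _ _ _) => *; lra.
Qed.

(* Both constants come from [f t t <= eta t^2 + C |t|^q] with [eta] half of the coercivity
   constant [m0 V0], which the quadratic part absorbs. *)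
Let growth_absorbed : exists2 K, 0 < K & forall u, Hs s u -> nehari u <= 0 ->
  m0 / 2 * N u <= K * Rint (fun x => `|u x| `^ q).
Proof.
have V0p := kp_V0 H; have m0p := kp_m0 H.
have e0 : 0 < m0 * V0 / 2 by rewrite !mulr_gt0// invr_gt0.
have [C1 C10 hC1] := f_growth (kp_fc H) (kp_fneg H) (kp_f1 H) (kp_q4 H) (kp_f2 H)
  (kp_f3 H) (kp_f4 H) e0.
exists (C1 + 1); first by lra.
move=> u Hu gu.
have iq : intg mu (fun x => `|u x| `^ q) by apply: (@powq _ (N u + 1)) => //; have := N0 u; lra.
have [mu_ i2] := Hs_L2 Hu.
have I0 : 0 <= Rint (fun x => `|u x| `^ q) by apply: Rintegral_ge0 => x _; exact: powR_ge0.
have h1 : Rint (fun x => f (u x) * u x) <=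
   m0 * V0 / 2 * Rint (fun x => u x ^+ 2) + C1 * Rint (fun x => `|u x| `^ q).
  rewrite -RintegralZl// -RintegralZl// -RintegralD//; [|exact: intgZ|exact: intgZ].
  apply: le_Rint; [exact: nonlin_intg|by apply: intgD; exact: intgZ|].
  move=> x; have [ux|ux] := leP (u x) 0.
    by rewrite fle0// mul0r addr_ge0// mulr_ge0 ?sqr_ge0 ?powR_ge0 ?(ltW e0).
  have := ler_wpM2r (ltW ux) (hC1 (u x)); rewrite gtr0_norm//.
  have q0 : 0 < q by have := q1; lra.
  rewrite (powR_predr q0 (ltW ux)).
  by rewrite mulrDl expr2 !mulrA.
have h2 : V0 * Rint (fun x => u x ^+ 2) <= N u.
  by have := normV_ge_L2 V0p Hu; rewrite ler_pdivlMr// mulrC.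
have h3 : m0 * N u <= M (N u) * N u by apply: ler_wpM2r => //; exact: kp_M1 H _ _.
have h4 := ler_wpM2l (ltW m0p) h2.
move: gu I0 h1 h3 h4; rewrite /nehari.
move: (M _ * _) (Rintegral _ _ _) (Rintegral _ _ _) (Rintegral _ _ _) => *; lra.
Qed.

(** With [T ^+ 2 = k * N u], absorption and the embedding bound [N u] by a multiple of the power [q]
    of [T]. For [T < 1] this power is at most [T ^+ 3]; after division by [N u] one factor [T]
    remains and is bounded below. *)
Lemma nehari_norm_lower : exists2 a0, 0 < a0 & forall u, Hs s u -> 0 < N u ->
  nehari u <= 0 -> a0 <= N u.
Proof.
have V0p := kp_V0 H; have m0p := kp_m0 H; have q4 := kp_q4 H.
have [K K0 hK] := growth_absorbed.
have [C1 C10 hC] := Lq_bound (kp_s0 H) (kp_s1 H) q2 (kp_q6 H).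
pose k := 1 + V0^-1; have k0 : 0 < k by rewrite addr_gt0 ?invr_gt0.
pose D := K * C1 * k; have D0 : 0 < D by rewrite !mulr_gt0.
pose t0 := Num.min 1 (m0 / (2 * D)).
have t00 : 0 < t0 by rewrite lt_min ltr01 divr_gt0// mulr_gt0.
exists (t0 ^+ 2 / k); first by rewrite divr_gt0// exprn_gt0.
move=> u Hu Nu gu; rewrite ler_pdivrMr// mulrC.
set T := Num.sqrt (k * N u).
have kN : 0 < k * N u by rewrite mulr_gt0.
have T0 : 0 < T by rewrite sqrtr_gt0.
have T2 : T ^+ 2 = k * N u by rewrite sqr_sqrtr// ltW.
rewrite -T2 ler_pXn2r ?nnegrE ?(ltW T0) ?(ltW t00)//.
have [T1|T1] := leP 1 T; first by rewrite (le_trans _ T1)// ge_min lexx.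
rewrite /t0 ge_min; apply/orP; right.
have [_ hq] := hC u T Hu T0 (bounded2_normV Hu (N0 u) (lexx _)).
have h1 : T `^ q <= T ^+ 3.
  rewrite -(subrK 3 q) powRD; last by rewrite (gt_eqF T0) implybT.
  rewrite powR_mulrn ?(ltW T0)// ler_piMl ?exprn_ge0 ?(ltW T0)//.
  rewrite [leRHS](_ : 1 = 1 `^ (q - 3)); last by rewrite powR1.
  apply: ge0_ler_powR; rewrite ?nnegrE ?(ltW T0) ?(ltW T1)//.
  by lra.
have h2 : m0 / 2 * N u <= K * (C1 * (T * (k * N u))).
  rewrite (le_trans (hK u Hu gu))// ler_pM2l// (le_trans hq)// ler_pM2l//.
  by rewrite -T2 -exprS.
rewrite ler_pdivrMr ?mulr_gt0//.
have -> : T * (2 * D) = 2 * (K * (C1 * (T * k))) by rewrite /D; ring.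
have : m0 / 2 * N u <= (K * (C1 * (T * k))) * N u.
  by apply: le_trans h2 _; rewrite le_eqVlt; apply/orP; left; apply/eqP; ring.
by rewrite ler_pM2r//; lra.
Qed.

(** [growth_absorbed] and the lower bound [a0] keep the integral of the power [q] of [|u|] above
    [m0 * a0 / (2 * K)]. Without concentration Lions' lemma would push it to half of that. *)
Lemma nehari_not_vanishing C : exists2 del, 0 < del & forall u, Hs s u -> 0 < N u ->
  N u <= C -> nehari u <= 0 -> exists x, del <= Rint (fun y => chi 0 x y * u y ^+ 2).
Proof.
have [C0|C0] := leP C 0.
  by exists 1 => // u _ h1 h2; have := lt_le_trans h1 h2; rewrite ltNge C0.
have m0p := kp_m0 H; have V0p := kp_V0 H.
have [K K0 hK] := growth_absorbed; have [a0 a00 ha] := nehari_norm_lower.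
have e0 : 0 < m0 * a0 / (4 * K) by rewrite divr_gt0 ?mulr_gt0.
have T0 : 0 < Num.sqrt ((1 + V0^-1) * C).
  by rewrite sqrtr_gt0 mulr_gt0// addr_gt0 ?invr_gt0.
have [del del0 hdel] := Lq_vanish (kp_s0 H) (kp_s1 H) q2 (kp_q6 H) T0 e0.
exists del => // u Hu Nu uC gu; apply: contrapT => hN.
have : Rint (fun x => `|u x| `^ q) <= m0 * a0 / (4 * K).
  apply: hdel => //; first exact: bounded2_normV (ltW C0) uC.
  by move=> x; apply/ltW; rewrite ltNge; apply/negP => hx; apply: hN; exists x.
have h1 := hK u Hu gu; have h2 := ler_wpM2l (ltW m0p) (ha u Hu Nu gu).
move/(ler_wpM2l (ltW K0)).
have -> : K * (m0 * a0 / (4 * K)) = m0 * a0 / 4 by field; lra.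
have : 0 < m0 * a0 by rewrite mulr_gt0.
by move: h1 h2; lra.
Qed.

End Functional.

(** * Translation invariance *)

Section Translation.
Context (R : realType) (s V0 m0 q theta : R) (M f : R -> R).
Hypothesis H : kirchhoff_problem s V0 m0 q theta M f.
Implicit Types (u v w : R3 R -> R).
Notation mu := (@leb3 R).
Notation N := (normV s V0).
Notation F := (primF f).
Notation Rint := (Rintegral mu setT).

Lemma Rint_shift3 (a : R3 R) (g : R3 R -> R) : measurable_fun setT g -> (forall x, 0 <= g x) ->
  Rint (fun x => g (shift3 a x)) = Rint g.
Proof.
move=> mg g0; congr fine.
have mE : measurable_fun setT (EFin \o g) by exact/measurable_EFinP.
have gE x : (0 <= (EFin \o g) x)%E by rewrite lee_fin.
exact: preserves_integral (leb3_shift a) mE gE.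
Qed.

Let quot_shift a u z : quot s (u \o shift3 a) z = quot s u (shift3 a z.1, shift3 a z.2).
Proof.
rewrite /quot /gagw /=; congr (_ * Num.sqrt (_ `^ _)^-1); rewrite /dist3 /=.
by congr Num.sqrt; ring.
Qed.

Lemma shift3_Hs a u : Hs s u -> Hs s (u \o shift3 a) /\ N (u \o shift3 a) = N u.
Proof.
move=> Hu; have [mu_ i2] := Hs_L2 Hu; have [mq iq] := Hs_quot Hu.
have [msh psh] := leb3_shift a; have [msh6 psh6] := leb6_shift a.
have e2 : (\int[mu]_x ((u \o shift3 a) x ^+ 2)%:E = \int[mu]_x (u x ^+ 2)%:E)%E.
  have mE : measurable_fun setT (fun x => (u x ^+ 2)%:E).
    by apply/measurable_EFinP; exact: measurable_funX.
  have gE x : (0 <= (u x ^+ 2)%:E)%E by rewrite lee_fin sqr_ge0.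
  exact: preserves_integral (leb3_shift a) mE gE.
have eq : (\int[@leb6 R]_z (quot s (u \o shift3 a) z ^+ 2)%:E = \int[@leb6 R]_z (quot s u z ^+ 2)%:E)%E.
  have -> : (fun z => (quot s (u \o shift3 a) z ^+ 2)%:E) =
      (fun z => (quot s u (shift3 a z.1, shift3 a z.2) ^+ 2)%:E).
    by apply/funext => z; rewrite quot_shift.
  have mE : measurable_fun setT (fun z => (quot s u z ^+ 2)%:E).
    by apply/measurable_EFinP; exact: measurable_funX.
  have gE z : (0 <= (quot s u z ^+ 2)%:E)%E by rewrite lee_fin sqr_ge0.
  exact: preserves_integral (leb6_shift a) mE gE.
have mus : measurable_fun setT (u \o shift3 a) by exact: measurableT_comp.
have Hs' : Hs s (u \o shift3 a).
  apply/HsP; split; split.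
  - exact: mus.
  - apply/intg_ge0P; [exact: measurable_funX|by move=> x; exact: sqr_ge0|].
    rewrite [ltLHS]e2; apply/intg_ge0P => //; first exact: measurable_funX.
    by move=> x; exact: sqr_ge0.
  - exact: measurable_quot.
  - apply/intg_ge0P; [by apply: measurable_funX; exact: measurable_quot|by move=> x; exact: sqr_ge0|].
    rewrite [ltLHS]eq; apply/intg_ge0P => //; first exact: measurable_funX.
    by move=> x; exact: sqr_ge0.
split=> //; rewrite !normV_split//; by congr (fine _ + _ * fine _); [exact: eq|exact: e2].
Qed.

Lemma box_of_samecell (x y : R3 R) : chi 0 x y <= box 1 x y.
Proof.
rewrite /chi /box; case: (boolP (samecell 0 x y)) => [/and3P[/eqP a /eqP b /eqP c]|_]; last exact: ler0n.
have K (t r : R) : flr 0 t = flr 0 r -> `|t - r| <= 1.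
  by move/flr_eq_dist; rewrite expr0 invr1.
by rewrite /inbox !K.
Qed.

(** Shifting by a point [x] of concentration brings the mass into the unit box about the origin,
    where local compactness retains it. *)
Lemma nehari_concentrated C : exists2 del, 0 < del & forall u, Hs s u -> 0 < N u ->
  N u <= C -> nehari s V0 M f u <= 0 -> exists v, [/\ Hs s v, N v = N u,
  nehari s V0 M f v = nehari s V0 M f u, energy s V0 M f v = energy s V0 M f u &
  del <= Rint (fun y => box 1 0 y * v y ^+ 2)].
Proof.
have [del del0 hdel] := nehari_not_vanishing H C; exists del => // u Hu Nu uC gu.
have [x hx] := hdel u Hu Nu uC gu; have [Hv Nv] := shift3_Hs x Hu.
have mu_ := Hs_meas Hu; have [_ i2] := Hs_L2 Hu.
exists (u \o shift3 x); split; [exact: Hv|exact: Nv| | |].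
- rewrite /nehari Nv; congr (_ - _).
  apply: (Rint_shift3 x (g := fun y => f (u y) * u y)).
    exact: (intg_measurable (nonlin_intg H Hu Hu)).
  by move=> y; exact: (f_mul_ge0 H).
- have eF : Rint (fun y => F ((u \o shift3 x) y)) = Rint (fun y => F (u y)).
    apply: (Rint_shift3 x (g := fun y => F (u y))).
      exact: (intg_measurable (primF_intg H Hu)).
    by move=> y; exact: (F_ge0 (kp_fc H) (kp_fneg H) (kp_theta H) (kp_f3 H) (kp_f4 H)).
  by rewrite /energy Nv eF.
- have mb : measurable_fun setT (fun y => box 1 x y * u y ^+ 2).
  by apply: measurable_funM; [exact: measurable_box|exact: measurable_funX].
have ib : intg mu (fun y => box 1 x y * u y ^+ 2).
  apply: (intg_dom _ i2) => [|y]; first exact: mb.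
  rewrite ger0_norm; last by apply: mulr_ge0; rewrite ?box_ge0 ?sqr_ge0.
  by rewrite ler_piMl ?sqr_ge0// /box; case: inbox.
apply: (le_trans hx); apply: (@le_trans _ _ (Rint (fun y => box 1 x y * u y ^+ 2))).
  apply: le_Rint => //.
    apply: (intg_dom _ ib).
      by apply: measurable_funM; [exact: measurable_chi|exact: measurable_funX].
    move=> y; rewrite ger0_norm; last by apply: mulr_ge0; rewrite ?chi_ge0 ?sqr_ge0.
    by rewrite ler_wpM2r ?sqr_ge0// box_of_samecell.
  by move=> y; rewrite ler_wpM2r ?sqr_ge0// box_of_samecell.
rewrite -(Rint_shift3 x mb); last by move=> y; apply: mulr_ge0; rewrite ?box_ge0 ?sqr_ge0.
rewrite le_eqVlt; apply/orP; left; apply/eqP; apply: eq_Rintegral => y _ /=.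
congr (_ * _); rewrite /box /inbox /shift3 /=.
have K (a b : R) : a - (b + a) = 0 - b by ring.
by rewrite !K.
Qed.

End Translation.

(** Reduces continuity in the ray parameter to sequences, for which [nonlin_cvg] is stated. *)
Lemma cvg_at_of_seq (R : realType) (g : R -> R) (t : R) :
  (forall u : nat -> R, u n @[n --> \oo] --> t -> g (u n) @[n --> \oo] --> g t) ->
  g x @[x --> t] --> g t.
Proof.
move=> h; apply/cvgrPdist_lt => e e0; apply: contrapT => hN.
have hx n : exists x, `|t - x| < n.+1%:R^-1 /\ e <= `|g t - g x|.
  apply: contrapT => hn; apply: hN; exists n.+1%:R^-1 => /=; first by rewrite invr_gt0.
  by move=> x /= tx; rewrite ltNge; apply/negP => ex; apply: hn; exists x.
have [u hu] := choice hx.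
have ut : u n @[n --> \oo] --> t.
  apply/cvgrPdist_lt => d d0; have d1 : 0 < d^-1 by rewrite invr_gt0.
  exists (Num.bound d^-1) => // n /= hn; have [h1 _] := hu n.
  rewrite (lt_le_trans h1)// invf_ple ?posrE// (le_trans (ltW (archi_boundP (ltW d1))))//.
  by rewrite ler_nat (leq_trans hn).
have /cvgrPdist_lt /(_ e e0) [n0 _ /(_ n0 (leqnn n0))] := h u ut.
by have [_] := hu n0; rewrite leNgt => /negP.
Qed.

(** * Rays and their intersection with the Nehari set *)

Section Fibers.
Context (R : realType) (s V0 m0 q theta : R) (M f : R -> R).
Hypothesis H : kirchhoff_problem s V0 m0 q theta M f.
Implicit Types (u v w : R3 R -> R).
Notation mu := (@leb3 R).
Notation N := (normV s V0).
Notation F := (primF f).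
Notation Rint := (Rintegral mu setT).
Notation nehari := (nehari s V0 M f).
Notation energy := (energy s V0 M f).

Let N0 u : 0 <= N u. Proof. exact: normV_ge0 (kp_V0 H) u. Qed.

(** [M] is continuous only on [[0, +oo[], so the limit 0 calls for one-sided continuity. *)
Lemma kirchhoff_cvg (a : nat -> R) (l : R) : (forall n, 0 <= a n) ->
  a n @[n --> \oo] --> l -> M (a n) @[n --> \oo] --> M l.
Proof.
move=> a0 al; have l0 : 0 <= l by apply: (@ler_cvg_to _ _ _ R (fun=> 0) a 0 l _ al); [exact: cvg_cst|exact: nearW].
have := kp_Mc H; rewrite continuous_within_itvcyP => -[c1 c2].
have [lp|ln] := ltP 0 l.
  by apply: (continuous_cvg _ _ al); apply: c1; rewrite in_itv/= lp.
have l00 : l = 0 by apply/eqP; rewrite eq_le l0 ln.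
rewrite l00; move: al; rewrite l00 => al; apply/cvgrPdist_lt => e e0.
move/cvgrPdist_lt : c2 => /(_ e e0) [d /= d0 hd].
move/cvgrPdist_lt : al => /(_ d d0) [n0 _ hn]; exists n0 => // n /hn /= ad.
have [->|an0] := eqVneq (a n) 0; first by rewrite subrr normr0.
by apply: hd => //=; rewrite lt_neqAle eq_sym an0 a0.
Qed.

Lemma nehari_fiber_continuous w : Hs s w -> continuous (fun t : R => nehari (fun x => t * w x)).
Proof.
move=> Hw t; apply: cvg_at_of_seq => t_ ct.
have [K tK] : exists K, forall n, `|t_ n| <= K.
  have cv : cvgn t_ by apply: cvgP ct.
  have [K0 [_ hK]] := cvg_seq_bounded cv.
  by exists (K0 + 1) => n; apply: hK => //; rewrite ltrDl.
rewrite /nehari; apply: cvgB.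
  under eq_fun do rewrite normVZ//; rewrite normVZ//.
  have c2 : t_ n ^+ 2 * N w @[n --> \oo] --> t ^+ 2 * N w by apply: cvgMl; apply: cvgM.
  by apply: cvgM => //; apply: kirchhoff_cvg => // n; rewrite mulr_ge0 ?sqr_ge0.
(* The factor [t_ n] is pulled out so that the test function [w] stays fixed. *)
have -> : (fun n => Rint (fun x => f (t_ n * w x) * (t_ n * w x))) =
   (fun n => t_ n * Rint (fun x => f (t_ n * w x) * w x)).
  apply/funext => n; rewrite -RintegralZl//; last exact: (nonlin_intg H (HsZ _ Hw) Hw).
  by apply: eq_Rintegral => x _; rewrite mulrCA.
have -> : Rint (fun x => f (t * w x) * (t * w x)) = t * Rint (fun x => f (t * w x) * w x).
  rewrite -RintegralZl//; last exact: (nonlin_intg H (HsZ _ Hw) Hw).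
  by apply: eq_Rintegral => x _; rewrite mulrCA.
apply: cvgM => //; apply: (nonlin_cvg H (u_ := fun n x => t_ n * w x) (C := K ^+ 2 * N w)) => //.
- by move=> n; exact: HsZ.
- move=> n; rewrite normVZ// ler_wpM2r// -[leLHS]real_normK ?num_real//.
  by rewrite ler_pXn2r ?nnegrE// (le_trans _ (tK n)).
- by apply: measurable_funM => //; exact: Hs_meas Hw.
- by apply: (@aeW _ _ _ mu) => x; apply: cvgMl.
Qed.

Lemma nehari_root w a b : Hs s w -> a <= b -> 0 <= nehari (fun x => a * w x) ->
  nehari (fun x => b * w x) <= 0 -> exists2 t, a <= t <= b & nehari (fun x => t * w x) = 0.
Proof.
move=> Hw ab ga gb.
have [||t tab gt] := @IVT R (fun t => nehari (fun x => t * w x)) a b 0 ab.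
- by apply: continuous_subspaceT; exact: nehari_fiber_continuous.
- by rewrite ge_min le_max gb ga orbT.
by exists t => //; rewrite in_itv in tab.
Qed.

(** For small [t] the norm [N (t * u)] falls below [a0], which excludes [nehari (t * u) <= 0]; the
    intermediate value theorem does the rest. *)
Lemma nehari_proj u : Hs s u -> 0 < N u -> nehari u <= 0 ->
  exists2 t, 0 < t <= 1 & nehari (fun x => t * u x) = 0.
Proof.
move=> Hu Nu gu; have [a0 a00 ha] := nehari_norm_lower H.
pose t := Num.min 1 (a0 / (2 * N u)).
have t0 : 0 < t by rewrite lt_min ltr01 divr_gt0 ?mulr_gt0.
have t1 : t <= 1 by rewrite ge_min lexx.
have Nt : N (fun x => t * u x) < a0.
  rewrite normVZ// expr2 (@le_lt_trans _ _ (t * N u))//.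
    by rewrite ler_wpM2r// ler_piMl// ltW.
  rewrite -ltr_pdivlMr// (@le_lt_trans _ _ (a0 / (2 * N u)))//; first by rewrite ge_min lexx orbT.
  by rewrite ltr_pM2l// ltf_pV2 ?posrE ?mulr_gt0// ltr_pMl// ltr1n.
have gt : 0 <= nehari (fun x => t * u x).
  rewrite leNgt; apply/negP => /ltW /(ha _ (HsZ t Hu)).
  by rewrite normVZ// mulr_gt0 ?exprn_gt0// => /(_ isT); rewrite leNgt -normVZ// Nt.
have gu1 : nehari (fun x => 1 * u x) <= 0 by under eq_fun do rewrite mul1r.
have [r /andP[tr r1] gr] := nehari_root Hu t1 gt gu1.
by exists r => //; rewrite r1 (lt_le_trans t0).
Qed.

(** Let [L = M (N w) * N w] for a bump [w]. By [kirchhoff_growth] the norm term of [t * w] is at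
    most [L * t ^+ 4]; since [w >= 1] on a box of volume 8 and [f r >= L * r ^+ 3] for large [r],
    the nonlinear term is larger. *)
Lemma nehari_nonempty : exists u, [/\ Hs s u, 0 < N u & nehari u = 0].
Proof.
have s0 := kp_s0 H; have s1 := kp_s1 H; have V0p := kp_V0 H.
have Hw : Hs s (bump 2) by exact: bump_Hs.
have w1 (x : R3 R) : box 1 0 x <= bump 2 x.
  rewrite /box inboxE /bump; case: (leP (md 0 x) 1) => h; rewrite le_max; last by rewrite lexx.
  by apply/orP; right; rewrite /=; lra.
have Nw : 0 < N (bump 2).
  apply: (@lt_le_trans _ _ (V0 * 8)); first by rewrite mulr_gt0.
  have := normV_ge_L2 V0p Hw; rewrite ler_pdivlMr// mulrC; apply: le_trans.
  rewrite ler_pM2l// (_ : 8 = Rint (box 1 0)); last by rewrite box_Rint// mulr1; ring.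
  apply: le_Rint; [exact: box_intg|by case: (Hs_L2 Hw)|].
  move=> x; apply: (le_trans (_ : _ <= box 1 0 x ^+ 2)).
    by rewrite /box; case: inbox => /=; rewrite ?expr1n ?expr0n.
  by rewrite ler_pXn2r ?nnegrE ?box_ge0// bump_ge0.
set w := bump 2 in Hw Nw w1 *.
have [K K0 hK] := f_superquartic (kp_fc H) (kp_fneg H) (kp_theta H) (kp_f3 H) (kp_f4 H)
  (M (N w) * N w).
pose t := Num.max K 1; have t1 : 1 <= t by rewrite le_max lexx orbT.
have t0 : 0 < t by lra.
have Htw := HsZ t Hw; have Ntw : 0 < N (fun x => t * w x).
  by rewrite normVZ// mulr_gt0 ?exprn_gt0.
have L0 : 0 <= M (N w) * N w.
  by rewrite mulr_ge0 ?(ltW Nw)// (le_trans (ltW (kp_m0 H)))// (kp_M1 H) ?(ltW Nw).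
have gt : nehari (fun x => t * w x) <= 0.
  rewrite /nehari subr_le0 normVZ//.
  apply: (@le_trans _ _ (M (N w) * N w * t ^+ 4)).
    have := kirchhoff_growth (kp_m0 H) (kp_M3 H) Nw (_ : N w <= t ^+ 2 * N w).
    move=> /(_ _) h; have {}h : M (t ^+ 2 * N w) * N w <= M (N w) * (t ^+ 2 * N w).
      by apply: h; rewrite ler_peMl ?(ltW Nw)// expr_ge1 ?(ltW t0).
    have := ler_wpM2l (sqr_ge0 t) h; rewrite (exprD t 2 2); lra.
  apply: (@le_trans _ _ (Rint (fun x => M (N w) * N w * t ^+ 4 * box 1 0 x))).
    rewrite RintegralZl//; last exact: box_intg.
    rewrite box_Rint//; apply: ler_peMr; last by rewrite mulr1 expr_ge1// ler1n.
    by apply: mulr_ge0 => //; rewrite exprn_ge0 ?(ltW t0).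
  apply: le_Rint; [by apply: intgZ; exact: box_intg|exact: (nonlin_intg H Htw Htw)|].
  move=> x; have := w1 x; have := box_ge0 1 0 x; rewrite {2 3}/box; case: inbox => /= _ wx; last first.
    by rewrite mulr0; exact: (f_mul_ge0 H).
  have tw : t <= t * w x by rewrite ler_peMr ?(ltW t0).
  rewrite mulr1; apply: (@le_trans _ _ (M (N w) * N w * (t * w x) ^+ 3 * (t * w x))).
    rewrite -[leRHS]mulrA -exprSr ler_wpM2l//.
    by rewrite ler_pXn2r ?nnegrE ?(ltW t0)// (le_trans (ltW t0)).
  rewrite ler_wpM2r//; first by rewrite (le_trans (ltW t0)).
  by apply: hK; rewrite (le_trans _ tw)// le_max lexx.
have [r /andP[r0 _] gr] := nehari_proj Htw Ntw gt.
exists (fun x => r * (t * w x)); split=> //; first exact: HsZ.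
by rewrite normVZ// mulr_gt0 ?exprn_gt0.
Qed.

End Fibers.

(** * Almost minimizers are almost critical *)

Section GroundState.
Context (R : realType) (s V0 m0 q theta : R) (M f : R -> R).
Hypothesis H : kirchhoff_problem s V0 m0 q theta M f.
Implicit Types (u v w phi : R3 R -> R).
Notation mu := (@leb3 R).
Notation N := (normV s V0).
Notation B := (bform s V0).
Notation F := (primF f).
Notation Rint := (Rintegral mu setT).
Notation nehari := (nehari s V0 M f).
Notation energy := (energy s V0 M f).

Let N0 u : 0 <= N u. Proof. exact: normV_ge0 (kp_V0 H) u. Qed.
Let M0 t : 0 <= t -> 0 <= M t.
Proof. by move=> /(kp_M1 H); apply: le_trans; apply: ltW; exact: kp_m0 H. Qed.

Let energy_upper C v : Hs s v -> exists2 K, 0 <= K & forall u c, Hs s u -> N u <= C -> `|c| <= 1 ->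
  energy (fun x => u x + c * v x) - energy u <= K * `|c| /\
  N (fun x => u x + c * v x) <= 3 * C + 2 * N v.
Proof.
move=> Hv; have [K0 hK0] := nonlin_bound H C Hv.
set D := 3 * C + 2 * N v; set b := C + N v.
exists (`|M D * b| + `|K0|); first by rewrite addr_ge0.
move=> u c Hu uC c1; have Huv := HsD Hu (HsZ c Hv).
have hB := bform_CS (kp_V0 H) Hu Hv.
have Nu := N0 u; have Nv := N0 v.
have cB : `|c * B u v + c ^+ 2 / 2 * N v| <= `|c| * b.
  rewrite (_ : c * B u v + c ^+ 2 / 2 * N v = c * (B u v + c / 2 * N v)); last by ring.
  rewrite normrM ler_wpM2l// (le_trans (ler_normD _ _))// !normrM (ger0_norm Nv).
  rewrite (@ger0_norm _ (2^-1)) ?invr_ge0//.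
  have : `|c| / 2 * N v <= N v / 2 by rewrite mulrAC ler_pM2r ?invr_gt0// ler_piMl.
  by move: hB; rewrite /b; lra.
have ND : N (fun x => u x + c * v x) <= D.
  have -> : N (fun x => u x + c * v x) = N u + 2 * (c * B u v + c ^+ 2 / 2 * N v).
    by rewrite normV_addZ//; field.
  move: cB => /(le_trans (ler_norm _)) cB.
  have : `|c| * b <= b by rewrite ler_piMl// /b; lra.
  by move: cB; rewrite /D /b; lra.
split=> //; apply: (le_trans (energy_step H c Hu Hv)).
rewrite mulrDl; apply: lerD.
  apply: (@le_trans _ _ (M (N (fun x => u x + c * v x)) * (`|c| * b))).
    by rewrite ler_wpM2l ?M0// (le_trans (ler_norm _)).
  have b0 : 0 <= b by rewrite /b; lra.
  apply: (@le_trans _ _ (M D * (`|c| * b))).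
    by rewrite ler_wpM2r ?mulr_ge0// (kirchhoff_homo (kp_M2 H)).
  rewrite (mulrC `|c|) mulrA ler_wpM2r// ler_norm//.
rewrite -mulNr (le_trans (ler_norm _))// normrM normrN mulrC ler_wpM2r//.
by rewrite (le_trans (hK0 u Hu uC))// ler_norm.
Qed.

(** Convexity bounds increments only from above; the lower bound comes from stepping back by
    [- c * v] from the new point, whose norm obeys the enlarged bound. *)
Lemma energy_lipschitz C v : Hs s v -> exists2 K, 0 <= K &
  forall u c, Hs s u -> N u <= C -> `|c| <= 1 ->
  `|energy (fun x => u x + c * v x) - energy u| <= K * `|c|.
Proof.
move=> Hv; have [K1 K10 h1] := energy_upper C Hv.
have [K2 K20 h2] := energy_upper (3 * C + 2 * N v) Hv.
exists (K1 + K2); first by rewrite addr_ge0.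
move=> u c Hu uC c1; have [a1 a2] := h1 u c Hu uC c1.
have [|a3 _] := h2 _ (- c) (HsD Hu (HsZ c Hv)) a2; first by rewrite normrN.
have e1 : (fun x => u x + c * v x + - c * v x) = u by apply/funext => x; ring.
rewrite e1 normrN in a3.
have n1 : 0 <= K1 * `|c| by rewrite mulr_ge0.
have n2 : 0 <= K2 * `|c| by rewrite mulr_ge0.
rewrite mulrDl ler_norml; move: a1 a3 n1 n2.
move: (energy _) (energy _) (K1 * _) (K2 * _) => *; apply/andP; split; lra.
Qed.

(** To be read backwards: comparing the energies of two multiples of [w] decides the sign of
    [nehari] at one of them. *)
Let energy_ray w a b : Hs s w -> 0 < a -> 0 <= b ->
  energy (fun x => b * w x) + (1 - (b / a) ^+ 4) / 4 * nehari (fun x => a * w x) <=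
  energy (fun x => a * w x).
Proof.
move=> Hw a0 b0; have := energy_fiber H (HsZ a Hw) (divr_ge0 b0 (ltW a0)).
have -> : (fun x => b / a * (a * w x)) = (fun x => b * w x).
  by apply/funext => x; field; rewrite gt_eqF.
apply: le_trans; rewrite lerDl.
apply: mulr_ge0; last exact: sqr_ge0.
by apply: mulr_ge0; rewrite ?N0// divr_ge0// ltW// (kp_m0 H).
Qed.

(* If [u] nearly minimizes the energy on the Nehari set, then the ray through [u + e phi] meets
   that set at a parameter [t] close to 1, and minimality bounds the directional derivative. *)
Lemma nehari_almost_critical C phi c0 : Hs s phi ->
  (forall v, Hs s v -> 0 < N v -> nehari v = 0 -> c0 <= energy v) ->
  exists K e0, [/\ 0 <= K, 0 < e0 & forall e u, 0 < e -> e <= e0 ->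
    Hs s u -> N u <= C -> 0 < N u -> nehari u = 0 -> energy u <= c0 + e ^+ 2 ->
    exists t, [/\ 1 / 2 <= t <= 2, (1 - t) ^+ 2 <= K * e &
      - e <= M (N (fun x => t * u x + t * e * phi x)) *
               (t * B (fun x => t * u x) phi + t ^+ 2 * e / 2 * N phi)
             - t * Rint (fun x => f (t * u x) * phi x)]].
Proof.
have half2 : 1 / 2 <= 2 :> R by lra.
have half1 : 1 / 2 <= 1 :> R by lra.
have half0 : 0 <= 1 / 2 :> R by lra.
have one2 : 1 <= 2 :> R by lra.
move=> Hp hc; have [a0 a00 ha] := nehari_norm_lower H.
have m0p := kp_m0 H; have Np := N0 phi.
(* [4 * C] bounds [N (t * u)] for [t <= 2]. *)
have [K1 K10 lip] := energy_lipschitz (4 * C) Hp.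
have ma : 0 < m0 * a0 by rewrite mulr_gt0.
pose D := `|C| + N phi + 1; have D0 : 0 < D by rewrite /D; have := normr_ge0 C; lra.
(* Three demands: the step satisfies [t * e <= 1] for [t <= 2]; the energy errors [K1 * e] are small
   against [m0 * a0]; the perturbed function [w] keeps a positive norm. *)
pose e0 := Num.min (1 / 2) (Num.min (m0 * a0 / (64 * (K1 + 1))) (a0 / (2 * D))).
have K11 : 0 < K1 + 1 by lra.
exists (4 / (m0 * a0) * (1 + 2 * K1)), e0; split.
- by rewrite mulr_ge0 ?divr_ge0 ?(ltW ma)//; lra.
- by rewrite !lt_min !divr_gt0 ?mulr_gt0.
move=> e u ep; rewrite !le_min => /and3P[e1 e2 e3] Hu uC Nu gu Eu.
have au : a0 <= N u by apply: ha => //; rewrite gu.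
have eK : K1 * e <= m0 * a0 / 64.
  rewrite ler_pdivlMr ?mulr_gt0// in e2.
  have : 0 <= e by exact: ltW.
  by move: e2; lra.
pose w x := u x + e * phi x.
have Hw : Hs s w by apply: HsD => //; exact: HsZ.
have twE t : (fun x => t * w x) = (fun x => t * u x + t * e * phi x).
  by apply/funext => x; rewrite /w; ring.
have close t : 1 / 2 <= t -> t <= 2 ->
    `|energy (fun x => t * w x) - energy (fun x => t * u x)| <= 2 * (K1 * e).
  move=> t1 t2; have t0 : 0 <= t by lra.
  rewrite twE (le_trans (lip _ _ (HsZ t Hu) _ _))//.
  - rewrite normVZ//; have : t ^+ 2 <= 4 by nra.
    by move=> t4; rewrite (le_trans (ler_wpM2r (ltW Nu) t4))// ler_pM2l.
  - by rewrite ger0_norm ?mulr_ge0 ?(ltW ep)//; nra.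
  - rewrite ger0_norm ?mulr_ge0 ?(ltW ep)// mulrCA ler_wpM2r ?mulr_ge0 ?(ltW ep)//.
have ray t : 0 <= t -> energy (fun x => t * u x) + m0 / 4 * a0 * (1 - t ^+ 2) ^+ 2 <= energy u.
  move=> t0; have := energy_fiber H Hu t0; rewrite gu mulr0 addr0; apply: le_trans.
  rewrite lerD2l ler_wpM2r ?sqr_ge0// ler_wpM2l// divr_ge0// ltW//.
have fold1 (v : R3 R -> R) : (fun x => 1 * v x) = v by apply/funext => x; rewrite mul1r.
have Nw : 0 < N w.
  have hB := bform_CS (kp_V0 H) Hu Hp.
  rewrite normV_addZ//.
  have h1 : - (e * (N u + N phi)) <= 2 * e * B u phi.
    have := ler_wpM2l (ltW ep) (le_trans (ler_norm _) (_ : `|- B u phi| <= (N u + N phi) / 2)).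
    by rewrite normrN => /(_ hB); lra.
  have h2 : e * (N u + N phi) <= a0 / 2.
    rewrite ler_pdivlMr ?mulr_gt0// in e3.
    have : e * (N u + N phi) <= e * D.
      by rewrite ler_pM2l// /D; have := ler_norm C; lra.
    by move: e3; lra.
  have h3 : 0 <= e ^+ 2 * N phi by rewrite mulr_ge0 ?sqr_ge0.
  by move: h1 h2 h3 au a00; lra.
(* By [ray] the energy of [u / 2] is below that of [u] by [9 / 64 * (m0 * a0)]. Two errors of size
   [2 * (K1 * e)] do not destroy this for [w], and a negative [nehari] at [w / 2] would contradict
   [energy_ray]. *)
have half : 0 <= nehari (fun x => 1 / 2 * w x).
  have h1 := @energy_ray w (1 / 2) 1 Hw (divr_gt0 ltr01 (ltr0n _ 2)) ler01.
  have h2 := close _ (lexx _) half2; have h3 := close 1 half1 one2.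
  have h4 := ray (1 / 2) half0.
  rewrite !fold1 in h1 h3; move: h1 h2 h3 h4 eK ma.
  have -> : (1 - (1 / (1 / 2)) ^+ 4) / 4 = - 15 / 4 :> R by field.
  have -> : m0 / 4 * a0 * (1 - (1 / 2) ^+ 2) ^+ 2 = 9 / 64 * (m0 * a0) by field.
  move: (energy (fun x => 1 / 2 * w x)) (energy w) (energy (fun x => 1 / 2 * u x)) (energy u).
  move: (nehari _) (K1 * e) (m0 * a0) => x1 x2 x3 x4 x5 x6 x7 h1 h2 h3 h4 h5 h6.
  by move: h2 h3; rewrite !ler_norml => /andP[? ?] /andP[? ?]; lra.
have two : nehari (fun x => 2 * w x) <= 0.
  have h1 := @energy_ray w 2 1 Hw (ltr0n _ 2) ler01.
  have h2 := close 2 half2 (lexx _); have h3 := close 1 half1 one2.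
  have h4 := ray 2 (ler0n _ 2).
  rewrite !fold1 in h1 h3; move: h1 h2 h3 h4 eK ma.
  have -> : (1 - (1 / 2) ^+ 4) / 4 = 15 / 64 :> R by field.
  have -> : m0 / 4 * a0 * (1 - 2 ^+ 2) ^+ 2 = 9 / 4 * (m0 * a0) by field.
  move: (energy (fun x => 2 * w x)) (energy w) (energy (fun x => 2 * u x)) (energy u).
  move: (nehari _) (K1 * e) (m0 * a0) => x1 x2 x3 x4 x5 x6 x7 h1 h2 h3 h4 h5 h6.
  by move: h2 h3; rewrite !ler_norml => /andP[? ?] /andP[? ?]; lra.
have [t /andP[t1 t2] gt] := nehari_root H Hw half2 half two.
have t0 : 0 < t by apply: lt_le_trans t1; rewrite divr_gt0.
have Etw : c0 <= energy (fun x => t * w x).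
  by apply: hc; [exact: HsZ|rewrite normVZ// mulr_gt0// exprn_gt0|exact: gt].
have Ec := close t t1 t2; have Er := ray t (ltW t0).
exists t; split; first by rewrite t1.
- have h1 : m0 / 4 * a0 * (1 - t ^+ 2) ^+ 2 <= (1 + 2 * K1) * e.
    move: Etw Ec Er Eu; rewrite ler_norml.
    have : e ^+ 2 <= e by rewrite expr2 ler_piMl ?(ltW ep)// (le_trans e1).
    have -> : (1 + 2 * K1) * e = e + 2 * (K1 * e) by ring.
    move: (energy _) (energy _) (energy _) (K1 * e) (e ^+ 2) (m0 / 4 * _ * _).
    by move=> x1 x2 x3 x4 x5 x6 ? ? /andP[? ?] ? ?; lra.
  have h2 : (1 - t) ^+ 2 <= (1 - t ^+ 2) ^+ 2.
    have -> : (1 - t ^+ 2) ^+ 2 = (1 - t) ^+ 2 * (1 + t) ^+ 2 by ring.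
    by rewrite ler_peMr ?sqr_ge0// expr_ge1 ?addr_ge0 ?(ltW t0)// lerDl ltW.
  apply: (le_trans h2); rewrite -[leRHS]mulrA.
  have -> : (1 - t ^+ 2) ^+ 2 = 4 / (m0 * a0) * (m0 / 4 * a0 * (1 - t ^+ 2) ^+ 2).
    by field; rewrite !gt_eqF.
  by rewrite ler_wpM2l// divr_ge0// ltW.
(* [t * w] is on the Nehari set and [u] is minimal up to [e ^+ 2], so passing from [t * u] to
   [t * w] lowers the energy by at most [e ^+ 2]. The step has length [t * e]; division by [e]
   leaves [- e], which is why the defect is taken quadratic. *)
- rewrite -(ler_pM2l ep).
  have h1 := energy_step H (t * e) (HsZ t Hu) Hp; rewrite twE in Etw.
  apply: le_trans (le_trans h1 _); last first.
    rewrite mulrBr le_eqVlt; apply/orP; left; apply/eqP; congr (_ - _); last by ring.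
    by rewrite mulrCA; congr (_ * _); field.
  have h2 : 0 <= m0 / 4 * a0 * (1 - t ^+ 2) ^+ 2.
    by rewrite mulr_ge0 ?sqr_ge0// mulr_ge0 ?divr_ge0 // ltW.
  rewrite mulrN -expr2; clear h1 Ec; move: Etw Er Eu h2.
  by move: (energy _) (energy _) (energy _) (_ * (_ - _) ^+ 2) (e ^+ 2) => *; lra.
Qed.

End GroundState.

(** * Existence of a ground state *)

Section Existence.
Context (R : realType) (s V0 m0 q theta : R) (M f : R -> R).
Hypothesis H : kirchhoff_problem s V0 m0 q theta M f.
Implicit Types (u v w phi : R3 R -> R).
Notation mu := (@leb3 R).
Notation N := (normV s V0).
Notation B := (bform s V0).
Notation F := (primF f).
Notation Rint := (Rintegral mu setT).
Notation nehari := (nehari s V0 M f).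
Notation energy := (energy s V0 M f).

Let N0 u : 0 <= N u. Proof. exact: normV_ge0 (kp_V0 H) u. Qed.

Let minimizing_sequence : exists (c0 C del : R) (u_ : nat -> R3 R -> R),
  [/\ 0 < C, 0 < del,
    forall v, Hs s v -> 0 < N v -> nehari v = 0 -> c0 <= energy v &
    forall n, [/\ Hs s (u_ n), 0 < N (u_ n) <= C, nehari (u_ n) = 0,
      energy (u_ n) <= c0 + harmonic n ^+ 2 &
      del <= Rint (fun y => box 1 0 y * u_ n y ^+ 2)]].
Proof.
have m0p := kp_m0 H.
pose E := [set x | exists v, [/\ Hs s v, 0 < N v, nehari v = 0 & x = energy v]].
have E0 : lbound E 0.
  move=> _ [v [Hv Nv gv ->]]; have := energy_nehari H Hv; rewrite gv mul0r subr0.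
  by apply: le_trans; rewrite mulr_ge0 ?divr_ge0// ltW.
have iE : has_inf E.
  split; last by exists 0.
  by have [v [Hv Nv gv]] := nehari_nonempty H; exists (energy v), v.
(* [C] comes from [m0 / 4 * N v <= energy v] on the Nehari set, with energies at most [c0 + 1]. *)
pose c0 := inf E; pose C := 4 / m0 * (c0 + 1) .
have hc v : Hs s v -> 0 < N v -> nehari v = 0 -> c0 <= energy v.
  by move=> Hv Nv gv; apply: ge_inf; [case: iE|exists v].
have [del del0 hdel] := nehari_concentrated H C.
have step n : exists v, [/\ Hs s v, 0 < N v <= C, nehari v = 0,
      energy v <= c0 + harmonic n ^+ 2 & del <= Rint (fun y => box 1 0 y * v y ^+ 2)].
  have h0 : 0 < harmonic n ^+ 2 :> R by rewrite exprn_gt0// /harmonic invr_gt0.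
  have [_ [v [Hv Nv gv ->]] /ltW Ev] := inf_adherent h0 iE.
  have NC : N v <= C.
    have h1 : harmonic n ^+ 2 <= 1 :> R.
      by rewrite expr_le1// /harmonic ?invr_ge0// invf_le1// ler1n.
    have := energy_nehari H Hv; rewrite gv mul0r subr0 => h2.
    have h3 : m0 / 4 * N v <= c0 + 1 by move: h1 h2 Ev; rewrite -/c0; lra.
    have := ler_wpM2l (_ : 0 <= 4 / m0) h3; rewrite mulrA -/C.
    have -> : 4 / m0 * (m0 / 4) = 1 by field; rewrite gt_eqF.
    by rewrite mul1r; apply; rewrite divr_ge0// ltW.
  have [|w [Hw Nw gw Ew hw]] := hdel v Hv Nv NC; first by rewrite gv.
  by exists w; split; [exact: Hw|rewrite Nw Nv NC|rewrite gw|rewrite Ew|exact: hw].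
have [u_ hu] := choice step.
exists c0, C, del, u_; split=> //.
by have [_ /andP[h1 h2] _ _ _] := hu 0%N; exact: lt_le_trans h1 h2.
Qed.

Let harmonic_sub (phi : nat -> nat) : (forall n, (n <= phi n)%N) ->
  harmonic (phi n) @[n --> \oo] --> (0 : R).
Proof.
move=> hphi; apply: (@squeeze_cvgr _ _ _ _ (fun=> 0) harmonic); last exact: cvg_harmonic.
  apply: nearW => n; rewrite /harmonic invr_ge0 ler0n /= lef_pV2 ?posrE//.
  by rewrite ler_nat ltnS.
exact: cvg_cst.
Qed.

(** The ray parameters tend to 1 and the steps to 0, so the perturbed norms have the same limit [A]
    as [N (u_ n)], which may still differ from [N u]. *)
Let limit_inequality c0 C (u_ : nat -> R3 R -> R) (e_ : nat -> R) u A phi :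
  (forall v, Hs s v -> 0 < N v -> nehari v = 0 -> c0 <= energy v) ->
  (forall n, [/\ Hs s (u_ n), 0 < N (u_ n) <= C, nehari (u_ n) = 0 &
     energy (u_ n) <= c0 + e_ n ^+ 2]) ->
  (forall n, 0 < e_ n) -> e_ n @[n --> \oo] --> 0 ->
  measurable_fun setT u -> {ae mu, forall x, u_ n x @[n --> \oo] --> u x} ->
  N (u_ n) @[n --> \oo] --> A -> Hs s phi ->
  0 <= M A * B u phi - Rint (fun x => f (u x) * phi x).
Proof.
move=> hc hu ep e0 mu_ cu cA Hp.
have Hu n : Hs s (u_ n) by have [] := hu n.
have uC n : N (u_ n) <= C by have [_ /andP[]] := hu n.
have [K [d [K0 d0 crit]]] := nehari_almost_critical H C Hp hc.
have [n0 hn0] : exists n0, forall n, (n0 <= n)%N -> e_ n <= d.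
  move/cvgrPdist_le : e0 => /(_ d d0) [n0 _ hn]; exists n0 => n /hn /=.
  by rewrite sub0r normrN; apply: le_trans; exact: ler_norm.
(* Almost criticality is available only once [e_ n <= d]; the guard makes the statement total for
   [choice], with the placeholder [t = 1] for earlier [n]. *)
pose P n t := (n0 <= n)%N -> (1 - t) ^+ 2 <= K * e_ n /\
   - e_ n <= M (N (fun x => t * u_ n x + t * e_ n * phi x)) *
               (t * B (fun x => t * u_ n x) phi + t ^+ 2 * e_ n / 2 * N phi)
             - t * Rint (fun x => f (t * u_ n x) * phi x).
have hx n : exists t, 1 / 2 <= t <= 2 /\ P n t.
  have [nn|nn] := leqP n0 n; last first.
    by exists 1; split; [apply/andP; split; lra|move=> h; have := leq_trans nn h; rewrite ltnn].
  have [a1 /andP[a2 a3] a4 a5] := hu n.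
  have [t [h1 h2 h3]] := crit (e_ n) (u_ n) (ep n) (hn0 n nn) a1 a3 a2 a4 a5.
  by exists t.
have [t_ ht] := choice hx.
have t12 n : 1 / 2 <= t_ n <= 2 by case: (ht n).
have ct : t_ n @[n --> \oo] --> (1 : R).
  have cK : K * e_ n @[n --> \oo] --> (0 : R) by rewrite -(mulr0 K); exact: cvgMr.
  apply/cvgrPdist_lt => e ee; have e2 : 0 < e ^+ 2 by rewrite exprn_gt0.
  move/cvgrPdist_lt : cK => /(_ _ e2) [n1 _ hn1]; exists (maxn n0 n1) => // n /=.
  rewrite geq_max => /andP[nn0 /hn1 /=]; rewrite sub0r normrN => h1.
  have [_ /(_ nn0)[h2 _]] := ht n.
  have h3 : `|1 - t_ n| ^+ 2 < e ^+ 2.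
    rewrite real_normK ?num_real// (le_lt_trans h2)// (le_lt_trans _ h1)//; exact: ler_norm.
  by rewrite ltr_pXn2r ?nnegrE ?(ltW ee) in h3.
have Htu n : Hs s (fun x => t_ n * u_ n x) by exact: HsZ.
have t0 n : 0 <= t_ n by have /andP[h _] := t12 n; lra.
have t4 n : t_ n ^+ 2 <= 4 by have /andP[_ h] := t12 n; have := t0 n; nra.
have [Hlim cB] := Hs_weak (kp_V0 H) Hu uC mu_ cu.
have {}cB := cB phi Hp.
have ctB : B (fun x => t_ n * u_ n x) phi @[n --> \oo] --> B u phi.
  rewrite -[X in _ --> X]mul1r.
  have -> : (fun n => B (fun x => t_ n * u_ n x) phi) = (fun n => t_ n * B (u_ n) phi).
    by apply/funext => n; rewrite bformZl.
  exact: cvgM.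
have cte : t_ n * e_ n @[n --> \oo] --> (0 : R) by rewrite -(mulr0 1); exact: cvgM.
have ct2 : t_ n ^+ 2 @[n --> \oo] --> (1 : R) by rewrite -(mulr1 1); exact: cvgM.
have cN : N (fun x => t_ n * u_ n x + t_ n * e_ n * phi x) @[n --> \oo] --> A.
  have -> : (fun n => N (fun x => t_ n * u_ n x + t_ n * e_ n * phi x)) =
    (fun n => t_ n ^+ 2 * N (u_ n) + 2 * (t_ n * e_ n) * B (fun x => t_ n * u_ n x) phi +
       (t_ n * e_ n) ^+ 2 * N phi).
    by apply/funext => n; rewrite normV_addZ// normVZ.
  have -> : A = 1 * A + 2 * 0 * B u phi + (0 * 0) * N phi by ring.
  apply: cvgD; last by apply: cvgMl; exact: cvgM.
  by apply: cvgD; apply: cvgM => //; apply: cvgMr.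
have cf : Rint (fun x => f (t_ n * u_ n x) * phi x) @[n --> \oo] -->
    Rint (fun x => f (u x) * phi x).
  apply: (nonlin_cvg H (u_ := fun n x => t_ n * u_ n x) (C := 4 * C)) => //.
    move=> n; rewrite normVZ//.
    have [_ /andP[/ltW h1 h2] _ _] := hu n.
    by rewrite (le_trans (ler_wpM2r h1 (t4 n)))// ler_pM2l.
  by apply: (@ae_mono _ _ _ mu) cu => x cx; rewrite -[X in _ --> X]mul1r; exact: cvgM.
have cr : M (N (fun x => t_ n * u_ n x + t_ n * e_ n * phi x)) *
               (t_ n * B (fun x => t_ n * u_ n x) phi + t_ n ^+ 2 * e_ n / 2 * N phi)
             - t_ n * Rint (fun x => f (t_ n * u_ n x) * phi x) @[n --> \oo] -->
    M A * (1 * B u phi + 1 * 0 / 2 * N phi) - 1 * Rint (fun x => f (u x) * phi x).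
  apply: cvgB; last exact: cvgM.
  apply: cvgM; first exact: (kirchhoff_cvg H).
  apply: cvgD; first exact: cvgM.
  by apply: cvgMl; apply: cvgMl; exact: cvgM.
have cme : - e_ n @[n --> \oo] --> (0 : R) by rewrite -oppr0; exact: cvgN.
have := ler_cvg_to cme cr; rewrite !mul1r !mul0r addr0; apply.
by exists n0 => // n /= nn; have [_ /(_ nn)[]] := ht n.
Qed.

Theorem nehari_ground_state : exists u, weak_solution s V0 M f u /\ 0 < N u.
Proof.
have half_gap (a b c : R) : a - b <= (a - c) / 2 -> (a - c) / 2 <= b - c by lra.
have level_gap (k l j c h d : R) :
  k + j <= c + h -> h <= d / 2 -> d <= k - l -> j <= c - l - d / 2 by lra.
have V0p := kp_V0 H; have m0p := kp_m0 H.
have [c0 [C [del [u_ [C0 del0 hc hu]]]]] := minimizing_sequence.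
have Hu n : Hs s (u_ n) by case: (hu n).
have uC n : N (u_ n) <= C by have [_ /andP[]] := hu n.
have T0 : 0 < Num.sqrt ((1 + V0^-1) * C).
  by rewrite sqrtr_gt0 mulr_gt0// addr_gt0 ?invr_gt0.
have [|n|psi [u [A [hpsi mu_ cu cA nz]]]] :=
  compactness (kp_s0 H) (u_ := u_) (A_ := fun n => N (u_ n)) (C := C) T0 Hu _ _.
- by move=> n; exact: (bounded2_normV H (Hu n) (ltW C0) (uC n)).
- by rewrite ger0_norm.
have ep n : 0 < harmonic (psi n) :> R by rewrite /harmonic invr_gt0.
have ce := harmonic_sub hpsi.
have hU n : [/\ Hs s (u_ (psi n)), 0 < N (u_ (psi n)) <= C, nehari (u_ (psi n)) = 0 &
     energy (u_ (psi n)) <= c0 + harmonic (psi n) ^+ 2] by case: (hu (psi n)).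
have ineq phi := limit_inequality hc hU ep ce mu_ cu cA (phi := phi).
have [Hlim _] := Hs_weak V0p (fun n => Hu (psi n)) (fun n => uC (psi n)) mu_ cu.
have NA := normV_weak_le V0p (fun n => Hu (psi n)) (fun n => uC (psi n)) mu_ cu cA.
have Nu : 0 < N u.
  rewrite lt_neqAle N0 andbT eq_sym; apply/eqP => Nu0.
  apply: (nz del del0) => [n|]; first by case: (hu n).
  by apply: (normV_eq0 V0p Hlim); rewrite Nu0.
(* The inequality for [phi] and for [- phi]. *)
have eqn phi : Hs s phi -> M A * B u phi = Rint (fun x => f (u x) * phi x).
  move=> Hp; have h1 := ineq phi Hp; have h2 := ineq _ (HsZ (-1) Hp).
  rewrite bformZr// in h2.
  have e1 : Rint (fun x => f (u x) * (-1 * phi x)) = - Rint (fun x => f (u x) * phi x).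
    rewrite -[RHS]mulN1r -RintegralZl//; last exact: (nonlin_intg H Hlim Hp).
    by apply: eq_Rintegral => x _; rewrite mulrCA.
  rewrite e1 mulN1r mulrN in h2; apply/eqP; rewrite eq_le; move: h1 h2.
  by move: (M A * _) (Rint _) => *; apply/andP; split; lra.
suff AN : A = N u.
  exists u; split=> //; split=> // phi Hp.
  by rewrite -AN -(eqn phi Hp).
apply/eqP; rewrite eq_le NA andbT leNgt; apply/negP => NuA.
have gu : nehari u <= 0.
  rewrite /nehari -(eqn u Hlim) -normVE subr_le0 ler_wpM2r//.
  exact: (kirchhoff_homo (kp_M2 H)).
have [t /andP[t0 t1] gt] := nehari_proj H Hlim Nu gu.
have Et : c0 <= energy u - nehari u / 4.
  have h1 : c0 <= energy (fun x => t * u x).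
    by apply: hc => //; [exact: HsZ|rewrite normVZ// mulr_gt0// exprn_gt0].
  have h2 := energy_fiber H Hlim (ltW t0).
  have h3 : 0 <= m0 / 4 * N u * (1 - t ^+ 2) ^+ 2.
    by apply: mulr_ge0; rewrite ?sqr_ge0// mulr_ge0 ?(ltW Nu)// divr_ge0// ltW.
  have h4 : t ^+ 4 * nehari u <= 0 by rewrite mulr_ge0_le0// exprn_ge0// ltW.
  move: h1 h2 h3 h4 gu; rewrite mulrBl mulrBl mul1r [t ^+ 4 / 4 * _]mulrAC.
  move: (energy _) (energy u) (m0 / 4 * _ * _) (t ^+ 4 * _) => *; lra.
(* [energy - nehari / 4] splits into [K (N v) + J v]. The integrand of [J] is nonnegative, so
   Fatou's lemma applies, and [K] is strictly increasing; a loss of norm would push the value at [u]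
   below [c0]. *)
pose J v := Rint (fun x => f (v x) * v x / 4 - F (v x)).
pose K a := primF M a / 2 - M a * a / 4.
have Ji v : Hs s v -> intg mu (fun x => f (v x) * v x / 4 - F (v x)).
  move=> Hv; apply: intgB; last exact: (primF_intg H).
  have := intgZ (4^-1) (nonlin_intg H Hv Hv).
  by under [X in _.-integrable _ X -> _]eq_fun do rewrite /= mulrC.
have JE v : Hs s v -> energy v - nehari v / 4 = K (N v) + J v.
  move=> Hv; have iv := nonlin_intg H Hv Hv.
  have -> : J v = Rint (fun x => f (v x) * v x) / 4 - Rint (fun x => F (v x)).
    rewrite mulrC -RintegralZl// -RintegralB//; last exact: (primF_intg H).
      by apply: eq_Rintegral => x _; rewrite [4^-1 * _]mulrC.
    exact: intgZ.
  rewrite /energy /nehari /K; move: (M _ * _) (primF M _) (Rint _) (Rint _) => *; lra.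
(* A lower bound for the gain in [K] once the norms exceed [N u] by half of [A - N u]. Half of [d]
   absorbs the defect of the almost minimizers, the other half gives the contradiction. *)
pose d := m0 / 4 * ((A - N u) / 2).
have d0 : 0 < d by rewrite mulr_gt0 ?divr_gt0// subr_gt0.
have [n1 hn1] : exists n1, forall n, (n1 <= n)%N ->
    J (u_ (psi n)) <= c0 - K (N u) - d / 2.
  have cA2 : 0 < (A - N u) / 2 by rewrite divr_gt0// subr_gt0.
  move/cvgrPdist_le : cA => /(_ _ cA2) [n1 _ h1].
  have ce2 : harmonic (psi n) ^+ 2 @[n --> \oo] --> (0 * 0 : R) by exact: cvgM.
  rewrite mulr0 in ce2.
  have d2 : 0 < d / 2 by rewrite divr_gt0.
  move/cvgrPdist_le : ce2 => /(_ _ d2) [n2 _ h2].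
  exists (maxn n1 n2) => n; rewrite geq_max => /andP[/h1 /= h3 /h2 /= h4].
  have [Hn /andP[Nn NC] gn En] := hU n.
  have := JE _ Hn; rewrite gn mul0r subr0 => EJ.
  have NN : (A - N u) / 2 <= N (u_ (psi n)) - N u.
    by apply: half_gap; exact: le_trans (ler_norm _) h3.
  have gap := kirchhoff_gap (kp_Mc H) (kp_M1 H) (kp_M3 H) (N0 u)
    (_ : N u <= N (u_ (psi n))).
  have {}gap : d <= K (N (u_ (psi n))) - K (N u).
    apply: le_trans (gap _); last by rewrite -subr_ge0 (le_trans (ltW cA2)).
    by rewrite ler_pM2l ?divr_gt0.
  have h5 : harmonic (psi n) ^+ 2 <= d / 2.
    by rewrite sub0r normrN in h4; rewrite (le_trans (ler_norm _)).
  by move: En; rewrite EJ => /level_gap h; exact: h h5 gap.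
have [_ Ju] : intg mu (fun x => f (u x) * u x / 4 - F (u x)) /\ J u <= c0 - K (N u) - d / 2.
  apply: (@Rint_fatou _ _ _ mu (fun n x => f (u_ (psi (n + n1)%N) x) * u_ (psi (n + n1)%N) x / 4
     - F (u_ (psi (n + n1)%N) x))).
  - by move=> n; exact: Ji.
  - by move=> n x; rewrite subr_ge0; exact: (F_le_quarter (kp_fc H) (kp_fneg H) (kp_f4 H)).
  - exact: (intg_measurable (Ji _ Hlim)).
  - by move=> x; rewrite subr_ge0; exact: (F_le_quarter (kp_fc H) (kp_fneg H) (kp_f4 H)).
  - apply: (@ae_mono _ _ _ mu) cu => x cx.
    have cx' : u_ (psi (n + n1)%N) x @[n --> \oo] --> u x.
      by rewrite (cvg_shiftn n1 (fun n => u_ (psi n) x)).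
    apply: cvgB; last by apply: continuous_cvg => //; exact: (primF_continuous H).
    apply: cvgMl; apply: cvgM => //; apply: continuous_cvg => //; exact: (kp_fc H).
  - by move=> n; apply: hn1; rewrite leq_addl.
by move: Et; rewrite (JE _ Hlim) => Et; move: Ju d0 Et; move: (K _) (J _) => *; lra.
Qed.

End Existence.

(** * The strong maximum principle *)

Section StrongMaximum.
Context (R : realType) (s V0 : R).
Hypotheses (s_gt0 : 0 < s) (s_lt1 : s < 1) (V0_gt0 : 0 < V0).
Variable u : R3 R -> R.
Hypothesis Hu : Hs s u.
Hypothesis u_super : forall w, Hs s w -> (forall x, 0 <= w x) -> 0 <= bform s V0 u w.
Implicit Types (w eta : R3 R -> R).
Notation mu3 := (@leb3 R).
Notation mu6 := (@leb6 R).
Notation N := (normV s V0).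
Notation B := (bform s V0).

Let Hs_pos w : Hs s w -> Hs s (fun x => Num.max 0 (w x)).
Proof.
have K (a b : R) : `|Num.max 0 a - Num.max 0 b| <= `|a - b|.
  by have [a0|a0] := leP a 0; have [b0|b0] := leP b 0;
    rewrite ?(max_l a0) ?(max_r (ltW a0)) ?(max_l b0) ?(max_r (ltW b0)) ler_norml;
    apply/andP; split; move: (ler_norm (a - b)) (ler_norm (- (a - b))); rewrite normrN; lra.
move=> Hw; apply: (Hs_contraction _ Hw) => [|x|x y]; last exact: K.
  by apply: measurable_maxr => //; exact: Hs_meas Hw.
by have := K (w x) 0; rewrite maxxx !subr0.
Qed.

Let part_pos eta e x := Num.max 0 (u x - e * eta x).
Let part_neg eta e x := Num.max 0 (e * eta x - u x).

Let cross eta e (z : R3 R * R3 R) :=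
  part_pos eta e z.1 * part_neg eta e z.2 * gagw s z ^+ 2.

Let cross_ge0 eta e z : 0 <= cross eta e z.
Proof. by rewrite /cross mulr_ge0 ?sqr_ge0// mulr_ge0// le_max lexx. Qed.

(* Test the inequality with [w = (e eta - u)^+] and write [u = e eta - w + p] with
   [p = (u - e eta)^+]: since [p w = 0], the form [B p w] is minus the integral of
   [p x * w y + p y * w x], and [e B eta w <= N w + e^2 N eta / 4]. *)
Let cross_bound eta e : Hs s eta -> 0 < e ->
  intg mu6 (cross eta e) /\ Rintegral mu6 setT (cross eta e) <= e ^+ 2 / 4 * N eta.
Proof.
move=> He e0; set p := part_pos eta e; set w := part_neg eta e.
have Hp : Hs s p by apply: Hs_pos; apply: HsB => //; exact: HsZ.
have Hw : Hs s w by apply: Hs_pos; apply: HsB => //; exact: HsZ.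
have p0 x : 0 <= p x by rewrite le_max lexx.
have w0 x : 0 <= w x by rewrite le_max lexx.
have uE x : u x = e * eta x + -1 * w x + p x.
  rewrite /w /p /part_neg /part_pos; have [h|h] := leP (u x) (e * eta x).
    by rewrite max_r ?subr_ge0// max_l ?subr_le0//; ring.
  by rewrite max_l ?subr_le0 ?(ltW h)// max_r ?subr_ge0 ?(ltW h)//; ring.
have pw x : p x * w x = 0.
  rewrite /w /p /part_neg /part_pos; have [h|h] := leP (u x) (e * eta x).
    by rewrite [X in X * _]max_l ?subr_le0// mul0r.
  by rewrite [X in _ * X]max_l ?subr_le0 ?(ltW h)// mulr0.
pose h z := - (quot s p z * quot s w z).
have [iq iv] := bform_intg V0 Hp Hw.
have ih : intg mu6 h.
  by have := intgZ (-1) iq; under [X in _.-integrable _ X -> _]eq_fun do rewrite /= mulN1r.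
have hE z : h z = cross eta e z + p z.2 * w z.1 * gagw s z ^+ 2.
  rewrite /h /quot /cross -/p -/w.
  have := pw z.1; have := pw z.2 => h2 h1.
  transitivity (- ((p z.1 * w z.1 + p z.2 * w z.2) - p z.1 * w z.2 - p z.2 * w z.1) *
    gagw s z ^+ 2); first by ring.
  by rewrite h1 h2; ring.
have ch z : cross eta e z <= h z.
  by rewrite hE lerDl mulr_ge0 ?sqr_ge0// mulr_ge0.
have mc : measurable_fun setT (cross eta e).
  have [mp1 _] := measurable_fst_snd (Hs_meas Hp).
  have [_ mw2] := measurable_fst_snd (Hs_meas Hw).
  apply: measurable_funM; first exact: measurable_funM mp1 mw2.
  by apply: measurable_funX; exact: measurable_gagw.
have ic : intg mu6 (cross eta e).
  by apply: (intg_dom _ ih) => [|z]; [exact: mc|rewrite ger0_norm ?cross_ge0//].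
split=> //; apply: (le_trans (le_Rint ic ih ch)).
have hB := u_super Hw w0.
have BE : B u w = e * B eta w - N w + B p w.
  have -> : u = fun x => (e * eta x + -1 * w x) + p x by apply/funext.
  have He' := HsZ e He; have Hw' := HsZ (-1) Hw.
  rewrite bformDl//; last exact: HsD.
  by rewrite bformDl// !bformZl// mulN1r -normVE.
have BpE : B p w = - Rintegral mu6 setT h.
  rewrite bformE (_ : (fun x => V0 * (p x * w x)) = fun=> 0); last first.
    by apply/funext => x; rewrite pw mulr0.
  rewrite Rintegral_cst// mul0r addr0 -[RHS]mulN1r -RintegralZl//.
  by apply: eq_Rintegral => z _; rewrite mulN1r opprK.
have Q : 0 <= N w - e * B eta w + e ^+ 2 / 4 * N eta.
  have := normV_ge0 s V0_gt0 (fun x => w x + - (e / 2) * eta x).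
  rewrite normV_addZ// (bformC _ _ w).
  have -> : N w + 2 * - (e / 2) * B eta w + (- (e / 2)) ^+ 2 * N eta =
    N w - e * B eta w + e ^+ 2 / 4 * N eta by field.
  by [].
by move: hB Q; rewrite BE BpE; move: (Rintegral _ _ _) (_ * B _ _) (N w) (_ * N _) => *; lra.
Qed.

Hypothesis u_ge0 : {ae mu3, forall x, 0 <= u x}.

Let Z : set (R3 R) := [set x | u x = 0].

Let mZ : measurable Z.
Proof.
have -> : Z = setT `&` u @^-1` [set 0] by rewrite setTI.
exact: (Hs_meas Hu).
Qed.

(* The almost everywhere limit of [e^-1 * cross eta e] as [e] tends to 0. *)
Let limit_cross eta (z : R3 R * R3 R) :=
  Num.max 0 (u z.1) * (eta z.2 * \1_Z z.2) * gagw s z ^+ 2.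

(** The bound on [cross] is quadratic in [e] and the normalisation only linear, so the integral of
    the limit is below every positive [c]. *)
Let limit_cross_eq0 eta : Hs s eta -> (forall x, 0 <= eta x) ->
  {ae mu6, forall z, limit_cross eta z = 0}.
Proof.
have maxE (a : R) : Num.max 0 a = (a + `|a|) / 2.
  by have [a0|a0] := leP a 0; [rewrite ler0_norm// subrr mul0r|rewrite gtr0_norm//; lra].
move=> He eta0; have Nn := normV_ge0 s V0_gt0 eta.
have l0 z : 0 <= limit_cross eta z.
  by rewrite /limit_cross mulr_ge0 ?sqr_ge0// mulr_ge0 ?le_max ?lexx// mulr_ge0// indicE.
have ml : measurable_fun setT (limit_cross eta).
  have [m1 _] := measurable_fst_snd (Hs_meas (Hs_pos Hu)).
  have [_ m2] := measurable_fst_snd (Hs_meas He).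
  have [_ m3] := measurable_fst_snd (proj1 (measurable_indicP R Z) mZ).
  apply: measurable_funM; last by apply: measurable_funX; exact: measurable_gagw.
  by apply: measurable_funM; [exact: m1|exact: measurable_funM m2 m3].
have bound c : 0 < c -> intg mu6 (limit_cross eta) /\ Rintegral mu6 setT (limit_cross eta) <= c.
  move=> c0; pose d := c / (N eta + 1).
  have N1 : 0 < N eta + 1 by rewrite ltr_wpDl.
  have d0 : 0 < d by rewrite divr_gt0.
  pose e n := d / n.+1%:R; have e0 n : 0 < e n by rewrite divr_gt0.
  have ce : e n @[n --> \oo] --> (0 : R).
    by rewrite -(mulr0 d); apply: cvgMr; exact: cvg_harmonic.
  apply: (@Rint_fatou _ _ _ mu6 (fun n z => (e n)^-1 * cross eta (e n) z)).
  - by move=> n; apply: intgZ; have [] := cross_bound He (e0 n).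
  - by move=> n z; rewrite mulr_ge0 ?cross_ge0 ?invr_ge0 ?(ltW (e0 n)).
  - exact: ml.
  - exact: l0.
  - apply: (@ae_mono _ _ _ mu6) (leb6_fst_snd_ae u_ge0) => z [u1 u2].
    have -> : (fun n => (e n)^-1 * cross eta (e n) z) =
       (fun n => part_pos eta (e n) z.1 * ((e n)^-1 * part_neg eta (e n) z.2) * gagw s z ^+ 2).
      by apply/funext => n; rewrite /cross; ring.
    apply: cvgMl; apply: cvgM.
      have c1 : u z.1 - e n * eta z.1 @[n --> \oo] --> u z.1.
        rewrite -[X in _ --> X]subr0 -(mul0r (eta z.1)); apply: cvgB; first exact: cvg_cst.
        exact: cvgMl.
      rewrite /part_pos maxE; under eq_fun do rewrite maxE.
      by apply: cvgMl; apply: cvgD => //; exact: cvg_norm.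
    rewrite indicE; case: (boolP (z.2 \in Z)) => [|zZ].
      rewrite inE /Z /= mulr1 => uz; apply: cvg_near_cst; apply: nearW => n.
      rewrite /part_neg uz subr0 max_r ?mulKf// ?gt_eqF//.
      by apply: mulr_ge0 => //; exact: ltW.
    rewrite mulr0.
    have uz : 0 < u z.2.
      by rewrite lt_neqAle u2 andbT eq_sym; apply/eqP => uz; move: zZ; rewrite notin_setE.
    have c2 : e n * eta z.2 @[n --> \oo] --> (0 : R).
      by rewrite -(mul0r (eta z.2)); exact: cvgMl.
    apply: cvg_near_cst; move/cvgrPdist_lt : c2 => /(_ _ uz) [n0 _ hn]; exists n0 => // n /hn /=.
    rewrite sub0r normrN => /(le_lt_trans (ler_norm _)) /ltW h.
    by rewrite /part_neg max_l ?subr_le0// mulr0.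
  - move=> n; have [ic bc] := cross_bound He (e0 n).
    rewrite RintegralZl// ler_pdivrMl// (le_trans bc)//.
    have ed : e n <= d by rewrite ler_pdivrMr// ler_peMr ?ler1n// ltW.
    have dc : d * (N eta + 1) = c by rewrite divfK ?gt_eqF.
    have en := e0 n; have h := ler_wpM2r Nn ed.
    rewrite (_ : e n ^+ 2 / 4 * N eta = e n * (e n * N eta / 4)); last by ring.
    rewrite ler_pM2l//; apply: (@le_trans _ _ (d * N eta + d)); last by have := dc; rewrite mulrDr mulr1 => ->.
    have : 0 <= e n * N eta by apply: mulr_ge0 => //; exact: ltW.
    by move: h d0; move: (e n * _) (d * _) => *; lra.
apply: Rint_ae_eq0 => //; have [il _] := bound 1 ltr01.
rewrite -EFin_Rint// lee_fin leNgt; apply/negP => L0.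
have [_] := bound _ (divr_gt0 L0 (ltr0n _ 2)); lra.
Qed.

(** The product of [A], where [u > 0], with the zeros of [u] inside a box is null, because
    [limit_cross] is positive there. As [A] has positive measure, the zeros in each box are null,
    and countably many boxes cover the space. *)
Lemma strong_maximum : ~ {ae mu3, forall x, u x = 0} -> {ae mu3, forall x, 0 < u x}.
Proof.
move=> un0; pose A : set (R3 R) := [set x | 0 < u x].
have mA : measurable A.
  have -> : A = setT `&` u @^-1` `]0, +oo[%classic.
    by rewrite setTI; apply/seteqP; split => x /=; rewrite in_itv/= andbT.
  exact: (Hs_meas Hu).
have A0 : mu3 A != 0%E.
  apply/eqP => A0; apply: un0.
  have nA : {ae mu3, forall x, ~ A x} by exists A; split=> // x /= /contrapT.
  apply: (@ae_mono _ _ _ mu3) (ae_and u_ge0 nA) => x [h1 h2].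
  by apply/eqP; rewrite eq_le h1 andbT leNgt; apply/negP.
have nZ (n : nat) : {ae mu3, forall x, ~ (Z x /\ 0 < bump n.+1%:R x)}.
  have Hb : Hs s (bump (n.+1%:R : R)) by apply: bump_Hs.
  pose Zn : set (R3 R) := Z `&` [set x | 0 < bump n.+1%:R x].
  have mZn : measurable Zn.
    apply: measurableI => //.
    have -> : [set x | 0 < bump n.+1%:R x] =
        setT `&` (bump n.+1%:R : R3 R -> R) @^-1` `]0, +oo[%classic.
      by rewrite setTI; apply/seteqP; split => x /=; rewrite in_itv/= andbT.
    exact: (Hs_meas Hb).
  have nAZ : mu6 (A `*` Zn) = 0%E.
    have [X [mX X0 hX]] := limit_cross_eq0 Hb (bump_ge0 _).
    apply/eqP; rewrite eq_le measure_ge0 andbT -X0 le_measure ?inE//; first exact: measurableX.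
    move=> [x y] [/= Ax [Zy by_]]; apply: hX => /=.
    rewrite /limit_cross /= indicE (mem_set Zy) mulr1 max_r ?(ltW Ax)//.
    have d0 : 0 < dist3 x y.
      rewrite lt_neqAle sqrtr_ge0 andbT eq_sym; apply/eqP => /dist3_eq0 xy.
      by move: Ax; rewrite /A /= xy Zy ltxx.
    apply/eqP; rewrite gagw_sqr /= mulf_neq0 ?mulf_neq0 ?invr_neq0// gt_eqF// powR_gt0//.
  have : (mu3 A * mu3 Zn = 0)%E by rewrite -nAZ /leb6 product_measure1E.
  move/eqP; rewrite mule_eq0 (negbTE A0) /= => /eqP Zn0.
  by exists Zn; split=> // x /= /contrapT.
have : {ae mu3, forall x, forall n : nat, ~ (Z x /\ 0 < bump n.+1%:R x)} by exact/ae_foralln.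
move=> nZ'; apply: (@ae_mono _ _ _ mu3) (ae_and u_ge0 nZ') => x [ux hx].
rewrite lt_neqAle ux andbT eq_sym; apply/eqP => ux0.
apply: (hx (Num.bound (md 0 x))); split=> //.
rewrite /bump lt_max; apply/orP; right; rewrite subr_gt0.
by rewrite (lt_trans (archi_boundP (md_ge0 _ _)))// ltr_nat.
Qed.

End StrongMaximum.

Lemma weak_solution_positive (R : realType) (s V0 m0 q theta : R) (M f : R -> R)
  (u : R3 R -> R) : kirchhoff_problem s V0 m0 q theta M f ->
  weak_solution s V0 M f u -> 0 < normV s V0 u -> positive_ae u.
Proof.
move=> H [Hu sol] Nu; have V0p := kp_V0 H.
have f0 := f_ge0 (kp_fc H) (kp_fneg H) (kp_f3 H).
have Mp : 0 < M (normV s V0 u).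
  by apply: lt_le_trans (kp_m0 H) _; apply: (kp_M1 H); exact: ltW.
have super w : Hs s w -> (forall x, 0 <= w x) -> 0 <= bform s V0 u w.
  move=> Hw w0; rewrite -(pmulr_rge0 _ Mp); have -> := sol w Hw.
  by apply: Rintegral_ge0 => x _; rewrite mulr_ge0.
pose w x := Num.max 0 (- u x).
have w0 x : 0 <= w x by rewrite le_max lexx.
(* The second inequality, integrated against the kernel, gives [bform u w <= - normV w]; together
   with [0 <= bform u w] it forces [w] to vanish. *)
have wu (a b : R) : `|Num.max 0 (- a) - Num.max 0 (- b)| <= `|a - b| /\
    (a - b) * (Num.max 0 (- a) - Num.max 0 (- b)) <= - (Num.max 0 (- a) - Num.max 0 (- b)) ^+ 2.
  have h1 := ler_norm (a - b); have h2 := ler_norm (- (a - b)); rewrite normrN in h2.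
  clear -h1 h2; by have [a0|a0] := leP (- a) 0; have [b0|b0] := leP (- b) 0; split;
    rewrite ?ler_norml; try (apply/andP; split); nra.
have Hw : Hs s w.
  apply: (Hs_contraction _ Hu) => [|x|x y]; last by case: (wu (u x) (u y)).
    by apply: measurable_maxr => //; apply: measurableT_comp => //; exact: Hs_meas Hu.
  have [h _] := wu (u x) 0; rewrite oppr0 maxxx subr0 addr0 in h; exact: h.
have Nw : normV s V0 w <= 0.
  rewrite -oppr_ge0 (le_trans (super w Hw w0))//.
  have [i1 i2] := bform_intg V0 Hu Hw; have [j1 j2] := bform_intg V0 Hw Hw.
  have opp2 (a b : R) : - (a + b) = -1 * a + -1 * b by ring.
  rewrite normVE !bformE opp2 -!RintegralZl//.
  apply: lerD; apply: le_Rint => //; try exact: intgZ.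
    move=> z; rewrite /quot; have [_ h] := wu (u z.1) (u z.2).
    have := ler_wpM2r (sqr_ge0 (gagw s z)) h; rewrite /w; lra.
  move=> x; have [_] := wu (u x) 0; rewrite oppr0 maxxx subr0 addr0 => h.
  have := ler_wpM2l (ltW V0p) h; rewrite /w; lra.
have u0 : {ae @leb3 R, forall x, 0 <= u x}.
  apply: (@ae_mono _ _ _ (@leb3 R)) (normV_eq0 V0p Hw Nw) => x wx.
  by rewrite -oppr_le0 -wx /w le_max lexx orbT.
apply: (strong_maximum (kp_s0 H) (kp_s1 H) V0p Hu super u0) => uz.
(* If [u] vanished almost everywhere, the equation tested with [u] itself would give
   [M (normV u) * normV u = 0]. *)
have int0 : Rintegral (@leb3 R) setT (fun x => f (u x) * u x) = 0.
  have -> : 0 = Rintegral (@leb3 R) setT (fun=> 0) by rewrite Rintegral_cst// mul0r.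
  congr fine; apply: ae_eq_integral => //.
    by apply/measurable_EFinP; exact: (intg_measurable (nonlin_intg H Hu Hu)).
  by apply: (@ae_mono _ _ _ (@leb3 R)) uz => x ux _; rewrite ux mulr0.
have e : M (normV s V0 u) * bform s V0 u u = 0 := etrans (sol u Hu) int0.
by have := mulr_gt0 Mp Nu; rewrite [X in _ * X]normVE e ltxx.
Qed.

Theorem theorem4p6 (R : realType) (s V0 m0 q theta : R) (M f : R -> R) :
  3 / 4 < s -> s < 1 -> 0 < V0 ->
  (* hypotheses on M *)
  {within `[0, +oo[, continuous M} ->
  0 < m0 ->
  (forall t, 0 <= t -> m0 <= M t) ->                                 (* M1 *)
  (forall t1 t2, 0 <= t1 -> t1 < t2 -> M t1 < M t2) ->               (* M2 *)
  (forall t1 t2, 0 < t2 -> t2 <= t1 ->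
     M t1 / t1 - M t2 / t2 <= m0 * (t1^-1 - t2^-1)) ->                (* M3 *)
  (* hypotheses on f *)
  continuous f ->
  (forall t, t < 0 -> f t = 0) ->
  (fun t => f t / t ^+ 3) @ 0^'+ --> 0 ->                            (* f1 *)
  4 < q -> q < 6 / (3 - 2 * s) ->
  (fun t => f t / t `^ (q - 1)) @ +oo --> 0 ->                       (* f2 *)
  4 < theta -> theta < 6 / (3 - 2 * s) ->
  (forall t, 0 < t -> 0 < theta * primF f t /\
                      theta * primF f t <= f t * t) ->                (* f3 *)
  (forall t1 t2, 0 < t1 -> t1 <= t2 ->
     f t1 / t1 ^+ 3 <= f t2 / t2 ^+ 3) ->                            (* f4 *)
  exists u : R3 R -> R, weak_solution s V0 M f u /\ positive_ae u.
Proof.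
move=> s34 s1 V0p Mc m0p M1 M2 M3 fc fneg f1 q4 q6 f2 th _ f3 f4.
have H : kirchhoff_problem s V0 m0 q theta M f by split => //; lra.
have [u [sol Nu]] := nehari_ground_state H.
by exists u; split=> //; exact: weak_solution_positive H sol Nu.
Qed.
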